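(* Let $n\ge 1$ and let $\mathrm{TL}(B_n)$ be the type $B$ Temperley--Lieb algebra over $\mathbb{C}(q)$ with loop parameter $\delta=q+q^{-1}$. There exist two idempotents $b_{n,+},b_{n,-}\in\mathrm{TL}(B_n)$ such that, under the identification $\mathrm{TL}(B_n)\cong\mathrm{End}_{U^\iota}(V^{\otimes n})$ described in the context, $b_{n,+}$ is the projection of $V^{\otimes n}$ onto $L([n])$ and $b_{n,-}$ is the projection onto $L(-[n])$ (along the other isotypic components). They are uniquely characterized as follows: $b_{n,+}$ is the unique non-zero idempotent of $\mathrm{TL}(B_n)$ with $U_ib_{n,+}=0=b_{n,+}U_i$ for all $1\le i\le n-1$ and $b_{n,+}s_0=b_{n,+}=s_0b_{n,+}$; and $b_{n,-}$ is the unique non-zero idempotent of $\mathrm{TL}(B_n)$ with $U_ib_{n,-}=0=b_{n,-}U_i$ for all $1\le i\le n-1$ and $b_{n,-}s_0=-b_{n,-}=s_0b_{n,-}$. The sum $d_n:=b_{n,+}+b_{n,-}$ lies in $\mathrm{TL}(D_n)$ and is the unique non-zero idempotent of $\mathrm{TL}(D_n)$ annihilated from both sides by all generators $U_0,U_1,\dots,U_{n-1}$ of $\mathrm{TL}(D_n)$. It is given by the recursion $$d_1=1,\qquad d_2=1-\tfrac{1}{q+q^{-1}}U_1-\tfrac{1}{q+q^{-1}}U_0,\qquad d_{n+1}=d_n-\frac{q^{n-1}+q^{-(n-1)}}{q^n+q^{-n}}\,d_nU_nd_n\quad(n\ge2),$$ and all coefficients of $d_n$ with respect to the diagram basis, expanded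 as Laurent series in $q$, lie in $\mathbb{Z}[[q]][q^{-1}]$.
   Context: **Type $B$ Temperley--Lieb algebra.** For a commutative ring $k$ and $\delta\in k$, $\mathrm{TL}(B_n)=\mathrm{TL}(B_n,\delta)$ ($n\ge1$) is the unital associative $k$-algebra with generators $s_0,U_1,\dots,U_{n-1}$ and relations: $U_i^2=\delta U_i$; $U_iU_{i+1}U_i=U_i$ and $U_{i+1}U_iU_{i+1}=U_{i+1}$ for $1\le i\le n-2$; $U_iU_j=U_jU_i$ for $|i-j|\ge2$; $s_0^2=1$; $U_1s_0U_1=0$; $s_0U_i=U_is_0$ for $i\ge2$. $\mathrm{TL}(B_n)$ embeds in $\mathrm{TL}(B_{n+1})$ by sending generators to generators of the same name (adding a vertical strand on the right). $\mathrm{TL}(D_n)$ is the subalgebra of $\mathrm{TL}(B_n)$ generated by $U_0:=s_0U_1s_0,U_1,\dots,U_{n-1}$ (for $n=1$ there are no generators and $\mathrm{TL}(D_1)=k\cdot1$). **Diagram basis.** $\mathrm{TL}(B_n)$ is free over $k$ with basis the dotted Temperley--Lieb diagrams: crossingless matchings of $n+n$ points on two parallel horizontal lines, each strand carrying at most one dot, such that every dotted strand can be reached from the left side of the diagram by a curve not crossing any strand. Multiplication is vertical stacking, where two dots on one strand cancel, an undotted closed circle is replaced by $\delta$, and a diagram with a dotted closed circle is $0$. Here $U_i$ is the diagram with a cup and a cap at positions $i,i+1$ and vertical strands elsewhere, $s_0$ is the identity diagram with a dot on the first strand. **Representation theory.** Ground field $\mathbb{C}(q)$, $[n]=\frac{q^n-q^{-n}}{q-q^{-1}}$.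 $U_q(\mathfrak{gl}_2)$ has generators $E,F,D_1^{\pm1},D_2^{\pm1}$ with the usual relations ($D_1ED_1^{-1}=qE$, $D_2ED_2^{-1}=q^{-1}E$, $D_1FD_1^{-1}=q^{-1}F$, $D_2FD_2^{-1}=qF$, $D_1D_2=D_2D_1$, $EF-FE=\frac{K-K^{-1}}{q-q^{-1}}$, $K=D_1D_2^{-1}$) and comultiplication $\Delta(E)=E\otimes1+K\otimes E$, $\Delta(F)=F\otimes K^{-1}+1\otimes F$, $\Delta(D_i)=D_i\otimes D_i$. $V$ has basis $x,y$ with $Ey=x$, $Ex=0$, $Fx=y$, $Fy=0$, $D_1x=qx$, $D_1y=y$, $D_2x=x$, $D_2y=qy$. $U^\iota=U_q'(\mathfrak{gl}_1\times\mathfrak{gl}_1)$ is the subalgebra generated by $C^{\pm1}$, $C=D_1D_2$, and $B=q^{-1}EK^{-1}+F$. As $U^\iota$-module, $V^{\otimes n}=\bigoplus_{k=0}^n\binom nk L([n-2k])$, where $L([m])$ is one-dimensional with $B$ acting by $[m]$ and $C$ by $q^n$; so $L([n])$ and $L(-[n])$ each occur exactly once. **Identification.** Let $\cap:V\otimes V\to\mathbb{C}(q)$, $\cap(x\otimes x)=\cap(y\otimes y)=0$, $\cap(x\otimes y)=-q^{-1}$, $\cap(y\otimes x)=1$, and $\cup:\mathbb{C}(q)\to V\otimes V$, $\cup(1)=x\otimes y-q\,y\otimes x$. The isomorphism $\mathrm{TL}(B_n,q+q^{-1})\cong\mathrm{End}_{U^\iota}(V^{\otimes n})$ sends $s_0$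 to the map exchanging $x$ and $y$ in the first tensor factor and $U_i$ to $-(\mathrm{id}^{\otimes(i-1)}\otimes(\cup\circ\cap)\otimes\mathrm{id}^{\otimes(n-i-1)})$ (the sign is needed because $\cap\circ\cup=-(q+q^{-1})$). *)

(* Defs.v *)
(* Mathematical Components world, with the classical axioms of boolp and the
   real numbers of MathComp-Analysis (only [reals] is loaded). *)
From HB Require Import structures.
From mathcomp Require Import all_boot all_order all_algebra.
From mathcomp Require Import finmap boolp reals complex.
From mathcomp Require Import zify.
From mathcomp.multinomials Require Import monalg.

Set Implicit Arguments.
Unset Strict Implicit.
Unset Printing Implicit Defensive.

Import Order.TTheory GRing.Theory Num.Theory.

Local Open Scope ring_scope.
Local Open Scope quotient_scope.

(* ------------------------------------------------------------------------ *)
Section Generalities.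

Inductive gen_ideal (A : nzRingType) (rel : A -> A -> Prop) : A -> Prop :=
| gen_ideal_rel x y : rel x y -> gen_ideal rel (x - y)
| gen_ideal0 : gen_ideal rel 0
| gen_idealB x y : gen_ideal rel x -> gen_ideal rel y -> gen_ideal rel (x - y)
| gen_idealMl a x : gen_ideal rel x -> gen_ideal rel (a * x)
| gen_idealMr a x : gen_ideal rel x -> gen_ideal rel (x * a).

Inductive gen_subalg (k : nzRingType) (A : lalgType k) (S : A -> Prop) :
  A -> Prop :=
| gen_subalg_gen x : S x -> gen_subalg S x
| gen_subalg_scalar c : gen_subalg S c%:A
| gen_subalgD x y : gen_subalg S x -> gen_subalg S y -> gen_subalg S (x + y)
| gen_subalgM x y : gen_subalg S x -> gen_subalg S y -> gen_subalg S (x * y).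

Definition is_unique_nz_idempotent (A : nzRingType) (P : A -> Prop) (b : A) :=
  [/\ b != 0, b * b = b, P b
    & forall e : A, e != 0 -> e * e = e -> P e -> e = b].

Definition is_projection (k : fieldType) (W : vectType k) (p : 'End(W))
    (A C : {vspace W}) :=
  [/\ (A + C = fullv)%VS, (A :&: C = 0)%VS,
      forall v, v \in A -> p v = v & forall v, v \in C -> p v = 0].

Section KernelOperators.

Variables (k : comNzRingType) (I : finType) (M : I -> I -> k).

Definition kernel_fun (v : {ffun I -> k^o}) : {ffun I -> k^o} :=
  [ffun a => \sum_b M a b * v b].

Fact kernel_fun_linear : linear kernel_fun.
Proof.
move=> c u v; apply/ffunP=> a; rewrite !ffunE /GRing.scale /= mulr_sumr.
rewrite -big_split /=.
by apply: eq_bigr => b _; rewrite !ffunE mulrDr mulrCA.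
Qed.

HB.instance Definition _ :=
  GRing.isLinear.Build k {ffun I -> k^o} {ffun I -> k^o} _ kernel_fun
    kernel_fun_linear.

(* The endomorphism of the free module on I whose matrix has the entry M a b
   in row a and column b. *)
Definition kernel_op : 'End({ffun I -> k^o}) := linfun kernel_fun.

End KernelOperators.

Definition basis_vector (k : comNzRingType) (I : finType) (a : I) :
  {ffun I -> k^o} := [ffun b => (b == a)%:R].

Fact malg_scaleAr (k : comNzRingType) (M : monomType) (c : k)
  (x y : {malg k[M]}) : c *: (x * y) = x * (c *: y).
Proof.
have xc : c%:MP * x = x * c%:MP.
  rewrite !malgM_def fgmulUg fgmulgU.
  by apply: eq_bigr => w _; rewrite mulrC mul1m mulm1.
by rewrite -!mul_malgC mulrA xc mulrA.
Qed.

Section FreeLift.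

Variables (k : comNzRingType) (M : monomType) (V : lmodType k) (h : M -> V).

(* The linear extension of h to the monoid algebra. *)
Definition free_lift (f : {malg k[M]}) : V := \sum_(w <- msupp f) f@_w *: h w.

Fact free_liftEw (d : {fset M}) f : (msupp f `<=` d)%fset ->
  free_lift f = \sum_(w <- d) f@_w *: h w.
Proof.
move=> le; rewrite [LHS](big_fset_incl _ le) // => w _ /mcoeff_outdom ->.
by rewrite scale0r.
Qed.

Fact free_lift_linear : linear free_lift.
Proof.
move=> c f g; pose d := (msupp f `|` msupp g `|` msupp (c *: f + g))%fset.
rewrite (@free_liftEw d (c *: f + g)) ?fsubsetUr //.
rewrite (@free_liftEw d f); last by rewrite /d -fsetUA fsubsetUl.
rewrite (@free_liftEw d g); last by rewrite /d fsetUAC fsubsetUr.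
rewrite scaler_sumr -big_split /=; apply: eq_bigr => w _.
by rewrite mcoeffD mcoeffZ scalerDl scalerA.
Qed.

HB.instance Definition _ :=
  GRing.isLinear.Build k {malg k[M]} V _ free_lift free_lift_linear.

Fact free_liftU w c : free_lift << c *g w >> = c *: h w.
Proof. by rewrite (free_liftEw msuppU_le) big_seq_fset1 mcoeffUU. Qed.

End FreeLift.
Fact free_liftM (k : comNzRingType) (M : monomType) (V : lmodType k) (h : M -> V)
  (mul : V -> V -> V) :
  (forall x, linear (mul x)) -> (forall y, linear (mul^~ y)) ->
  (forall w w', h (mmul w w') = mul (h w) (h w')) -> 
  forall f g, free_lift h (f * g) = mul (free_lift h f) (free_lift h g).
Proof.
move=> mr ml hM f g.
pose Hr x := GRing.isLinear.Build k V V _ (mul x) (mr x).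
pose Hl x := GRing.isLinear.Build k V V _ (mul^~ x) (ml x).
pose r x : {linear V -> V} := HB.pack (mul x) (Hr x).
pose l x : {linear V -> V} := HB.pack (mul^~ x) (Hl x).
have sr x I (s : seq I) (F : I -> V) : mul x (\sum_(i <- s) F i) = \sum_(i <- s) mul x (F i).
  exact: (raddf_sum (r x)).
have sl x I (s : seq I) (F : I -> V) : mul (\sum_(i <- s) F i) x = \sum_(i <- s) mul (F i) x.
  exact: (raddf_sum (l x)).
have zr x c y : mul x (c *: y) = c *: mul x y by exact: (linearZ_LR (r x) c y).
have zl x c y : mul (c *: y) x = c *: mul y x by exact: (linearZ_LR (l x) c y).
have E x : free_lift h x = \sum_(w <- msupp x) x@_w *: h w by [].
rewrite malgME raddf_sum /= (E f) sl; apply: eq_bigr => w _.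
rewrite raddf_sum /= (E g) sr; apply: eq_bigr => w' _.
by rewrite free_liftU hM zr zl scalerA mulrC.
Qed.

End Generalities.

(* ------------------------------------------------------------------------ *)
(* TL(B_n) is the free algebra on the letters 0, ..., n-1 modulo relations;
   the letter 0 stands for s_0 and the letter i > 0 for U_i. *)
Section TypeB.

Variables (k : comNzRingType) (delta : k) (n : nat).

Local Notation freeAlg := {malg k[{fmonom 'I_n}]}.

Definition letter (i : 'I_n) : freeAlg := << fmu i >>.

Inductive TLB_rel : freeAlg -> freeAlg -> Prop :=
| TLB_UU (i : 'I_n) : (0 < i)%N ->
    TLB_rel (letter i * letter i) (delta *: letter i)
| TLB_UUU (i j : 'I_n) : (0 < i)%N -> (0 < j)%N ->
    (i.+1 = j :> nat \/ j.+1 = i :> nat) ->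
    TLB_rel (letter i * letter j * letter i) (letter i)
| TLB_UUC (i j : 'I_n) : (0 < i)%N -> (i.+2 <= j)%N ->
    TLB_rel (letter i * letter j) (letter j * letter i)
| TLB_ss (z : 'I_n) : z = 0%N :> nat ->
    TLB_rel (letter z * letter z) 1
| TLB_UsU (z i : 'I_n) : z = 0%N :> nat -> i = 1%N :> nat ->
    TLB_rel (letter i * letter z * letter i) 0
| TLB_sU (z i : 'I_n) : z = 0%N :> nat -> (2 <= i)%N ->
    TLB_rel (letter z * letter i) (letter i * letter z).

Definition TLB_ideal : {pred freeAlg} := fun x => `[< gen_ideal TLB_rel x >].

Fact TLB_ideal_zmod_closed : zmod_closed TLB_ideal.
Proof.
split; first by apply/asboolP; exact: gen_ideal0.
by move=> x y /asboolP Ix /asboolP Iy; apply/asboolP; exact: gen_idealB.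
Qed.

HB.instance Definition _ :=
  GRing.isZmodClosed.Build freeAlg TLB_ideal TLB_ideal_zmod_closed.

Fact TLB_idealMl a x : x \in TLB_ideal -> a * x \in TLB_ideal.
Proof. by move/asboolP=> Ix; apply/asboolP; exact: gen_idealMl. Qed.

Fact TLB_idealMr a x : x \in TLB_ideal -> x * a \in TLB_ideal.
Proof. by move/asboolP=> Ix; apply/asboolP; exact: gen_idealMr. Qed.

(* The character s_0 |-> 1, U_i |-> 0 shows that the quotient is not zero. *)
Let chi_word (w : {fmonom 'I_n}) : k := (all (fun i : 'I_n => i == 0%N :> nat) w)%:R.

Let chi_word_morph : mmorphism chi_word.
Proof.
split; last by rewrite /chi_word fm1.
by move=> u v; rewrite /chi_word fmM all_cat -natrM mulnb.
Qed.

HB.instance Definition _ := isMultiplicative.Build _ _ chi_word chi_word_morph.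

Fact TLB_ideal1 : 1 \notin TLB_ideal.
Proof.
have [chi [chiM chi1 chi0 chiB [chiZ chiL]]] : exists chi : freeAlg -> k,
    [/\ {morph chi : x y / x * y}, chi 1 = 1, chi 0 = 0,
        {morph chi : x y / x - y}
      & (forall c x, chi (c *: x) = c * chi x)
        /\ forall i, chi (letter i) = (i == 0%N :> nat)%:R].
  exists (mmap idfun chi_word); split.
  - exact: rmorphM.
  - exact: rmorph1.
  - exact: raddf0.
  - exact: raddfB.
  - split=> [c x|i]; first exact: mmapZ.
    by rewrite /letter mmapU /= mul1r /chi_word fmU /= andbT.
suff chiI x : gen_ideal TLB_rel x -> chi x = 0.
  by apply/negP=> /asboolP/chiI/eqP; rewrite chi1 oner_eq0.
elim=> {x} [x y rxy||x y _ ex _ ey|a x _ ex|a x _ ex] //; last 3 first.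
- by rewrite chiB ex ey subrr.
- by rewrite chiM ex mulr0.
- by rewrite chiM ex mul0r.
rewrite chiB; apply/eqP; rewrite subr_eq0; apply/eqP.
case: rxy => [i i0|i j i0 j0 _|i j i0 ij|z z0|z i z0 i1|z i z0 i2].
- by rewrite chiM chiZ chiL gtn_eqF // !mulr0.
- by rewrite chiM chiM chiL gtn_eqF // mulr0.
- exact: etrans (chiM _ _) (etrans (mulrC _ _) (esym (chiM _ _))).
- by rewrite chiM chiL chi1 z0 eqxx mulr1.
- by rewrite chiM chi0 chiL i1 mulr0.
- exact: etrans (chiM _ _) (etrans (mulrC _ _) (esym (chiM _ _))).
Qed.

Definition TLB : Type := Quotient.quot TLB_ideal.
HB.instance Definition _ := GRing.Zmodule.on TLB.

Definition TLB_pi : freeAlg -> TLB := \pi_(Quotient.quot TLB_ideal).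
Definition TLB_repr : TLB -> freeAlg := @repr _ (Quotient.quot TLB_ideal).

Fact TLB_piP x y : TLB_pi x = TLB_pi y <-> x - y \in TLB_ideal.
Proof.
by rewrite (Quotient.idealrBE TLB_ideal); split=> [/eqP//|/eqP//].
Qed.

Fact TLB_reprK : cancel TLB_repr TLB_pi.
Proof. exact: reprK. Qed.

Fact TLB_pi_ind (P : TLB -> Prop) : (forall x, P (TLB_pi x)) -> forall a, P a.
Proof. by move=> PP a; rewrite -[a]TLB_reprK. Qed.

Fact TLB_pi_repr x : TLB_repr (TLB_pi x) - x \in TLB_ideal.
Proof. by apply/TLB_piP; rewrite TLB_reprK. Qed.

Fact TLB_piD : {morph TLB_pi : x y / x + y}.
Proof. by move=> x y; rewrite /TLB_pi piE. Qed.

Definition TLB_one : TLB := TLB_pi 1.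
Definition TLB_mul (a b : TLB) : TLB := TLB_pi (TLB_repr a * TLB_repr b).
Definition TLB_scale (c : k) (a : TLB) : TLB := TLB_pi (c *: TLB_repr a).

Fact TLB_piM x y : TLB_pi (x * y) = TLB_mul (TLB_pi x) (TLB_pi y).
Proof.
apply/esym/TLB_piP; set x' := TLB_repr _; set y' := TLB_repr _.
have -> : x' * y' - x * y = (x' - x) * y' + x * (y' - y).
  by rewrite mulrBl mulrBr addrA subrK.
by apply: rpredD; [apply: TLB_idealMr|apply: TLB_idealMl]; apply: TLB_pi_repr.
Qed.

Fact TLB_piZ c x : TLB_pi (c *: x) = TLB_scale c (TLB_pi x).
Proof.
apply/esym/TLB_piP; rewrite -scalerBr -mul_malgC.
exact/TLB_idealMl/TLB_pi_repr.
Qed.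

Fact TLB_mulA : associative TLB_mul.
Proof.
elim/TLB_pi_ind=> x; elim/TLB_pi_ind=> y; elim/TLB_pi_ind=> z.
by rewrite -!TLB_piM mulrA.
Qed.

Fact TLB_mul1 : left_id TLB_one TLB_mul.
Proof. by elim/TLB_pi_ind=> x; rewrite -TLB_piM mul1r. Qed.

Fact TLB_1mul : right_id TLB_one TLB_mul.
Proof. by elim/TLB_pi_ind=> x; rewrite -TLB_piM mulr1. Qed.

Fact TLB_mulDl : left_distributive TLB_mul +%R.
Proof.
elim/TLB_pi_ind=> x; elim/TLB_pi_ind=> y; elim/TLB_pi_ind=> z.
by rewrite -!(TLB_piM, TLB_piD) mulrDl.
Qed.

Fact TLB_mulDr : right_distributive TLB_mul +%R.
Proof.
elim/TLB_pi_ind=> x; elim/TLB_pi_ind=> y; elim/TLB_pi_ind=> z.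
by rewrite -!(TLB_piM, TLB_piD) mulrDr.
Qed.

Fact TLB_pi0 : TLB_pi 0 = 0.
Proof. by apply: (addrI (TLB_pi 0)); rewrite -TLB_piD !addr0. Qed.

Fact TLB_one_neq0 : TLB_one != 0.
Proof.
apply/eqP; rewrite -TLB_pi0 => /TLB_piP; rewrite subr0.
exact/negP/TLB_ideal1.
Qed.

HB.instance Definition _ := GRing.Zmodule_isNzRing.Build TLB
  TLB_mulA TLB_mul1 TLB_1mul TLB_mulDl TLB_mulDr TLB_one_neq0.

Fact TLB_scaleA a b x : TLB_scale a (TLB_scale b x) = TLB_scale (a * b) x.
Proof. by elim/TLB_pi_ind: x => x; rewrite -!TLB_piZ scalerA. Qed.

Fact TLB_scale1 : left_id 1 TLB_scale.
Proof. by elim/TLB_pi_ind=> x; rewrite -TLB_piZ scale1r. Qed.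

Fact TLB_scaleDr : right_distributive TLB_scale +%R.
Proof.
move=> c; elim/TLB_pi_ind=> x; elim/TLB_pi_ind=> y.
by rewrite -!(TLB_piZ, TLB_piD) scalerDr.
Qed.

Fact TLB_scaleDl x : {morph TLB_scale^~ x : a b / a + b}.
Proof.
by elim/TLB_pi_ind: x => x a b; rewrite -!(TLB_piZ, TLB_piD) scalerDl.
Qed.

HB.instance Definition _ := GRing.Zmodule_isLmodule.Build k TLB
  TLB_scaleA TLB_scale1 TLB_scaleDr TLB_scaleDl.

Fact TLB_scaleAl c (a b : TLB) : c *: (a * b) = (c *: a) * b.
Proof.
elim/TLB_pi_ind: a => x; elim/TLB_pi_ind: b => y.
rewrite -[_ * _]TLB_piM -[LHS]TLB_piZ -[_ *: TLB_pi x]TLB_piZ.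
by rewrite -[RHS]TLB_piM scalerAl.
Qed.

HB.instance Definition _ := GRing.Lmodule_isLalgebra.Build k TLB TLB_scaleAl.

Fact TLB_scaleAr c (a b : TLB) : c *: (a * b) = a * (c *: b).
Proof.
elim/TLB_pi_ind: a => x; elim/TLB_pi_ind: b => y.
rewrite -[_ * _]TLB_piM -[LHS]TLB_piZ -[_ *: TLB_pi y]TLB_piZ.
by rewrite -[RHS]TLB_piM malg_scaleAr.
Qed.

HB.instance Definition _ := GRing.Lalgebra_isAlgebra.Build k TLB TLB_scaleAr.

(* Junk value 0 when i >= n. *)
Definition TLB_gen (i : nat) : TLB :=
  if insub i is Some j then TLB_pi (letter j) else 0.

End TypeB.

(* ------------------------------------------------------------------------ *)
Section TLBRelations.

Variables (k : comNzRingType) (delta : k) (n : nat).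

Local Notation g := (TLB_gen delta n).

Fact TLB_genE (i : 'I_n) : g i = TLB_pi delta (letter k i).
Proof. by rewrite /TLB_gen valK. Qed.

Fact TLB_gen_ord i (ilt : (i < n)%N) :
  g i = TLB_pi delta (letter k (Ordinal ilt)).
Proof. by rewrite -TLB_genE. Qed.

Fact TLB_pi_rel (x y : {malg k[{fmonom 'I_n}]}) :
  TLB_rel delta x y -> TLB_pi delta x = TLB_pi delta y.
Proof. by move=> xy; apply/TLB_piP/asboolP; apply: gen_ideal_rel. Qed.

Fact TLB_gen_UU i : (0 < i)%N -> (i < n)%N -> g i * g i = delta *: g i.
Proof.
move=> i0 ilt; rewrite !(TLB_gen_ord ilt) -[LHS]TLB_piM -[RHS]TLB_piZ.
exact/TLB_pi_rel/TLB_UU.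
Qed.

Fact TLB_gen_UUU i j : (0 < i)%N -> (i < n)%N -> (0 < j)%N -> (j < n)%N ->
  i.+1 = j \/ j.+1 = i -> g i * g j * g i = g i.
Proof.
move=> i0 ilt j0 jlt ij; rewrite !(TLB_gen_ord ilt) (TLB_gen_ord jlt).
by rewrite -[_ * _ in X in X * _]TLB_piM -[LHS]TLB_piM; apply/TLB_pi_rel/TLB_UUU.
Qed.

Fact TLB_gen_UUC i j : (0 < i)%N -> (i.+2 <= j)%N -> (j < n)%N ->
  g i * g j = g j * g i.
Proof.
move=> i0 ij jlt; have ilt : (i < n)%N by lia.
rewrite (TLB_gen_ord ilt) (TLB_gen_ord jlt) -[LHS]TLB_piM -[RHS]TLB_piM.
exact/TLB_pi_rel/TLB_UUC.
Qed.

Fact TLB_gen_ss : (0 < n)%N -> g 0%N * g 0%N = 1.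
Proof.
move=> n0; rewrite (TLB_gen_ord n0) -[LHS]TLB_piM.
exact/TLB_pi_rel/TLB_ss.
Qed.

Fact TLB_gen_UsU : (1 < n)%N -> g 1%N * g 0%N * g 1%N = 0.
Proof.
move=> n1; have n0 : (0 < n)%N by lia.
rewrite !(TLB_gen_ord n1) (TLB_gen_ord n0).
rewrite -[_ * _ in X in X * _]TLB_piM -[LHS]TLB_piM -(TLB_pi0 delta n).
exact/TLB_pi_rel/TLB_UsU.
Qed.

Fact TLB_gen_sU i : (2 <= i)%N -> (i < n)%N -> g 0%N * g i = g i * g 0%N.
Proof.
move=> i2 ilt; have n0 : (0 < n)%N by lia.
rewrite (TLB_gen_ord ilt) (TLB_gen_ord n0) -[LHS]TLB_piM -[RHS]TLB_piM.
exact/TLB_pi_rel/TLB_sU.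
Qed.

End TLBRelations.

Section LiftToTLB.

Variables (k : comNzRingType) (delta : k) (n : nat) (V : lmodType k).
Variables (h : {fmonom 'I_n} -> V) (mul : V -> V -> V).
Hypothesis mulr_lin : forall x, linear (mul x).
Hypothesis mull_lin : forall y, linear (mul^~ y).
Hypothesis hM : forall w w', h (mmul w w') = mul (h w) (h w').
Hypothesis h_rel : forall x y, TLB_rel delta x y -> free_lift h x = free_lift h y.

Fact free_lift_ideal f : gen_ideal (@TLB_rel k delta n) f -> free_lift h f = 0.
Proof.
have mul0 x : mul x 0 = 0.
  by have := mulr_lin x (-1) 0 0; rewrite scaler0 addr0 scaleN1r addNr.
have mul0l x : mul 0 x = 0.
  by have := mull_lin x (-1) 0 0; rewrite scaler0 addr0 scaleN1r addNr.
elim=> {f} [x y /h_rel e||x y _ ex _ ey|a x _ ex|a x _ ex].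
- by rewrite raddfB /= e subrr.
- exact: raddf0.
- by rewrite raddfB /= ex ey subrr.
- by rewrite (free_liftM mulr_lin mull_lin hM) ex mul0.
- by rewrite (free_liftM mulr_lin mull_lin hM) ex mul0l.
Qed.

Fact free_lift_repr f : free_lift h (TLB_repr (TLB_pi delta f)) = free_lift h f.
Proof.
have /asboolP/free_lift_ideal := TLB_pi_repr delta f.
by rewrite raddfB /= => /eqP; rewrite subr_eq0 => /eqP.
Qed.

End LiftToTLB.

Section MapsOutOfTLB.

Variables (k : comNzRingType) (delta : k).

Definition word_image (n : nat) (w : {fmonom 'I_n}) : TLB delta n.+1 :=
  \prod_(i <- fmonom_val w) TLB_gen delta n.+1 i.

(* The homomorphism that sends generators to generators of the same name; see
   TLB_embedM, TLB_embed1, TLB_embedZ, TLB_embedD, TLB_embed_gen. *)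
Definition TLB_embed (n : nat) (a : TLB delta n) : TLB delta n.+1 :=
  free_lift (@word_image n) (TLB_repr a).

(* The representation of TL(B_n) on W in which the letter i acts by op i. It
   does not depend on the choice of a representative of a in the free algebra
   if the operators op i satisfy the defining relations (free_lift_repr). *)
Definition TLB_rep (n : nat) (W : vectType k) (op : 'I_n -> 'End(W))
    (a : TLB delta n) : 'End(W) :=
  free_lift (fun w => foldr (fun i g => (op i \o g)%VF) \1%VF (fmonom_val w))
    (TLB_repr a).

Fact word_imageM n (w w' : {fmonom 'I_n}) :
  word_image (mmul w w') = word_image w * word_image w'.
Proof. by rewrite /word_image fmM big_cat. Qed.

Fact TLB_mulr_linear n (x : TLB delta n) : linear ( *%R x).
Proof. by move=> c u v; rewrite mulrDr scalerAr. Qed.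

Fact TLB_mull_linear n (y : TLB delta n) : linear ( *%R^~ y).
Proof. by move=> c u v; rewrite mulrDl scalerAl. Qed.

Fact word_image_rel n x y : TLB_rel delta x y ->
  free_lift (@word_image n) x = free_lift (@word_image n) y.
Proof.
pose e := free_lift (@word_image n).
have eM u v : e (u * v) = e u * e v.
  apply: free_liftM; [exact: TLB_mulr_linear|exact: TLB_mull_linear|].
  exact: word_imageM.
have eL (i : 'I_n) : e (letter k i) = TLB_gen delta n.+1 i.
  by rewrite /e free_liftU scale1r /word_image fmU big_seq1.
have lt (i : 'I_n) : (i < n.+1)%N by rewrite ltnW // ltnS.
rewrite -/(e x) -/(e y).
case=> [i i0|i j i0 j0 ij|i j i0 ij|z z0|z i z0 i1|z i z0 i2].
- by rewrite eM /e linearZ /= -/e eL TLB_gen_UU.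
- by rewrite eM eM !eL TLB_gen_UUU.
- by apply: etrans (eM _ _) (etrans _ (esym (eM _ _))); rewrite !eL TLB_gen_UUC.
- rewrite eM !eL z0 TLB_gen_ss // /e free_liftU scale1r /word_image fm1.
  by rewrite big_nil.
- rewrite eM eM !eL z0 i1 TLB_gen_UsU; first by rewrite /e raddf0.
  by rewrite -[1%N]i1.
- apply: etrans (eM _ _) (etrans _ (esym (eM _ _))).
  by rewrite !eL z0 TLB_gen_sU.
Qed.

Fact TLB_embed_pi n f :
  TLB_embed (TLB_pi delta f) = free_lift (@word_image n) f.
Proof.
apply: free_lift_repr; first exact: TLB_mulr_linear.
- exact: TLB_mull_linear.
- exact: word_imageM.
- exact: word_image_rel.
Qed.

Fact TLB_embedD n : {morph @TLB_embed n : a b / a + b}.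
Proof.
elim/TLB_pi_ind=> x; elim/TLB_pi_ind=> y.
by rewrite -TLB_piD !TLB_embed_pi raddfD.
Qed.

Fact TLB_embedZ n c : {morph @TLB_embed n : a / c *: a}.
Proof. by elim/TLB_pi_ind=> x; rewrite -[_ *: _]TLB_piZ !TLB_embed_pi linearZ. Qed.

Fact TLB_embedM n : {morph @TLB_embed n : a b / a * b}.
Proof.
elim/TLB_pi_ind=> x; elim/TLB_pi_ind=> y.
rewrite -[_ * _ in LHS]TLB_piM !TLB_embed_pi; apply: free_liftM.
- exact: TLB_mulr_linear.
- exact: TLB_mull_linear.
- exact: word_imageM.
Qed.

Fact TLB_embed1 n : @TLB_embed n 1 = 1.
Proof.
rewrite -[X in TLB_embed X]/(@TLB_pi k delta n 1) TLB_embed_pi free_liftU scale1r.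
by rewrite /word_image fm1 big_nil.
Qed.

Fact TLB_embed_gen n i : (i < n)%N ->
  TLB_embed (TLB_gen delta n i) = TLB_gen delta n.+1 i.
Proof.
move=> ilt; rewrite (TLB_gen_ord delta ilt) TLB_embed_pi free_liftU scale1r.
by rewrite /word_image fmU big_seq1.
Qed.

Definition U0 (n : nat) : TLB delta n :=
  TLB_gen delta n 0 * TLB_gen delta n 1 * TLB_gen delta n 0.

Definition TLD_generator (n : nat) (x : TLB delta n) : Prop :=
  (2 <= n)%N /\ x = U0 n
  \/ exists i, [/\ (1 <= i)%N, (i < n)%N & x = TLB_gen delta n i].

Definition TLD (n : nat) : TLB delta n -> Prop := gen_subalg (@TLD_generator n).

End MapsOutOfTLB.

(* ------------------------------------------------------------------------ *)
(* A dotted diagram on n + n points. Going around the rectangle from the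
   middle of its left side, the boundary points are numbered 0, ..., 2n-1: the
   top points from left to right are 0, ..., n-1 and the bottom points from
   left to right are 2n-1, ..., n. In x = (m, T) the map m exchanges the two
   ends of each strand, and T consists of the ends of the dotted strands. The
   second condition says that no two strands cross; given this, a strand can
   be reached from the left side iff no strand r -- m r separates its ends
   from the left side, which is the last condition on dotted strands. *)
Section Diagrams.

Variable n : nat.

Definition is_diagram
    (x : {ffun 'I_n.*2 -> 'I_n.*2} * {set 'I_n.*2}) : bool :=
  let: (m, T) := x in
  [&& [forall p, (m (m p) == p) && (m p != p)],
      [forall p : 'I_n.*2, forall r : 'I_n.*2,
         ~~ [&& (p < r)%N, (r < m p)%N & (m p < m r)%N]],
      [forall p in T, m p \in T]
    & [forall p in T, forall r : 'I_n.*2, ~~ ((r < p)%N && (p < m r)%N)]].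

Record diagram := Diagram {
  diagram_val : {ffun 'I_n.*2 -> 'I_n.*2} * {set 'I_n.*2};
  diagram_valP : is_diagram diagram_val }.

HB.instance Definition _ := [isSub for diagram_val].
HB.instance Definition _ := [Finite of diagram by <:].

Definition mate (D : diagram) : {ffun 'I_n.*2 -> 'I_n.*2} := (val D).1.
Definition dots (D : diagram) : {set 'I_n.*2} := (val D).2.

Record diagram_spec (m : 'I_n.*2 -> 'I_n.*2) (T : {set 'I_n.*2}) : Prop :=
  DiagramSpec {
    mateK : forall p, m (m p) = p;
    mate_neq : forall p : 'I_n.*2, m p <> p :> nat;
    mate_nc : forall p r : 'I_n.*2, ~ [/\ (p < r)%N, (r < m p)%N & (m p < m r)%N];
    dots_mate : forall p : 'I_n.*2, p \in T -> m p \in T;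
    dots_left : forall p r : 'I_n.*2, p \in T -> ~ ((r < p)%N /\ (p < m r)%N) }.

Fact is_diagramP (m : {ffun 'I_n.*2 -> 'I_n.*2}) T :
  reflect (diagram_spec m T) (is_diagram (m, T)).
Proof.
apply: (iffP and4P) => [[/forallP mP /forallP ncP dP lP]|[mK mN nc dm dl]].
  split=> [p|p|p r [pr rp mm]|p pS|p r pS [rp pr]].
  - by have /andP[/eqP] := mP p.
  - by have /andP[_ /eqP mp] := mP p; move=> /val_inj.
  - by have /forallP/(_ r) := ncP p; rewrite pr rp mm.
  - exact: (forall_inP dP).
  - by have /forallP/(_ r) := forall_inP lP p pS; rewrite rp pr.
split.
- by apply/forallP=> p; rewrite mK eqxx; apply/eqP=> /(congr1 val); apply: mN.
- apply/forallP=> p; apply/forallP=> r; apply/negP=> /and3P[pr rp mm].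
  exact: (nc p r).
- by apply/forall_inP=> p; apply: dm.
- apply/forall_inP=> p pS; apply/forallP=> r; apply/negP=> /andP[rp pr].
  exact: (dl p r pS).
Qed.

Fact diagramP (D : diagram) : diagram_spec (mate D) (dots D).
Proof. by apply/is_diagramP; case: D => [[m T] DP]. Qed.

(* Put a new dot on the strand at p; two dots on a strand cancel. *)
Definition toggle_dot (p : 'I_n.*2) (D : diagram) :=
  (mate D, [set r | (r \in dots D) (+) ((r == p) || (r == mate D p))]).

Fact toggle_dotP (p : 'I_n.*2) (D : diagram) :
  p = 0%N :> nat -> is_diagram (toggle_dot p D).
Proof.
case: (diagramP D) => mK mN nc dm dl p0; apply/is_diagramP; split=> //.
  move=> r; rewrite !inE (inj_eq (can_inj mK)) (can2_eq mK mK).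
  suff -> : (mate D r \in dots D) = (r \in dots D) by rewrite orbC.
  by apply/idP/idP => /dm; rewrite ?mK.
move=> r t; rewrite !inE; have [rS _|_ /=] := boolP (r \in dots D).
  exact: dl.
case/orP=> /eqP-> [lt1 lt2]; first by rewrite p0 in lt1.
have [tp|tNp] := eqVneq t p; first by rewrite tp ltnn in lt2.
by apply: (nc p t); split=> //; rewrite ltn_neqAle eq_sym val_eqE tNp p0.
Qed.

(* Stack a cup-cap diagram on top of D: its cap joins the neighbouring top
   points l and r of D (which are not already joined, mate D l != r), and its
   cup becomes the strand between the new points l and r. *)
Definition join_mate (l r : 'I_n.*2) (D : diagram) :=
  [ffun p => if p == l then r else if p == r then l
             else if p == mate D l then mate D r
             else if p == mate D r then mate D l else mate D p].

Definition join_dots (l r : 'I_n.*2) (D : diagram) :=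
  [set p | if (p == l) || (p == r) then false
           else if (p == mate D l) || (p == mate D r)
           then (l \in dots D) (+) (r \in dots D) else p \in dots D].

Definition join_points (l r : 'I_n.*2) (D : diagram) :=
  (join_mate l r D, join_dots l r D).

Variant join_spec (l r p : 'I_n.*2) (D : diagram) : 'I_n.*2 -> bool -> Prop :=
| JoinL of p = l : join_spec l r p D r false
| JoinR of p = r : join_spec l r p D l false
| JoinML of p = mate D l :
    join_spec l r p D (mate D r) ((l \in dots D) (+) (r \in dots D))
| JoinMR of p = mate D r :
    join_spec l r p D (mate D l) ((l \in dots D) (+) (r \in dots D))
| JoinOther of p <> l :> nat & p <> r :> nat
    & p <> mate D l :> nat & p <> mate D r :> nat :
    join_spec l r p D (mate D p) (p \in dots D).

Fact joinP l r p D : join_spec l r p D (join_mate l r D p) (p \in join_dots l r D).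
Proof.
rewrite ffunE inE; have [->|pl] := eqVneq p l; first by constructor.
have [->|pr] := eqVneq p r; first by constructor.
have [->|pml] := eqVneq p (mate D l); first by constructor.
have [->|pmr] := eqVneq p (mate D r); first by constructor.
by constructor; apply/eqP.
Qed.

Fact join_pointsP (l r : 'I_n.*2) (D : diagram) :
  r = l.+1 :> nat -> mate D l != r -> is_diagram (join_points l r D).
Proof.
move=> rl mlr; case: (diagramP D) => mK mN nc dm dl.
have nat_neq (x y : 'I_n.*2) : x <> y -> x <> y :> nat by move=> h /val_inj.
have arN : mate D l <> r :> nat by apply: nat_neq; apply/eqP.
have blN : mate D r <> l :> nat.
  by apply: nat_neq => e; move/eqP: mlr; apply; rewrite -e mK.
have abN : mate D l <> mate D r :> nat.
  by move/val_inj/(can_inj mK) => e; move: rl; rewrite e; lia.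
have ncb (x y : 'I_n.*2) : ~~ [&& (x < y)%N, (y < mate D x)%N & (mate D x < mate D y)%N].
  by apply/negP=> /and3P[*]; apply: (nc x y).
have dlb (x y : 'I_n.*2) : x \in dots D -> ~~ ((y < x)%N && (x < mate D y)%N).
  by move=> xT; apply/negP=> /andP[*]; apply: (dl x y).
have alN := mN l; have brN := mN r.
have al := mK l; have br := mK r.
have dm2 (p : 'I_n.*2) : (mate D p \in dots D) = (p \in dots D).
  by apply/idP/idP => /dm; rewrite ?mK.
have dal := dm2 l; have dbr := dm2 r.
have other (p : 'I_n.*2) : p <> l :> nat -> p <> r :> nat ->
    p <> mate D l :> nat -> p <> mate D r :> nat ->
    [/\ mate D p <> l :> nat, mate D p <> r :> nat, mate D p <> mate D l :> nat
      & mate D p <> mate D r :> nat].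
  move=> pl pr pa pb.
  split=> /val_inj e; [apply: pa|apply: pb|apply: pl|apply: pr];
    by rewrite -?e ?mK // (can_inj mK e).
(* The hypotheses on a pair of strands, for a strand y and the strands of l, r *)
have nc8 (y : 'I_n.*2) : let z := mate D y in
    [/\ ~~ [&& (l < y)%N, (y < mate D l)%N & (mate D l < z)%N],
        ~~ [&& (mate D l < y)%N, (y < l)%N & (l < z)%N],
        ~~ [&& (y < l)%N, (l < z)%N & (z < mate D l)%N]
      & ~~ [&& (y < mate D l)%N, (mate D l < z)%N & (z < l)%N]] /\
    [/\ ~~ [&& (r < y)%N, (y < mate D r)%N & (mate D r < z)%N],
        ~~ [&& (mate D r < y)%N, (y < r)%N & (r < z)%N],
        ~~ [&& (y < r)%N, (r < z)%N & (z < mate D r)%N]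
      & ~~ [&& (y < mate D r)%N, (mate D r < z)%N & (z < r)%N]].
  move=> z; split; split.
  - exact: ncb l y. 
  - by have := ncb (mate D l) y; rewrite al.
  - exact: ncb y l.
  - by have := ncb y (mate D l); rewrite al.
  - exact: ncb r y.
  - by have := ncb (mate D r) y; rewrite br.
  - exact: ncb y r.
  - by have := ncb y (mate D r); rewrite br.
pose vE := congr1 (@nat_of_ord n.*2).
apply/is_diagramP; split.
- move=> p; case: (joinP l r p D) => [->|->|->|->|pl pr pa pb].
  + by case: (joinP l r r D) => // /vE; lia.
  + by case: (joinP l r l D) => // /vE; lia.
  + by case: (joinP l r (mate D r) D) => // /vE; lia.
  + by case: (joinP l r (mate D l) D) => // /vE; lia.
  + have [? ? ? ?] := other p pl pr pa pb.
    by case: (joinP l r (mate D p) D) => [/vE|/vE|/vE|/vE|*]; rewrite ?mK //; lia.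
- move=> p; case: (joinP l r p D) => [->|->|->|->|pl pr pa pb].
  + lia.
  + lia.
  + by move/nesym: abN.
  + exact: abN.
  + exact: mN.
- move=> p t; case: (joinP l r p D) => [->|->|->|->|pl pr pa pb].
  + by move=> []; lia.
  + by move=> []; lia.
  + case: (joinP l r t D) => [->|->|->|->|tl tr ta tb].
    * by move=> []; lia.
    * by move=> []; lia.
    * by move=> []; lia.
    * by move=> []; lia.
    have [? ? ? ?] := other t tl tr ta tb.
    have [[? ? ? ?] [? ? ? ?]] := nc8 t.
    by move=> []; lia.
  + case: (joinP l r t D) => [->|->|->|->|tl tr ta tb].
    * by move=> []; lia.
    * by move=> []; lia.
    * by move=> []; lia.
    * by move=> []; lia.
    have [? ? ? ?] := other t tl tr ta tb.
    have [[? ? ? ?] [? ? ? ?]] := nc8 t.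
    by move=> []; lia.
  + case: (joinP l r t D) => [->|->|->|->|tl tr ta tb].
    * by move=> []; lia.
    * by move=> []; lia.
    * have [? ? ? ?] := other p pl pr pa pb.
      have [[? ? ? ?] [? ? ? ?]] := nc8 p.
      by move=> []; lia.
    * have [? ? ? ?] := other p pl pr pa pb.
      have [[? ? ? ?] [? ? ? ?]] := nc8 p.
      by move=> []; lia.
    exact: nc.
- move=> p; case: (joinP l r p D) => [_|_|_|_|pl pr pa pb] //.
  + by case: (joinP l r (mate D r) D) => // /vE; lia.
  + by case: (joinP l r (mate D l) D) => // /vE; lia.
  + have [? ? ? ?] := other p pl pr pa pb.
    by case: (joinP l r (mate D p) D) => [/vE|/vE|/vE|/vE|*]; rewrite ?dm2 //; lia.
have dlt (t : 'I_n.*2) : t <> l :> nat -> t <> r :> nat -> t <> mate D l :> nat ->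
    t <> mate D r :> nat -> (l \in dots D) || (r \in dots D) ->
    ~ ((t < mate D l)%N /\ (mate D l < mate D t)%N) /\
    ~ ((t < mate D r)%N /\ (mate D r < mate D t)%N).
  move=> tl tr ta tb /orP lrT.
  have {lrT} : ~~ ((t < l)%N && (l < mate D t)%N) &&
                 ~~ ((t < mate D l)%N && (mate D l < mate D t)%N) \/
               ~~ ((t < r)%N && (r < mate D t)%N) &&
                 ~~ ((t < mate D r)%N && (mate D r < mate D t)%N).
    by case: lrT => xT; [left|right]; rewrite !dlb ?dm2.
  have [? ? ? ?] := other t tl tr ta tb.
  have [[? ? ? ?] [? ? ? ?]] := nc8 t.
  by clear dal dbr; lia.
move=> p t; case: (joinP l r p D) => [_|_|->|->|pl pr pa pb] // xT.
- have {xT} abT : (l \in dots D) || (r \in dots D).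
    by move: xT; do 2![case: (_ \in _)].
  case: (joinP l r t D) => [->|->|->|->|tl tr ta tb].
  + by move: (rl) => {abT} e []; lia.
  + by move: (rl) => {abT} e []; lia.
  + by move=> {abT} []; lia.
  + by move=> {abT} []; lia.
  by have [] := dlt t tl tr ta tb abT.
- have {xT} abT : (l \in dots D) || (r \in dots D).
    by move: xT; do 2![case: (_ \in _)].
  case: (joinP l r t D) => [->|->|->|->|tl tr ta tb].
  + by move: (rl) => {abT} e []; lia.
  + by move: (rl) => {abT} e []; lia.
  + by move=> {abT} []; lia.
  + by move=> {abT} []; lia.
  by have [] := dlt t tl tr ta tb abT.
case: (joinP l r t D) => [->|->|->|->|tl tr ta tb].
- by clear xT; move=> []; lia.
- by clear xT; move=> []; lia.
- move: (dlb p l xT) (dlb p r xT) (dlb p (mate D l) xT) (dlb p (mate D r) xT).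
  have [? ? ? ?] := other p pl pr pa pb.
  have [[? ? ? ?] [? ? ? ?]] := nc8 p.
  by clear xT; rewrite al br => h1 h2 h3 h4 []; lia.
- move: (dlb p l xT) (dlb p r xT) (dlb p (mate D l) xT) (dlb p (mate D r) xT).
  have [? ? ? ?] := other p pl pr pa pb.
  have [[? ? ? ?] [? ? ? ?]] := nc8 p.
  by clear xT; rewrite al br => h1 h2 h3 h4 []; lia.
exact: dl.
Qed.

End Diagrams.

(* ------------------------------------------------------------------------ *)
Fact pred_ord_subproof n (i : 'I_n) : (i.-1 < n)%N.
Proof. exact: leq_ltn_trans (leq_pred i) (ltn_ord i). Qed.

Definition pred_ord n (i : 'I_n) : 'I_n := Ordinal (pred_ord_subproof i).

Section DiagramCoefficients.

Variables (k : comNzRingType) (delta : k) (n : nat).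

Fact id_diagram_subproof :
  is_diagram ([ffun p : 'I_n.*2 => rev_ord p], set0).
Proof.
apply/is_diagramP; split=> [p|p|p r [pr]|p|p r]; rewrite ?ffunE ?inE //=.
- exact: rev_ordK.
- by rewrite /= subnS; have := ltn_ord p; lia.
- by have := ltn_ord p; have := ltn_ord r; lia.
Qed.

Definition id_diagram : diagram n := Diagram id_diagram_subproof.

Fact leq_n_double : (n <= n.*2)%N. Proof. by rewrite -addnn leq_addr. Qed.

Definition top_point (i : 'I_n) : 'I_n.*2 := widen_ord leq_n_double i.

(* stack i D = (c, D') when putting the diagram of s_0 (if i = 0) or of U_i
   (if i > 0) on top of D gives c times D'. The default value of insubd is
   never used, see stack_dotE and stack_cupcapE. *)
Definition stack (i : 'I_n) (D : diagram n) : k * diagram n :=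
  let l := top_point (pred_ord i) in
  let r := top_point i in
  if i == 0%N :> nat then (1, insubd D (toggle_dot r D))
  else if mate D l == r then (if l \in dots D then 0 else delta, D)
  else (1, insubd D (join_points l r D)).

Fact stack_dotE (i : 'I_n) (D : diagram n) : i = 0%N :> nat ->
  val (stack i D).2 = toggle_dot (top_point i) D.
Proof.
by move=> i0; rewrite /stack i0 eqxx; apply: insubdK; apply: toggle_dotP.
Qed.

Fact stack_cupcapE (i : 'I_n) (D : diagram n) : (0 < i)%N ->
  mate D (top_point (pred_ord i)) != top_point i ->
  val (stack i D).2 = join_points (top_point (pred_ord i)) (top_point i) D.
Proof.
move=> i0 mi; rewrite /stack gtn_eqF // (negbTE mi); apply: insubdK.
by apply: join_pointsP => //=; rewrite prednK.
Qed.

(* The stacking action of the generators on the free module on the diagrams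
   satisfies the relations of TL(B_n). The coordinate of a on the basis element
   D of TL(B_n) is the coefficient of D in the combination of diagrams that
   is obtained by letting a act on the identity diagram. *)
Definition stack_op (i : 'I_n) : 'End({ffun diagram n -> k^o}) :=
  kernel_op (fun D' D => (stack i D).1 *+ (D' == (stack i D).2)).

Definition diagram_coef (a : TLB delta n) (D : diagram n) : k :=
  TLB_rep stack_op a (basis_vector k id_diagram) D.

End DiagramCoefficients.

(* ------------------------------------------------------------------------ *)
Section TensorSpace.

Variables (F : fieldType) (q : F) (n : nat).

(* V has the basis x = 0, y = 1; the basis of the n-th tensor power of V is
   indexed by words in x, y. The entry a b of a matrix is the coefficient of a
   in the image of b. *)
Definition word := {ffun 'I_n -> 'I_2}.
Definition tensorV := {ffun word -> F^o}.

Definition diag2 (a b : F) : 'M[F]_2 :=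
  \matrix_(i, j) (if i == j then if i == 0 then a else b else 0).

Definition E_mx : 'M[F]_2 := delta_mx 0 1.
Definition F_mx : 'M[F]_2 := delta_mx 1 0.
Definition D1_mx : 'M[F]_2 := diag2 q 1.
Definition D2_mx : 'M[F]_2 := diag2 1 q.
Definition K_mx : 'M[F]_2 := D1_mx *m invmx D2_mx.
Definition swap_mx : 'M[F]_2 := delta_mx 0 1 + delta_mx 1 0.

Definition tensor_op (T : 'I_n -> 'M[F]_2) : 'End(tensorV) :=
  kernel_op (fun a b : word => \prod_i T i (a i) (b i)).

(* The iterated coproducts of E, F, D_1, D_2, K^-1. *)
Definition E_op : 'End(tensorV) :=
  \sum_(i < n) tensor_op (fun j : 'I_n =>
    if (j < i)%N then K_mx else if j == i then E_mx else 1%:M).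
Definition F_op : 'End(tensorV) :=
  \sum_(i < n) tensor_op (fun j : 'I_n =>
    if (j < i)%N then 1%:M else if j == i then F_mx else invmx K_mx).
Definition D1_op : 'End(tensorV) := tensor_op (fun=> D1_mx).
Definition D2_op : 'End(tensorV) := tensor_op (fun=> D2_mx).
Definition Kinv_op : 'End(tensorV) := tensor_op (fun=> invmx K_mx).

Definition B_op : 'End(tensorV) := q^-1 *: (E_op \o Kinv_op)%VF + F_op.
Definition C_op : 'End(tensorV) := (D1_op \o D2_op)%VF.

Definition qint (m : int) : F := (q ^ m - q ^ (- m)) / (q - q^-1).

(* L([m]) is a line on which B acts by [m] and C by q^n, so the sum of the
   submodules isomorphic to L([m]) is a common eigenspace of B and C. *)
Definition isotypic (m : int) : {vspace tensorV} :=
  (passmx.leigenspace B_op (qint m) :&: passmx.leigenspace C_op (q ^+ n))%VS.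

Definition is_isotypic_projection (m : int) (p : 'End(tensorV)) :=
  is_projection p (isotypic m)
    (\sum_(j < n.+1 | n%:Z - j.*2%:Z != m) isotypic (n%:Z - j.*2%:Z))%VS.

Definition cap (a b : 'I_2) : F :=
  if (a == 0) && (b == 1) then - q^-1
  else if (a == 1) && (b == 0) then 1 else 0.

Definition cup (a b : 'I_2) : F :=
  if (a == 0) && (b == 1) then 1
  else if (a == 1) && (b == 0) then - q else 0.

Definition cupcap_op (l r : 'I_n) : 'End(tensorV) :=
  kernel_op (fun a b : word =>
    if [forall j, (j != l) && (j != r) ==> (a j == b j)]
    then cup (a l) (a r) * cap (b l) (b r) else 0).

Definition letter_op (i : 'I_n) : 'End(tensorV) :=
  if i == 0%N :> nat
  then tensor_op (fun j => if j == i then swap_mx else 1%:M)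
  else - cupcap_op (pred_ord i) i.

Definition TLB_on_tensorV (a : TLB (q + q^-1) n) : 'End(tensorV) :=
  TLB_rep letter_op a.

End TensorSpace.

(* ------------------------------------------------------------------------ *)
Definition Cq (R : realType) : fieldType := {fraction {poly R[i]}}.

Definition qvar (R : realType) : Cq R := tofrac 'X.

(* The expansion at q = 0 of f is the Laurent series q^-N (sum_j a_j q^j): it
   becomes P when multiplied by Q, where f = P / Q. *)
Definition has_laurent_expansion (R : realType) (f : Cq R) (N : nat)
    (a : nat -> R[i]) : Prop :=
  exists P Q : {poly R[i]}, [/\ Q != 0, f = tofrac P / tofrac Q &
    forall j, \sum_(i < j.+1) Q`_i * a (j - i)%N = (P * 'X^N)`_j].

Definition in_integral_laurent (R : realType) (f : Cq R) : Prop :=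
  exists (N : nat) (a : nat -> int),
    has_laurent_expansion f N (fun j => (a j)%:~R).

(* Main.v *)
(* Write b for one of the two idempotents and e = 1 or -1 for the eigenvalue of
   s_0 on it. Both are produced by the recursion
     b_(n+1) = b_n - c_n b_n U_n b_n,  c_n = (q^(n-1) + q^-(n-1)) / (q^n + q^-n),
   starting from b_1 = (1 + e s_0) / 2; it works because
   U_n b_n U_n = c_n^-1 b_(n-1) U_n, an identity that propagates through
   c_(n+1)^-1 = q + q^-1 - c_n. Uniqueness and b <> 0 come from the character
   chi with s_0 |-> e, U_i |-> 0: every a satisfies a b = chi(a) b = b a.
   The mixed terms b_(n,+) U_n b_(n,-) vanish because s_0 commutes with U_n, so
   the sum d_n satisfies the same recursion.
   The tensors killed by all U_i on which s_0 acts by e form a line, spanned by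
   the product v_e of the x + e q^i y (0 <= i < n). The tensor products of
   factors x + q^m y (raising the B-weight m by 1) and x - q^-m y (lowering it
   by 1) are B-eigenvectors that span; all of them except v_e are killed by b_n
   because b_n maps u to a multiple of <v_e, u> v_e, where the product <v_e, u>
   has the factor 1 - q^i q^-i at the first sign that differs from e.
   The coefficients of d_n lie in the ring of fractions P / (q^N Q) with integer
   polynomials P, Q and Q(0) = 1, which contains 1 / (q + q^-1) and all c_n with
   n > 1, and whose elements expand into Laurent series with integer
   coefficients. *)
Require Import Defs.
From HB Require Import structures.
From mathcomp Require Import all_boot all_order all_algebra.
From mathcomp Require Import boolp reals complex.
From mathcomp Require Import zify ring.
From mathcomp.multinomials Require Import monalg.

Set Implicit Arguments.
Unset Strict Implicit.
Unset Printing Implicit Defensive.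

Import Order.TTheory GRing.Theory Num.Theory.

Local Open Scope ring_scope.

(** * Maps out of TL(B_n) *)

(** The starting value c_1^-1 = (q + q^-1) / 2, forced by U_1 s_0 U_1 = 0, is what makes the c_n
    ratios of the numbers q^n + q^-n, in place of the quantum integers of type A. The idempotents
    b_(n,+) and b_(n,-) have denominators 2, so integrality can only be seen on their sum. Since s_0
    does not commute with U_1, the step from d_1 to d_2 is not an instance of the recursion for d_n;
    it is computed directly, and there the halves cancel against the 2 in c_1. Coefficients of
    diagrams are read off from the stacking action on the free module on diagrams. To follow them
    through products one needs that this action respects the relations of TL(B_n); the delicate
    relation is U_i U_j = U_j U_i when the two stackings together close a circle. The projections
    are obtained from operators alone: an endomorphism that is absorbed by s_0 up to the sign e and
    killed by all U_i, on both sides, has its image in the line of v_e and is given by pairing with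
    v_e. Fixing v_e and vanishing on the other product eigenvectors then determines it, because
    these vectors span. *)

Lemma TLB_ind (k : comNzRingType) (delta : k) n (P : TLB delta n -> Prop) :
  (forall a b, P a -> P b -> P (a + b)) -> (forall c a, P a -> P (c *: a)) ->
  P 1 -> (forall (i : 'I_n) a, P a -> P (TLB_gen delta n i * a)) ->
  forall a, P a.
Proof.
move=> PD PZ P1 PM; elim/TLB_pi_ind=> f.
have P0 : P 0 by rewrite -(scale0r (1 : TLB delta n)); apply: PZ.
have piS (I : Type) (r : seq I) (g : I -> {malg k[{fmonom 'I_n}]}) :
    TLB_pi delta (\sum_(i <- r) g i) = \sum_(i <- r) TLB_pi delta (g i).
  by elim/big_rec2: _ => [|i y x _ <-]; [exact: TLB_pi0|exact: TLB_piD].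
rewrite (monalgE f) piS; elim/big_ind: _ => // w _.
have -> : << f@_w *g w >> = f@_w *: << w >> :> {malg k[{fmonom 'I_n}]}.
  by apply/malgP=> u; rewrite mcoeffZ !mcoeffU mulr_natr.
rewrite TLB_piZ; apply: PZ; case: w => w; elim: w => [|i w IHw].
  suff -> : FMonom [::] = mone :> {fmonom 'I_n} by exact: P1.
  by apply/val_inj; rewrite /= fm1.
have -> : FMonom (i :: w) = mmul (fmu i) (FMonom w).
  by apply/val_inj; rewrite /= fmM fmU.
suff -> : TLB_pi delta << mmul (fmu i) (FMonom w) >> =
    TLB_gen delta n i * TLB_pi delta << FMonom w >> by apply: PM.
rewrite TLB_genE -[RHS]TLB_piM /letter; congr TLB_pi.
by rewrite !malgM_def fgmulUU mulr1.
Qed.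

Section TLBLift.

Variables (k : comNzRingType) (delta : k) (n : nat) (V : lmodType k).
Variables (h : {fmonom 'I_n} -> V) (mul : V -> V -> V).
Hypothesis mulr_lin : forall x, linear (mul x).
Hypothesis mull_lin : forall y, linear (mul^~ y).
Hypothesis hM : forall w w', h (mmul w w') = mul (h w) (h w').

(** The target is a module with a bilinear product, so that one construction serves both
    endomorphisms under composition and scalars. *)
Definition TLB_lift (a : TLB delta n) : V := free_lift h (TLB_repr a).

Lemma free_lift_TLB_rel (A := fun i => h (fmu i)) :
  (forall i : 'I_n, (0 < i)%N -> mul (A i) (A i) = delta *: A i) ->
  (forall i j : 'I_n, (0 < i)%N -> (0 < j)%N ->
    (i.+1 = j :> nat \/ j.+1 = i :> nat) -> mul (mul (A i) (A j)) (A i) = A i) ->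
  (forall i j : 'I_n, (0 < i)%N -> (i.+2 <= j)%N ->
    mul (A i) (A j) = mul (A j) (A i)) ->
  (forall z : 'I_n, z = 0%N :> nat -> mul (A z) (A z) = h mone) ->
  (forall z i : 'I_n, z = 0%N :> nat -> i = 1%N :> nat ->
    mul (mul (A i) (A z)) (A i) = 0) ->
  (forall z i : 'I_n, z = 0%N :> nat -> (2 <= i)%N ->
    mul (A z) (A i) = mul (A i) (A z)) ->
  forall x y, TLB_rel delta x y -> free_lift h x = free_lift h y.
Proof.
move=> A1 A2 A3 A4 A5 A6.
have eM u v : free_lift h (u * v) = mul (free_lift h u) (free_lift h v).
  exact: free_liftM.
have eL i : free_lift h (letter k i) = A i.
  by rewrite /letter free_liftU scale1r.
move=> x y; case=> [i i0|i j i0 j0 ij|i j i0 ij|z z0|z i z0 i1|z i z0 i2].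
- by rewrite eM linearZ /= eL A1.
- by rewrite eM eM !eL A2.
- by apply: etrans (eM _ _) (etrans _ (esym (eM _ _))); rewrite !eL A3.
- by rewrite eM !eL A4 // free_liftU scale1r.
- by rewrite eM eM !eL A5 // raddf0.
- by apply: etrans (eM _ _) (etrans _ (esym (eM _ _))); rewrite !eL A6.
Qed.

Hypothesis h_rel :
  forall x y, TLB_rel delta x y -> free_lift h x = free_lift h y.

Lemma TLB_lift_pi f : TLB_lift (TLB_pi delta f) = free_lift h f.
Proof. exact: free_lift_repr. Qed.

Lemma TLB_liftM a b : TLB_lift (a * b) = mul (TLB_lift a) (TLB_lift b).
Proof.
elim/TLB_pi_ind: a => x; elim/TLB_pi_ind: b => y.
by rewrite -[_ * _ in LHS]TLB_piM !TLB_lift_pi; apply: free_liftM.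
Qed.

Lemma TLB_liftD a b : TLB_lift (a + b) = TLB_lift a + TLB_lift b.
Proof.
elim/TLB_pi_ind: a => x; elim/TLB_pi_ind: b => y.
by rewrite -TLB_piD !TLB_lift_pi raddfD.
Qed.

Lemma TLB_liftZ c a : TLB_lift (c *: a) = c *: TLB_lift a.
Proof.
by elim/TLB_pi_ind: a => x; rewrite -[_ *: _]TLB_piZ !TLB_lift_pi linearZ.
Qed.

Lemma TLB_lift1 : TLB_lift 1 = h mone.
Proof.
rewrite -[X in TLB_lift X]/(@TLB_pi k delta n 1) TLB_lift_pi.
by rewrite free_liftU scale1r.
Qed.

Lemma TLB_lift_gen (i : 'I_n) : TLB_lift (TLB_gen delta n i) = h (fmu i).
Proof. by rewrite TLB_genE TLB_lift_pi free_liftU scale1r. Qed.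

End TLBLift.

Section TLBRep.

Variables (k : comNzRingType) (delta : k) (n : nat) (W : vectType k).
Variable op : 'I_n -> 'End(W).

Hypothesis opUU : forall (i : 'I_n) v, (0 < i)%N -> op i (op i v) = delta *: op i v.
Hypothesis opUUU : forall (i j : 'I_n) v, (0 < i)%N -> (0 < j)%N ->
  (i.+1 = j :> nat \/ j.+1 = i :> nat) -> op i (op j (op i v)) = op i v.
Hypothesis opUUC : forall (i j : 'I_n) v, (0 < i)%N -> (i.+2 <= j)%N ->
  op i (op j v) = op j (op i v).
Hypothesis opss : forall (z : 'I_n) v, z = 0%N :> nat -> op z (op z v) = v.
Hypothesis opUsU : forall (z i : 'I_n) v, z = 0%N :> nat -> i = 1%N :> nat ->
  op i (op z (op i v)) = 0.
Hypothesis opsU : forall (z i : 'I_n) v, z = 0%N :> nat -> (2 <= i)%N ->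
  op z (op i v) = op i (op z v).

Let h (w : {fmonom 'I_n}) : 'End(W) :=
  foldr (fun i g => (op i \o g)%VF) \1%VF (fmonom_val w).
Let mul (f g : 'End(W)) : 'End(W) := (f \o g)%VF.

Let mulr_lin x : linear (mul x).
Proof. by move=> c u v; rewrite /mul comp_lfunDr comp_lfunZr. Qed.

Let mull_lin y : linear (mul^~ y).
Proof. by move=> c u v; rewrite /mul comp_lfunDl comp_lfunZl. Qed.

Let hM w w' : h (mmul w w') = mul (h w) (h w').
Proof.
rewrite /h fmM foldr_cat /mul; elim: (fmonom_val w) => [|i s IH] /=.
  by rewrite comp_lfun1l.
by rewrite IH comp_lfunA.
Qed.

Let hU i : h (fmu i) = op i.
Proof. by rewrite /h fmU /= comp_lfun1r. Qed.

Let h_rel x y : TLB_rel delta x y -> free_lift h x = free_lift h y.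
Proof.
apply: (free_lift_TLB_rel (mul := mul)) => //; rewrite /mul.
- move=> i i0; apply/lfunP=> v.
  by rewrite !hU comp_lfunE scale_lfunE opUU.
- by move=> i j i0 j0 ij; apply/lfunP=> v; rewrite !hU !comp_lfunE opUUU.
- by move=> i j i0 ij; apply/lfunP=> v; rewrite !hU !comp_lfunE opUUC.
- move=> z z0; apply/lfunP=> v.
  by rewrite !hU comp_lfunE opss // /h fm1 /= id_lfunE.
- move=> z i z0 i1; apply/lfunP=> v.
  by rewrite !hU !comp_lfunE opUsU // zero_lfunE.
- by move=> z i z0 i2; apply/lfunP=> v; rewrite !hU !comp_lfunE opsU.
Qed.

Lemma TLB_repM (a b : TLB delta n) v :
  TLB_rep op (a * b) v = TLB_rep op a (TLB_rep op b v).
Proof.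
have := TLB_liftM (mul := mul) mulr_lin mull_lin hM h_rel a b.
by rewrite /TLB_lift -!/(TLB_rep op _) => ->; rewrite /mul comp_lfunE.
Qed.

Lemma TLB_repD (a b : TLB delta n) v :
  TLB_rep op (a + b) v = TLB_rep op a v + TLB_rep op b v.
Proof.
have := TLB_liftD (mul := mul) mulr_lin mull_lin hM h_rel a b.
by rewrite /TLB_lift -!/(TLB_rep op _) => ->; rewrite add_lfunE.
Qed.

Lemma TLB_repZ c (a : TLB delta n) v :
  TLB_rep op (c *: a) v = c *: TLB_rep op a v.
Proof.
have := TLB_liftZ (mul := mul) mulr_lin mull_lin hM h_rel c a.
by rewrite /TLB_lift -!/(TLB_rep op _) => ->; rewrite scale_lfunE.
Qed.

Lemma TLB_rep1 v : TLB_rep op (1 : TLB delta n) v = v.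
Proof.
have := TLB_lift1 (mul := mul) mulr_lin mull_lin hM h_rel.
by rewrite /TLB_lift -!/(TLB_rep op _) => ->; rewrite /h fm1 /= lfunE.
Qed.

Lemma TLB_rep_gen (i : 'I_n) v :
  TLB_rep op (TLB_gen delta n i) v = op i v.
Proof.
have := TLB_lift_gen (mul := mul) mulr_lin mull_lin hM h_rel i.
by rewrite /TLB_lift -!/(TLB_rep op _) => ->; rewrite hU.
Qed.

End TLBRep.

Section KernelOpBasis.

Variables (k : comNzRingType) (I : finType).

Lemma kernel_opE (M : I -> I -> k) (v : {ffun I -> k^o}) a :
  kernel_op M v a = \sum_b M a b * v b.
Proof. by rewrite lfunE /= ffunE. Qed.

Lemma kernel_op_basis (M : I -> I -> k) b : kernel_op M (basis_vector k b) = [ffun a => M a b].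
Proof.
apply/ffunP=> a; rewrite kernel_opE ffunE (bigD1 b) //= ffunE eqxx mulr1.
by rewrite big1 ?addr0 // => c /negPf cb; rewrite ffunE cb mulr0.
Qed.

Lemma ffun_basisE (v : {ffun I -> k^o}) : v = \sum_b v b *: basis_vector k b.
Proof.
apply/ffunP=> a; rewrite sum_ffunE (bigD1 a) //= !ffunE eqxx.
rewrite big1 ?addr0 => [|b /negPf ba]; last first.
  by rewrite !ffunE eq_sym ba; apply: mulr0.
by apply/esym/mulr1.
Qed.

Lemma lfun_basis_ext (W : vectType k) (f g : 'Hom({ffun I -> k^o}, W)) :
  (forall b, f (basis_vector k b) = g (basis_vector k b)) -> f = g.
Proof.
move=> fg; apply/lfunP=> v; rewrite [v]ffun_basisE !linear_sum.
by apply: eq_bigr => b _; rewrite !linearZ /= fg.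
Qed.

End KernelOpBasis.

(* scalerAl and scalerAr for the canonical structures of TLB itself: unifying
   them with those inherited from its algebra structure is very slow. *)
Lemma TLB_scalerAl (k : comNzRingType) (delta : k) n c (a b : TLB delta n) :
  c *: (a * b) = (c *: a) * b.
Proof. exact: TLB_scaleAl. Qed.

Lemma TLB_scalerAr (k : comNzRingType) (delta : k) n c (a b : TLB delta n) :
  c *: (a * b) = a * (c *: b).
Proof. exact: TLB_scaleAr. Qed.

(** * Characters of TL(B_n) and uniqueness of idempotents *)

Section TLBCharacter.

Variables (k : comNzRingType) (delta e : k) (n : nat).
Hypothesis ee : e * e = 1.

Let h (w : {fmonom 'I_n}) : k^o :=
  \prod_(i <- fmonom_val w) (if i == 0%N :> nat then e else 0).

Definition TLB_chi (a : TLB delta n) : k := TLB_lift h a.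

Let mulr_lin (x : k^o) : linear (fun y : k^o => x * y : k^o).
Proof. by move=> c u v; rewrite mulrDr; congr (_ + _); apply: mulrCA. Qed.

Let mull_lin (y : k^o) : linear (fun x : k^o => x * y : k^o).
Proof. by move=> c u v; rewrite mulrDl; congr (_ + _); rewrite -scalerAl. Qed.

Let hM w w' : h (mmul w w') = h w * h w'.
Proof. by rewrite /h fmM big_cat. Qed.

Let hU i : h (fmu i) = if i == 0%N :> nat then e else 0.
Proof. by rewrite /h fmU big_seq1. Qed.

Let h_rel x y : TLB_rel delta x y -> free_lift h x = free_lift h y.
Proof.
apply: (free_lift_TLB_rel (mul := *%R)) => //.
- by move=> i i0; rewrite !hU gtn_eqF // mulr0 scaler0.
- by move=> i j i0 j0 ij; rewrite !hU !gtn_eqF // mulr0.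
- by move=> i j i0 ij; rewrite mulrC.
- by move=> z z0; rewrite !hU z0 ee /h fm1 big_nil.
- by move=> z i z0 i1; rewrite !hU z0 i1 mulr0.
- by move=> z i z0 i2; rewrite mulrC.
Qed.

Lemma TLB_chiM a b : TLB_chi (a * b) = TLB_chi a * TLB_chi b.
Proof. exact: (TLB_liftM mulr_lin mull_lin hM h_rel). Qed.

Lemma TLB_chiD a b : TLB_chi (a + b) = TLB_chi a + TLB_chi b.
Proof. exact: (TLB_liftD mulr_lin mull_lin hM h_rel). Qed.

Lemma TLB_chiZ c a : TLB_chi (c *: a) = c * TLB_chi a.
Proof. exact: (TLB_liftZ mulr_lin mull_lin hM h_rel). Qed.

Lemma TLB_chi1 : TLB_chi 1 = 1.
Proof.
rewrite /TLB_chi (TLB_lift1 mulr_lin mull_lin hM h_rel).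
by rewrite /h fm1 big_nil.
Qed.

Lemma TLB_chi0 : TLB_chi 0 = 0.
Proof. by rewrite -(scale0r 0) TLB_chiZ mul0r. Qed.

Lemma TLB_chi_gen i : (i < n)%N ->
  TLB_chi (TLB_gen delta n i) = if i == 0%N then e else 0.
Proof.
move=> ilt; have := TLB_lift_gen mulr_lin mull_lin hM h_rel (Ordinal ilt).
by rewrite hU.
Qed.

Lemma TLB_chi_mull b :
    (forall i, (0 < i < n)%N -> TLB_gen delta n i * b = 0) ->
    ((0 < n)%N -> TLB_gen delta n 0 * b = e *: b) ->
  forall a, a * b = TLB_chi a *: b.
Proof.
move=> Ub sb; apply: TLB_ind => [x y ex ey|c x ex||i x ex].
- by rewrite mulrDl ex ey TLB_chiD scalerDl.
- rewrite -TLB_scalerAl ex TLB_chiZ scalerA; exact: erefl.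
- by rewrite mul1r TLB_chi1 scale1r.
rewrite -mulrA ex TLB_chiM mulrC -scalerA -TLB_scalerAr; congr (_ *: _).
rewrite (TLB_chi_gen (ltn_ord i)).
case: eqP => [->|/eqP]; last rewrite -lt0n => i0.
  exact/sb/(leq_trans _ (ltn_ord i)).
by rewrite scale0r; apply: Ub; rewrite i0 ltn_ord.
Qed.

Lemma TLB_chi_mulr b :
    (forall i, (0 < i < n)%N -> b * TLB_gen delta n i = 0) ->
    ((0 < n)%N -> b * TLB_gen delta n 0 = e *: b) ->
  forall a, b * a = TLB_chi a *: b.
Proof.
move=> Ub sb; apply: TLB_ind => [x y ex ey|c x ex||i x ex].
- by rewrite mulrDr ex ey TLB_chiD scalerDl.
- rewrite -TLB_scalerAr ex TLB_chiZ scalerA; exact: erefl.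
- by rewrite mulr1 TLB_chi1 scale1r.
rewrite mulrA TLB_chiM -scalerA -ex TLB_scalerAl; congr (_ * _).
rewrite (TLB_chi_gen (ltn_ord i)).
case: eqP => [->|/eqP]; last rewrite -lt0n => i0.
  exact/sb/(leq_trans _ (ltn_ord i)).
by rewrite scale0r; apply: Ub; rewrite i0 ltn_ord.
Qed.

End TLBCharacter.

Section TLDCharacter.

Variables (k : comNzRingType) (delta e : k) (n : nat).
Hypothesis ee : e * e = 1.

Lemma TLB_chi_TLD_generator (u : TLB delta n) :
  TLD_generator u -> TLB_chi e u = 0.
Proof.
case=> [[n2 ->]|[i [i0 ilt ->]]]; last by rewrite TLB_chi_gen // gtn_eqF.
rewrite /U0 !TLB_chiM // (TLB_chi_gen _ ee (i := 1)) //.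
by rewrite mulr0 mul0r.
Qed.

(** On TL(D_n) the character is the augmentation for either sign [e]: it kills U_0, ..., U_(n-1), so
    only the scalar part of [a] survives, and the same happens in the products with [b]. *)
Lemma TLD_chi_mul (b : TLB delta n) :
  (forall u : TLB delta n, TLD_generator u -> u * b = 0 /\ b * u = 0) ->
  forall a : TLB delta n, TLD a ->
    a * b = TLB_chi e a *: b /\ b * a = TLB_chi e a *: b.
Proof.
move=> ub a; elim=> {a} [a ga|c|x y _ [ex ex'] _ [ey ey']|x y _ [ex ex'] _ [ey ey']].
- by have [-> ->] := ub a ga; rewrite TLB_chi_TLD_generator ?scale0r.
- by rewrite -TLB_scalerAl -TLB_scalerAr mul1r mulr1 (TLB_chiZ ee) (TLB_chi1 _ _ ee) mulr1.
- by rewrite mulrDl mulrDr ex ex' ey ey' (TLB_chiD ee) scalerDl.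
- rewrite (TLB_chiM ee) -mulrA ey -TLB_scalerAr ex mulrA ex' -TLB_scalerAl ey' !scalerA.
  rewrite (mulrC (TLB_chi e y)); split; exact: erefl.
Qed.

End TLDCharacter.

Section UniqueIdempotent.

Variables (F : fieldType) (A : algType F).

(* b e = chi(b) e = e and b e = chi(e) b, so e = chi(e) b. *)
Lemma unique_nz_idempotent_chi (chi : A -> F) (P : A -> Prop) (b : A) :
    chi 0 = 0 -> chi b = 1 -> b * b = b -> P b ->
    (forall e, P e -> b * e = chi b *: e /\ b * e = chi e *: b) ->
  is_unique_nz_idempotent P b.
Proof.
move=> chi0 chib bb Pb be; have bN0 : b != 0.
  by apply: contra_eq_neq chi0 => <-; rewrite chib oner_eq0.
split=> // e eN0 ee Pe; have [] := be e Pe.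
rewrite chib scale1r => ebe; rewrite ebe => eE; move: eN0 ee; rewrite eE.
rewrite -scalerAl -scalerAr bb scalerA.
set c := chi e => cb /eqP; rewrite -subr_eq0 -scalerBl scaler_eq0 (negPf bN0) orbF.
rewrite -{3}[c]mulr1 -mulrBr mulf_eq0 => /orP[/eqP c0|].
  by rewrite c0 scale0r eqxx in cb.
by rewrite subr_eq0 => /eqP->; rewrite scale1r.
Qed.

End UniqueIdempotent.

(** * The idempotents *)

Section JonesWenzlStep.

Variables (F : fieldType) (A : algType F) (c : F) (a b u : A).
Hypotheses (c0 : c != 0) (bb : b * b = b) (ab : a * b = b) (ba : b * a = b).
Hypotheses (au : a * u = u * a) (ubu : u * b * u = c^-1 *: (a * u)).

(** Here [a], [b], [u] stand for the images of b_(n-1), b_n and U_n in TL(B_(n+1)), and [b'] for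
    b_(n+1). *)
Let b' := b - c *: (b * u * b).

Lemma jw_step_mull : b * b' = b'.
Proof. by rewrite /b' mulrBr -scalerAr !mulrA bb. Qed.

Lemma jw_step_mulr : b' * b = b'.
Proof. by rewrite /b' mulrBl -scalerAl -!mulrA bb. Qed.

(** The coefficient [c] is made for this: c u b u b = a u b = u a b = u b. *)
Lemma jw_step_cup : u * b' = 0.
Proof.
rewrite /b' mulrBr -scalerAr !mulrA ubu -scalerAl scalerA divff // scale1r.
by rewrite au -mulrA ab subrr.
Qed.

Lemma jw_step_cap : b' * u = 0.
Proof.
rewrite /b' mulrBl -scalerAl -!mulrA [u * (b * u)]mulrA ubu -scalerAr scalerA.
by rewrite divff // scale1r mulrA ba subrr.
Qed.

Lemma jw_step_idem : b' * b' = b'.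
Proof.
have -> : b' * b' = b * b' - c *: (b * u * b) * b' by rewrite -mulrBl.
by rewrite jw_step_mull -scalerAl -!mulrA jw_step_mull jw_step_cup !mulr0 scaler0 subr0.
Qed.

End JonesWenzlStep.

Section JonesWenzl.

Variables (F : fieldType) (q : F).
Hypotheses (q0 : q != 0) (q1 : forall m, q ^+ m + 1 != 0).

Definition jw_coef (n : nat) : F :=
  (q ^+ n.-1 + q ^- n.-1) / (q ^+ n + q ^- n).

Lemma qpowDV_neq0 n : q ^+ n + q ^- n != 0.
Proof.
have qn0 : q ^+ n != 0 by rewrite expf_neq0.
rewrite -(inj_eq (mulIf qn0)) mul0r mulrDl mulVf //.
by rewrite -exprD q1.
Qed.

Lemma two_neq0 : 2 != 0 :> F.
Proof. by have := q1 0; rewrite expr0. Qed.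

Lemma jw_coef_neq0 n : jw_coef n != 0.
Proof. by rewrite mulf_neq0 ?invr_eq0 ?qpowDV_neq0. Qed.

Lemma jw_coef1 : jw_coef 1 = 2 / (q + q^-1).
Proof. by rewrite /jw_coef /= expr0 invr1 expr1. Qed.

(** With m = n + 1 and denominators cleared, this is (q + q^-1)(q^m + q^-m) = (q^(m+1) + q^-(m+1)) +
    (q^(m-1) + q^-(m-1)). *)
Lemma jw_coefSV n : (jw_coef n.+2)^-1 = q + q^-1 - jw_coef n.+1.
Proof.
rewrite /jw_coef /= invfM invrK.
have h1 := qpowDV_neq0 n.+1; have h2 := qpowDV_neq0 n.
apply: (mulIf h1); rewrite mulrBl !mulfVK //.
have qn0 : q ^+ n != 0 by rewrite expf_neq0.
rewrite !exprS; field.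
by rewrite qn0 q0 -exprS -exprD q1.
Qed.

(* T n stands for TL(B_n); the tower is abstract because unification in the
   quotient TLB is very slow. *)
Variables (T : nat -> algType F) (emb : forall n, T n -> T n.+1).
Variable gen : forall n, nat -> T n.
Arguments emb {n}.
Arguments gen : clear implicits.

Hypothesis embD : forall n, {morph @emb n : a b / a + b}.
Hypothesis embZ : forall n c, {morph @emb n : a / c *: a}.
Hypothesis embM : forall n, {morph @emb n : a b / a * b}.
Hypothesis emb1 : forall n, @emb n 1 = 1.
Hypothesis emb_gen : forall n i, (i < n)%N -> emb (gen n i) = gen n.+1 i.
Hypothesis emb2_comm : forall n (a : T n),
  emb (emb a) * gen n.+2 n.+1 = gen n.+2 n.+1 * emb (emb a).
Hypothesis gen_ss : forall n, (0 < n)%N -> gen n 0 * gen n 0 = 1.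
Hypothesis gen_UsU : forall n, (1 < n)%N -> gen n 1 * gen n 0 * gen n 1 = 0.
Hypothesis gen_UU : forall n i, (0 < i)%N -> (i < n)%N ->
  gen n i * gen n i = (q + q^-1) *: gen n i.
Hypothesis gen_UUU : forall n i j, (0 < i)%N -> (i < n)%N -> (0 < j)%N ->
  (j < n)%N -> i.+1 = j \/ j.+1 = i -> gen n i * gen n j * gen n i = gen n i.

Lemma embB n : {morph @emb n : a b / a - b}.
Proof. by move=> a b; rewrite embD -(scaleN1r b) embZ scaleN1r. Qed.

Lemma emb0 n : @emb n 0 = 0.
Proof. by have := embZ 0 (1 : T n); rewrite !scale0r. Qed.

(** The value 1 at n = 0 is the b_0 for which U_1 b_1 U_1 = c_1^-1 b_0 U_1, so that the induction
    can start there. *)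
Fixpoint jw (e : F) (n : nat) : T n :=
  match n with
  | 0 => 1
  | m.+1 =>
    if m == 0%N then 2^-1 *: (1 + e *: gen m.+1 0)
    else emb (jw e m)
         - jw_coef m *: (emb (jw e m) * gen m.+1 m
                         * emb (jw e m))
  end.

Lemma jwSS e n : jw e n.+2 = emb (jw e n.+1)
  - jw_coef n.+1 *: (emb (jw e n.+1) * gen n.+2 n.+1
                       * emb (jw e n.+1)).
Proof. by []. Qed.

Record jw_spec e n (b : T n) : Prop := JwSpec {
  jw_idem : b * b = b;
  jw_cup : forall i, (0 < i < n)%N -> gen n i * b = 0;
  jw_cap : forall i, (0 < i < n)%N -> b * gen n i = 0;
  jw_dotl : gen n 0 * b = e *: b;
  jw_dotr : b * gen n 0 = e *: b }.

(** The claims travel together: the step to the next idempotent uses both absorption rules and the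
    identity for [u * emb b * u], and the new identity uses the old absorption rules. *)
Lemma jwP_aux e n : e * e = 1 ->
  let b := jw e n.+1 in let a := emb (jw e n) in
  let u := gen n.+2 n.+1 in
  [/\ jw_spec e b, a * b = b, b * a = b &
      u * emb b * u = (jw_coef n.+1)^-1 *: (emb a * u)].
Proof.
move=> ee; elim: n => [|n [[bb Ub bU sb bs] ab ba ubu]] b a u.
  have ss := @gen_ss 1 isT.
  have sb : gen 1 0 * b = e *: b.
    rewrite /b /= -scalerAr mulrDr mulr1 -scalerAr ss [e *: _]scalerA [e * _]mulrC -scalerA.
    by congr (_ *: _); rewrite scalerDr scalerA ee scale1r addrC.
  have bs : b * gen 1 0 = e *: b.
    rewrite /b /= -scalerAl mulrDl mul1r -scalerAl ss [e *: _]scalerA [e * _]mulrC -scalerA.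
    by congr (_ *: _); rewrite scalerDr scalerA ee scale1r addrC.
  have a1 : a = 1 by rewrite /a emb1.
  split; last 1 first.
  (* U_1 s_0 U_1 = 0 leaves (q + q^-1) / 2 times U_1, and this factor is c_1^-1. *)
  - rewrite a1 emb1 mul1r /b /= embZ embD emb1 embZ.
    rewrite emb_gen // -scalerAr -scalerAl mulrDr mulrDl mulr1.
    rewrite -scalerAr -scalerAl gen_UsU // scaler0 addr0 gen_UU //.
    by rewrite scalerA jw_coef1 invfM invrK mulrC.
  - split=> //; [|by move=> i; lia|by move=> i; lia].
    rewrite {1}/b /= -scalerAl mulrDl mul1r -scalerAl sb scalerA ee scale1r.
    rewrite -{1}[b]scale1r -{2}[b]scale1r -scalerDl scalerA mulVf ?scale1r //.
    exact: two_neq0.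
  - by rewrite a1 mul1r.
  - by rewrite a1 mulr1.
have c0 := jw_coef_neq0 n.+1.
have bE : b = _ := jwSS e n; rewrite -/a in bE.
have aa : a * a = a by rewrite /a -embM bb.
have a2a : emb (emb (jw e n)) * a = a by rewrite /a -embM ab.
have aa2 : a * emb (emb (jw e n)) = a by rewrite /a -embM ba.
have cm := emb2_comm (jw e n).
have ab' : a * b = b by rewrite bE; apply: jw_step_mull.
have ba' : b * a = b by rewrite bE; apply: jw_step_mulr.
split=> //.
  split.
  - by rewrite bE; apply: jw_step_idem cm ubu.
  - move=> i ilt; have [->|iN] := eqVneq i n.+1.
      by rewrite bE; apply: jw_step_cup cm ubu.
    rewrite -(@emb_gen n.+1); last by lia.
    by rewrite -ab' mulrA /a -embM Ub ?emb0 ?mul0r //; lia.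
  - move=> i ilt; have [->|iN] := eqVneq i n.+1.
      by rewrite bE; apply: jw_step_cap ubu.
    rewrite -(@emb_gen n.+1); last by lia.
    by rewrite -ba' -mulrA /a -embM bU ?emb0 ?mulr0 //; lia.
  - rewrite -(@emb_gen n.+1) // -ab' mulrA /a -embM sb.
    by rewrite embZ -scalerAl.
  - rewrite -(@emb_gen n.+1) // -ba' -mulrA /a -embM bs.
    by rewrite embZ -scalerAr.
have cm2 := emb2_comm (jw e n.+1).
rewrite -/a -/u in cm2; pose v := gen n.+3 n.+1.
pose A := emb a; rewrite -/A in cm2 *.
have AA : A * A = A by rewrite /A -embM aa.
have -> : emb b = A - jw_coef n.+1 *: (A * v * A).
  by rewrite bE embB embZ !embM emb_gen.
rewrite mulrBr mulrBl -scalerAr -scalerAl.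
(* [A] comes from two strands below and commutes with [u]. The leading term gives (q + q^-1) A u,
   and the correction gives u A v A u = A (u v u) A = A u A = A u, whence the coefficient q + q^-1 -
   c. *)
have -> : u * A * u = (q + q^-1) *: (A * u).
  by rewrite -cm2 -mulrA gen_UU // scalerAr.
have -> : u * (A * v * A) * u = A * u.
  have -> : u * (A * v * A) * u = (u * A) * v * (A * u) by rewrite !mulrA.
  have -> : u * A * v * (A * u) = A * (u * v * u) * A.
    by rewrite -cm2 {2}cm2 !mulrA.
  by rewrite gen_UUU //; [rewrite -mulrA -cm2 mulrA AA|right].
by rewrite -scalerBl jw_coefSV.
Qed.

Lemma jwP e n : e * e = 1 -> (0 < n)%N -> jw_spec e (jw e n).
Proof. by case: n => // n ee _; have [] := jwP_aux n ee. Qed.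

(** The correction term contains U_n, which [chi] kills; at n = 1 the value is (1 + e^2) / 2 = 1. *)
Lemma jw_chi (chi : forall n, T n -> F) e n :
    (forall n c, {morph @chi n : a / c *: a >-> c * a}) ->
    (forall n, {morph @chi n : a b / a + b}) ->
    (forall n, {morph @chi n : a b / a * b}) -> (forall n, @chi n 1 = 1) ->
    (forall n, (0 < n)%N -> chi n (gen n 0) = e) ->
    (forall n i, (0 < i < n)%N -> chi n (gen n i) = 0) ->
    (forall n (a : T n), chi n.+1 (emb a) = chi n a) -> e * e = 1 ->
  chi n (jw e n) = 1.
Proof.
move=> chiZ chiD chiM chi1 chis chiU chi_emb ee.
case: n => [|n]; first exact: chi1.
elim: n => [|n IH]; first by rewrite /= chiZ chiD chi1 chiZ chis // ee mulVf // two_neq0.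
rewrite jwSS -scaleN1r chiD !chiZ !chiM chiU ?ltnSn //.
by rewrite mulr0 mul0r !mulr0 addr0 chi_emb.
Qed.

End JonesWenzl.

(** The letters of TL(B_n) are smaller than n, hence at distance at least 2 from n + 1. If s_0 is
    among them then n >= 1, so it commutes with U_(n+1). *)
Lemma TLB_embed2_comm (k : comNzRingType) (delta : k) n (a : TLB delta n) :
  TLB_embed (TLB_embed a) * TLB_gen delta n.+2 n.+1 =
  TLB_gen delta n.+2 n.+1 * TLB_embed (TLB_embed a).
Proof.
apply/esym; rewrite -/(GRing.comm _ _).
elim/TLB_ind: a => [x y ex ey|c x ex||i x ex].
- by rewrite (TLB_embedD x y) (TLB_embedD (TLB_embed x)); apply: commrD.
- rewrite (TLB_embedZ c x) (TLB_embedZ c (TLB_embed x)) /GRing.comm.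
  rewrite -TLB_scalerAl -ex; exact/esym/TLB_scalerAr.
- by rewrite (TLB_embed1 delta n) (TLB_embed1 delta n.+1); apply: commr1.
have ilt := ltn_ord i.
set g := TLB_gen delta n i.
rewrite (TLB_embedM g x) (TLB_embedM (TLB_embed g)); apply: commrM; last exact: ex.
rewrite /g (TLB_embed_gen delta ilt) (TLB_embed_gen delta (leqW ilt)).
rewrite /GRing.comm; have [->|i0] := posnP i.
  by apply/esym/TLB_gen_sU; lia.
by apply/esym/TLB_gen_UUC; lia.
Qed.

Lemma TLB_chi_embed (k : comNzRingType) (delta e : k) n (a : TLB delta n) :
  e * e = 1 -> TLB_chi e (TLB_embed a) = TLB_chi e a.
Proof.
move=> ee; elim/TLB_ind: a => [x y ex ey|c x ex||i x ex].
- rewrite (TLB_embedD x y).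
  exact: etrans (TLB_chiD ee _ _) (etrans (congr2 +%R ex ey) (esym (TLB_chiD ee _ _))).
- by rewrite (TLB_embedZ c x) !(TLB_chiZ ee) ex.
- by rewrite (TLB_embed1 delta n) !(TLB_chi1 _ _ ee).
have ilt := ltn_ord i.
rewrite (TLB_embedM (TLB_gen delta n i) x).
apply: etrans (TLB_chiM ee _ _) (etrans (congr2 *%R _ ex) (esym (TLB_chiM ee _ _))).
rewrite (TLB_embed_gen delta ilt).
by rewrite (TLB_chi_gen delta ee (leqW ilt)) (TLB_chi_gen delta ee ilt).
Qed.

(** * The sum of the two idempotents and TL(D_n) *)

Section SignedIdempotents.

Variables (F : fieldType) (A : algType F) (p m s : A).
Hypothesis two0 : 2 != 0 :> F.
Hypotheses (ps : p * s = p) (sp : s * p = p).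
Hypotheses (ms : m * s = - m) (sm : s * m = - m).

Lemma eqNr_eq0 (x : A) : x = - x -> x = 0.
Proof.
move=> xN; have : 2 *: x = 0 by rewrite scaler_nat mulr2n {2}xN subrr.
by move/eqP; rewrite scaler_eq0 (negPf two0) => /eqP.
Qed.

(** Moving [s] through [u] gives p u m = p s u m = p u s m = - p u m. *)
Lemma signed_mul_comm (u : A) : s * u = u * s -> p * u * m = 0 /\ m * u * p = 0.
Proof.
move=> su; split; apply: eqNr_eq0.
  by rewrite -{1}ps -[p * s * u]mulrA su -!mulrA sm !mulrN.
by rewrite -{1}sp mulrA -[m * u * s]mulrA -su mulrA ms !mulNr.
Qed.

Lemma signed_mul : p * m = 0 /\ m * p = 0.
Proof. by have := @signed_mul_comm 1; rewrite !mulr1 mul1r => /(_ erefl). Qed.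

Lemma signed_add_idem : p * p = p -> m * m = m -> (p + m) * (p + m) = p + m.
Proof.
by have [pm mp] := signed_mul; rewrite mulrDl !mulrDr pm mp => -> ->; rewrite addr0 add0r.
Qed.

Lemma signed_add_step (c : F) (u : A) : s * u = u * s ->
  p - c *: (p * u * p) + (m - c *: (m * u * m)) =
  p + m - c *: ((p + m) * u * (p + m)).
Proof.
move/signed_mul_comm=> [pum mup]; rewrite !(mulrDl, mulrDr) pum mup addr0 add0r.
by rewrite addrACA -opprD scalerDr.
Qed.

(** Used with v = U_1 to see that U_0 kills d_n: next to [p] and [m], the factor [s] only changes a
    sign. *)
Lemma signed_conj_mul (v : A) : v * p = 0 -> v * m = 0 -> p * v = 0 -> m * v = 0 ->
  s * v * s * (p + m) = 0 /\ (p + m) * (s * v * s) = 0.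
Proof.
move=> vp vm pv mv; split.
  by rewrite mulrDr -2!(mulrA (s * v)) sp sm mulrN -2!(mulrA s) vp vm mulr0 oppr0 addr0.
by rewrite mulrDl !mulrA ps ms mulNr pv mv oppr0 mul0r addr0.
Qed.

End SignedIdempotents.

Section HalfIdempotents.

Variables (F : fieldType) (A : algType F) (s : A).
Hypothesis two0 : 2 != 0 :> F.

Let p : A := 2^-1 *: (1 + 1 *: s).
Let m : A := 2^-1 *: (1 + (-1) *: s).

Lemma half_add : p + m = 1.
Proof.
rewrite -scalerDr addrACA -scalerDl subrr scale0r addr0 -mulr2n -scaler_nat.
by rewrite scalerA mulVf // scale1r.
Qed.

(** This takes the place of [signed_add_step] for n = 1, where [s] and [u] do not commute. The terms
    s u and u s cancel in the sum, leaving p u p + m u m = (u + s u s) / 2, and the 2 in c_1 = 2 / d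
    absorbs the half. *)
Lemma half_add_step (d : F) (u : A) :
  p - (2 / d) *: (p * u * p) + (m - (2 / d) *: (m * u * m)) =
  1 - d^-1 *: u - d^-1 *: (s * u * s).
Proof.
have E : p * u * p + m * u * m = 2^-1 *: (u + s * u * s).
  rewrite /p /m scale1r scaleN1r -!scalerAl -!scalerAr !scalerA -scalerDr.
  rewrite !(mulrDl, mulrDr) !(mul1r, mulr1, mulNr, mulrN) !opprK.
  have -> : u + s * u + (u * s + s * u * s) + (u - s * u + (- (u * s) + s * u * s))
      = 2 *: (u + s * u * s).
    rewrite scaler_nat mulr2n addrACA [u + _ + _]addrACA subrr addr0.
    by rewrite [u * s + _ + _]addrACA subrr add0r addrACA.
  by rewrite scalerA mulfVK.
rewrite addrACA half_add -opprD -scalerDr E scalerA mulrAC divff // mul1r.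
by rewrite scalerDr opprD addrA.
Qed.

End HalfIdempotents.

Section TLDClosure.

Variables (k : comNzRingType) (delta : k).

Lemma TLD_scale n c (a : TLB delta n) : TLD a -> TLD (c *: a).
Proof.
move=> Da; have -> : c *: a = c%:A * a by rewrite -TLB_scalerAl mul1r.
by apply: gen_subalgM Da; apply: gen_subalg_scalar.
Qed.

Lemma TLD1 n : TLD (1 : TLB delta n).
Proof. by have := gen_subalg_scalar (@TLD_generator _ delta n) 1; rewrite scale1r. Qed.

Lemma TLD_sub n (a b : TLB delta n) : TLD a -> TLD b -> TLD (a - b).
Proof.
by move=> Da Db; apply: gen_subalgD Da _; rewrite -scaleN1r; apply: TLD_scale.
Qed.

Lemma TLD_gen n i : (0 < i < n)%N -> TLD (TLB_gen delta n i).
Proof. by case/andP=> i0 ilt; apply: gen_subalg_gen; right; exists i. Qed.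

Lemma TLD_U0 n : (1 < n)%N -> TLD (U0 delta n).
Proof. by move=> n1; apply: gen_subalg_gen; left. Qed.

Lemma TLD_embed n (a : TLB delta n) : TLD a -> TLD (TLB_embed a).
Proof.
elim=> {a} [a [[n2 ->]|[i [i0 ilt ->]]]|c|x y _ Dx _ Dy|x y _ Dx _ Dy].
- rewrite /U0; set s := TLB_gen _ _ 0; set u := TLB_gen _ _ 1.
  rewrite (TLB_embedM (s * u)) (TLB_embedM s) /s /u.
  rewrite (TLB_embed_gen delta n2) (TLB_embed_gen delta (ltnW n2)).
  exact/TLD_U0/ltnW.
- by rewrite (TLB_embed_gen delta ilt); apply: TLD_gen; rewrite i0 leqW.
- by rewrite (TLB_embedZ c 1) (TLB_embed1 delta n); apply: gen_subalg_scalar.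
- by rewrite (TLB_embedD x); exact: (gen_subalgD Dx Dy).
- by rewrite (TLB_embedM x); exact: (gen_subalgM Dx Dy).
Qed.

End TLDClosure.

Section TLBJonesWenzl.

Variables (F : fieldType) (q : F).
Hypotheses (q0 : q != 0) (q1 : forall m, q ^+ m + 1 != 0).

Let delta : F := q + q^-1.
Let two0 : 2 != 0 :> F := two_neq0 q1.

Definition TLB_jw (e : F) (n : nat) : TLB (q + q^-1) n :=
  @jw F q (fun n => TLB (q + q^-1) n : algType F)
    (@TLB_embed F (q + q^-1)) (@TLB_gen F (q + q^-1)) e n.

Lemma TLB_jwSS e n : TLB_jw e n.+2 = TLB_embed (TLB_jw e n.+1)
  - jw_coef q n.+1 *: (TLB_embed (TLB_jw e n.+1) * TLB_gen delta n.+2 n.+1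
                       * TLB_embed (TLB_jw e n.+1)).
Proof. exact: erefl. Qed.

Section Properties.

Variables (e : F) (n : nat).
Hypotheses (ee : e * e = 1) (n0 : (0 < n)%N).

Let b := TLB_jw e n.

Lemma TLB_jwP : [/\ b * b = b,
  forall i, (0 < i < n)%N -> TLB_gen delta n i * b = 0,
  forall i, (0 < i < n)%N -> b * TLB_gen delta n i = 0,
  TLB_gen delta n 0 * b = e *: b & b * TLB_gen delta n 0 = e *: b].
Proof.
have [] := @jwP F q q0 q1 (fun n => TLB (q + q^-1) n : algType F)
    (@TLB_embed F (q + q^-1)) (@TLB_gen F (q + q^-1)) (@TLB_embedD _ _)
    (@TLB_embedZ _ _) (@TLB_embedM _ _) (@TLB_embed1 _ _)
    (@TLB_embed_gen _ _) (@TLB_embed2_comm _ _) (@TLB_gen_ss _ _)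
    (@TLB_gen_UsU _ _) (@TLB_gen_UU _ _) (@TLB_gen_UUU _ _) e n ee n0.
by move=> h1 h2 h3 h4 h5; split; [exact: h1|exact: h2|exact: h3|exact: h4|exact: h5].
Qed.

Lemma TLB_jw_chi : TLB_chi e b = 1.
Proof.
apply: (@jw_chi F q q1 (fun n => TLB (q + q^-1) n : algType F)
    (@TLB_embed F (q + q^-1)) (@TLB_gen F (q + q^-1)) (fun n => @TLB_chi _ _ e n)).
- by move=> m c a; apply: TLB_chiZ.
- by move=> m a a'; apply: TLB_chiD.
- by move=> m a a'; apply: TLB_chiM.
- by move=> m; apply: TLB_chi1.
- by move=> m m0; apply: (TLB_chi_gen _ ee m0).
- by move=> m i /andP[i0 ilt]; rewrite (TLB_chi_gen _ ee ilt) gtn_eqF.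
- by move=> m a; apply: TLB_chi_embed.
- exact: ee.
Qed.

Lemma TLB_jw_unique : is_unique_nz_idempotent (fun x : TLB (q + q^-1) n =>
  [/\ forall i, (0 < i < n)%N ->
        TLB_gen (q + q^-1) n i * x = 0 /\ x * TLB_gen (q + q^-1) n i = 0,
      x * TLB_gen (q + q^-1) n 0 = e *: x & TLB_gen (q + q^-1) n 0 * x = e *: x]) b.
Proof.
have [bb Ub bU sb bs] := TLB_jwP.
apply: (@unique_nz_idempotent_chi F (TLB (q + q^-1) n) (@TLB_chi _ _ e n)).
- exact: TLB_chi0.
- exact: TLB_jw_chi.
- exact: bb.
- by split; [move=> i ilt; split; [exact: Ub|exact: bU]|exact: bs|exact: sb].
move=> x [Ux xs sx]; split.
  by apply: (TLB_chi_mull ee) => [i ilt|_]; [have [] := Ux i ilt|exact: sx].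
by apply: (TLB_chi_mulr ee) => [i ilt|_]; [exact: bU|exact: bs].
Qed.

End Properties.

Definition TLB_jwD (n : nat) : TLB (q + q^-1) n := TLB_jw 1 n + TLB_jw (-1) n.

Let e1 : 1 * 1 = 1 :> F := mulr1 1.
Let eN1 : -1 * -1 = 1 :> F.
Proof. by rewrite mulrNN mulr1. Qed.

Lemma TLB_jw_signs n (p := TLB_jw 1 n) (m := TLB_jw (-1) n) (s := TLB_gen delta n 0) :
  (0 < n)%N -> [/\ p * s = p, s * p = p, m * s = - m & s * m = - m].
Proof.
move=> n0; have [_ _ _ sp ps] := TLB_jwP e1 n0; have [_ _ _ sm ms] := TLB_jwP eN1 n0.
rewrite /s /p /m sp ps sm ms; split; first exact: scale1r.
- exact: scale1r.
- exact: scaleN1r.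
exact: scaleN1r.
Qed.

Lemma TLB_jwD1 : TLB_jwD 1 = 1.
Proof. exact: (half_add _ two0). Qed.

Lemma TLB_jwD2 : TLB_jwD 2 = 1 - (q + q^-1)^-1 *: TLB_gen (q + q^-1) 2 1
  - (q + q^-1)^-1 *: U0 (q + q^-1) 2.
Proof.
have jwE e : TLB_embed (TLB_jw e 1) = 2^-1 *: (1 + e *: TLB_gen delta 2 0).
  have -> : TLB_jw e 1 = 2^-1 *: (1 + e *: TLB_gen delta 1 0) by exact: erefl.
  rewrite (TLB_embedZ 2^-1 (1 + e *: TLB_gen delta 1 0)).
  rewrite (TLB_embedD 1 (e *: TLB_gen delta 1 0)) (TLB_embed1 delta 1).
  rewrite (TLB_embedZ e (TLB_gen delta 1 0)) (@TLB_embed_gen _ delta 1 0 isT).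
  exact: erefl.
have jw2E e (b := 2^-1 *: (1 + e *: TLB_gen delta 2 0)) :
    TLB_jw e 2 = b - (2 / (q + q^-1)) *: (b * TLB_gen delta 2 1 * b).
  by rewrite (TLB_jwSS e 0) (jwE e) jw_coef1; exact: erefl.
apply: etrans (congr2 +%R (jw2E 1) (jw2E (-1))) _.
exact: (half_add_step _ two0).
Qed.

(** The bound on n enters through s_0 U_n = U_n s_0, which makes the mixed terms vanish. *)
Lemma TLB_jwDS n : (2 <= n)%N -> TLB_jwD n.+1 = TLB_embed (TLB_jwD n)
  - jw_coef q n *: (TLB_embed (TLB_jwD n) * TLB_gen (q + q^-1) n.+1 n
                     * TLB_embed (TLB_jwD n)).
Proof.
case: n => // n n1; rewrite (TLB_embedD (TLB_jw 1 n.+1)).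
apply: etrans (congr2 +%R (TLB_jwSS 1 n) (TLB_jwSS (-1) n)) _.
have [] := @TLB_jw_signs n.+1 isT.
set p := TLB_jw 1 _; set m := TLB_jw _ _; set s := TLB_gen _ _ 0 => ps sp ms sm.
have es : TLB_embed s = TLB_gen delta n.+2 0 by exact: TLB_embed_gen.
have eN : TLB_embed (- m) = - TLB_embed m.
  by rewrite -scaleN1r (TLB_embedZ (-1) m) scaleN1r.
apply: (@signed_add_step F (TLB delta n.+2) _ _ (TLB_embed s)).
- exact: two0.
- exact: etrans (esym (TLB_embedM p s)) (congr1 _ ps).
- exact: etrans (esym (TLB_embedM s p)) (congr1 _ sp).
- exact: etrans (esym (TLB_embedM m s)) (etrans (congr1 _ ms) eN).
- exact: etrans (esym (TLB_embedM s m)) (etrans (congr1 _ sm) eN).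
by rewrite es; exact: TLB_gen_sU.
Qed.

Lemma TLD_jwD n : (0 < n)%N -> TLD (TLB_jwD n).
Proof.
case: n => // n _; elim: n => [|[|n] IH].
- by rewrite TLB_jwD1; apply: TLD1.
- rewrite TLB_jwD2; apply: TLD_sub; last exact/TLD_scale/TLD_U0.
  by apply: TLD_sub; [exact: TLD1|exact/TLD_scale/TLD_gen].
have De := TLD_embed IH.
rewrite (@TLB_jwDS n.+2 isT); apply: TLD_sub; [exact: De|apply: TLD_scale].
apply: gen_subalgM; [apply: gen_subalgM; [exact: De|]|exact: De].
by apply: TLD_gen; rewrite ltnSn.
Qed.

Lemma TLB_jwD_unique n : (0 < n)%N ->
  is_unique_nz_idempotent (fun b : TLB (q + q^-1) n =>
    TLD b /\ forall u : TLB (q + q^-1) n, TLD_generator u -> u * b = 0 /\ b * u = 0)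
    (TLB_jwD n).
Proof.
move=> n0; have [ps sp ms sm] := TLB_jw_signs n0.
have [pp Up pU _ _] := TLB_jwP e1 n0; have [mm Um mU _ _] := TLB_jwP eN1 n0.
have Pd : TLD (TLB_jwD n) /\ forall u : TLB (q + q^-1) n, TLD_generator u ->
    u * TLB_jwD n = 0 /\ TLB_jwD n * u = 0.
  split; first exact: TLD_jwD.
  have dU i : (0 < i < n)%N ->
      TLB_gen delta n i * TLB_jwD n = 0 /\ TLB_jwD n * TLB_gen delta n i = 0.
    move=> ilt; rewrite /TLB_jwD (mulrDr (TLB_gen _ _ _)) (mulrDl (TLB_jw 1 n)).
    by rewrite Up // Um // pU // mU // addr0.
  move=> u [[n2 ->]|[i [i0 ilt ->]]]; last by apply: dU; rewrite i0 ilt.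
  rewrite /U0 /TLB_jwD; set s := TLB_gen _ _ 0; set v := TLB_gen _ _ 1.
  have [Up1 Um1 pU1 mU1] : [/\ v * TLB_jw 1 n = 0, v * TLB_jw (-1) n = 0,
      TLB_jw 1 n * v = 0 & TLB_jw (-1) n * v = 0].
    by split; [exact: Up|exact: Um|exact: pU|exact: mU].
  exact: (signed_conj_mul ps sp ms sm Up1 Um1 pU1 mU1).
apply: (@unique_nz_idempotent_chi F (TLB (q + q^-1) n) (@TLB_chi _ _ 1 n)).
- exact: TLB_chi0.
- rewrite /TLB_jwD (TLB_chiD e1) (TLB_jw_chi _ e1).
  (* The character with s_0 |-> 1, applied to b_- s_0 = - b_-, gives chi(b_-) = - chi(b_-). *)
  suff -> : TLB_chi 1 (TLB_jw (-1) n) = 0 by rewrite addr0.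
  have := congr1 (@TLB_chi _ _ 1 n) ms; rewrite (TLB_chiM e1) (TLB_chi_gen _ e1 n0) mulr1.
  rewrite -scaleN1r (TLB_chiZ e1) mulN1r => /eqP; rewrite -subr_eq0 opprK -mulr2n.
  by rewrite -mulr_natr mulf_eq0 (negPf two0) orbF => /eqP.
- exact: (signed_add_idem two0 ps sp ms sm pp mm).
- exact: Pd.
move=> x [Dx Ux]; have [Dd dU] := Pd.
have [dx _] := TLD_chi_mul e1 Ux Dd; have [_ xd] := TLD_chi_mul e1 dU Dx.
by split; [exact: dx|exact: xd].
Qed.

End TLBJonesWenzl.

(** * The stacking action on diagrams *)

(** The guards select a comparison whose sides contain no conditional, so inner comparisons are
    decided first; [congruence] prunes the contradictory branches after each split. *)
Ltac join_cases :=
  rewrite /=; try congruence;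
  try match goal with |- context [?a == ?b] =>
    lazymatch a with context [if _ then _ else _] => fail | _ =>
    lazymatch b with context [if _ then _ else _] => fail | _ =>
    case: (@eqP _ a b) => ?; join_cases end end
  end.

(* join_mate and join_dots for arbitrary functions m (mates) and d (dots). *)
Section JoinFun.

Variable T : eqType.
Implicit Types (l r x y p : T) (m : T -> T) (d : T -> bool).

Definition joinm l r m p : T :=
  if p == l then r else if p == r then l
  else if p == m l then m r else if p == m r then m l else m p.

Definition joind l r m d p : bool :=
  if (p == l) || (p == r) then false
  else if (p == m l) || (p == m r) then d l (+) d r else d p.

Variables (m : T -> T) (d : T -> bool).
Hypotheses (mK : involutive m) (mN : forall p, m p <> p) (dm : forall p, d (m p) = d p).

(** Straightening of a zigzag, the content of U_i U_j U_i = U_i. The two forms serve j = i + 1 and j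
    = i - 1. *)
Lemma joinm_zigzag x y z p (xy : x <> y) (yz : y <> z) (xz : x <> z) : m x = y ->
  joinm x y (joinm y z m) p = m p /\ joinm y x (joinm z y m) p = m p.
Proof.
move=> mxy; have mx := mK x; have my := mK y; have mz := mK z; have mp := mK p.
have [Nx Ny Nz Np] : [/\ m x <> x, m y <> y, m z <> z & m p <> p] by split; exact: mN.
split; rewrite /joinm; join_cases.
Qed.

Lemma joind_zigzag x y z p (xy : x <> y) (yz : y <> z) (xz : x <> z) : m x = y -> d x = false ->
  joind x y (joinm y z m) (joind y z m d) p = d p /\ 
  joind y x (joinm z y m) (joind z y m d) p = d p.
Proof.
move=> mxy dx; have mx := mK x; have my := mK y; have mz := mK z; have mp := mK p.
have [Nx Ny Nz Np] : [/\ m x <> x, m y <> y, m z <> z & m p <> p] by split; exact: mN.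
have dy := dm x; have dz := dm z; have dp := dm p.
split; rewrite /joind /joinm; join_cases.
all: have dy0 : d y = false by rewrite -mxy dm.
all: by rewrite dy0 ?addbF ?addFb; congruence.
Qed.

Section TwoJoins.

Variables (l r x y : T).
Hypotheses (lr : l <> r) (lx : l <> x) (ly : l <> y) (rx : r <> x) (ry : r <> y) (xy : x <> y).

(** The excluded cases are those in which the strands at [l], [r], [x], [y] and the two caps form a
    closed circle; they are treated in [joinm_loop]. *)
Lemma joinm_comm p : ~ (m l = x /\ m r = y) -> ~ (m l = y /\ m r = x) ->
  joinm l r (joinm x y m) p = joinm x y (joinm l r m) p.
Proof.
move=> h1 h2.
have [ml mr] := (mK l, mK r); have [mx my mp] := And3 (mK x) (mK y) (mK p).
have [Nl Nr] : m l <> l /\ m r <> r by split; exact: mN.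
have [Nx Ny Np] : [/\ m x <> x, m y <> y & m p <> p] by split; exact: mN.
have {h1} [h1|h1] : m l <> x \/ m r <> y.
  by case: (@eqP _ (m l) x) => e; [right=> e'; apply: h1|left].
all: have {h2} [h2|h2] : m l <> y \/ m r <> x.
all: try by case: (@eqP _ (m l) y) => e; [right=> e'; apply: h2|left].
all: rewrite /joinm; join_cases.
Qed.

Lemma joind_comm p : ~ (m l = x /\ m r = y) -> ~ (m l = y /\ m r = x) ->
  joind l r (joinm x y m) (joind x y m d) p = joind x y (joinm l r m) (joind l r m d) p.
Proof.
move=> h1 h2.
have [ml mr] := (mK l, mK r); have [mx my mp] := And3 (mK x) (mK y) (mK p).
have [Nl Nr] : m l <> l /\ m r <> r by split; exact: mN.
have [Nx Ny Np] : [/\ m x <> x, m y <> y & m p <> p] by split; exact: mN.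
have [dl dr] := (dm l, dm r); have [dx dy dp] := And3 (dm x) (dm y) (dm p).
have {h1} [h1|h1] : m l <> x \/ m r <> y.
  by case: (@eqP _ (m l) x) => e; [right=> e'; apply: h1|left].
all: have {h2} [h2|h2] : m l <> y \/ m r <> x.
all: try by case: (@eqP _ (m l) y) => e; [right=> e'; apply: h2|left].
all: rewrite /joind /joinm; join_cases.
all: case: (d p) dp => dp; case: (d l) dl => dl; case: (d r) dr => dr.
all: case: (d x) dx => dx; case: (d y) dy => dy; rewrite /=; congruence.
Qed.

Lemma joinm_hit : m l <> r -> joinm x y m l = r ->
  m l = x /\ m r = y \/ m l = y /\ m r = x.
Proof.
move=> mlr; rewrite /joinm; case: eqP => [/lx//|_]; case: eqP => [/ly//|_].
case: eqP => [-> <-|_]; first by rewrite !mK; left.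
by case: eqP => [-> <-|_] //; rewrite !mK; right.
Qed.

(** The first join makes [x] and [y] mates, so the second stacking closes a circle. The sum of the
    two dots decides whether this circle contributes 0 or delta. *)
Lemma joinm_loop p : m l = x /\ m r = y \/ m l = y /\ m r = x ->
  [/\ joinm l r m x = y, joind l r m d x = d l (+) d r &
      joinm l r m p = joinm x y m p].
Proof.
have [ml mr] := (mK l, mK r); have [mx my mp] := And3 (mK x) (mK y) (mK p).
have [Nl Nr] : m l <> l /\ m r <> r by split; exact: mN.
have [Nx Ny Np] : [/\ m x <> x, m y <> y & m p <> p] by split; exact: mN.
by case=> -[e1 e2]; split; rewrite /joind /joinm; join_cases.
Qed.

Lemma joind_loop p : m l = x /\ m r = y \/ m l = y /\ m r = x ->
  d l (+) d r = false -> joind l r m d p = joind x y m d p.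
Proof.
have [ml mr] := (mK l, mK r); have [mx my mp] := And3 (mK x) (mK y) (mK p).
have [dl dr] := (dm l, dm r).
have dC := addbC (d l) (d r).
case=> -[e1 e2] dlr; rewrite /joind /joinm; join_cases.
Qed.

End TwoJoins.

Definition toggled z m d p := d p (+) ((p == z) || (p == m z)).

Lemma joind_toggle l r z p (lr : l <> r) (lz : l <> z) (rz : r <> z) : m l <> r ->
  joind l r m (toggled z m d) p = toggled z (joinm l r m) (joind l r m d) p.
Proof.
move=> mlr.
have [ml mr] := (mK l, mK r); have [mz mp] := (mK z, mK p).
have [Nl Nr Nz] : [/\ m l <> l, m r <> r & m z <> z] by split; exact: mN.
rewrite /toggled /joind /joinm; join_cases.
all: by case: (d l); case: (d r); case: (d p).
Qed.

End JoinFun.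

(** * The stacking operators satisfy the relations of TL(B_n) *)

Section StackRelations.

Variables (k : comNzRingType) (delta : k) (n : nat).

Local Notation op := (@stack_op k delta n).
Local Notation e D := (basis_vector k (D : diagram n)).
Implicit Types (D E : diagram n) (i j z : 'I_n).

Let dd D p := p \in dots D.
Let l i : 'I_n.*2 := top_point (pred_ord i).
Let r i : 'I_n.*2 := top_point i.

Lemma diagram_eq D E : mate D =1 mate E -> (forall p, dd D p = dd E p) -> D = E.
Proof.
move=> em ed; apply: val_inj; rewrite [LHS]surjective_pairing [RHS]surjective_pairing.
by congr (_, _); [apply/ffunP|apply/setP].
Qed.

Lemma stack_op_basis i D : op i (e D) = (stack delta i D).1 *: e (stack delta i D).2.
Proof.
rewrite kernel_op_basis; apply/ffunP=> D'; rewrite !ffunE.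
by rewrite -[LHS]mulr_natr.
Qed.

Lemma mateK_diagram D : involutive (mate D). Proof. by case: (diagramP D). Qed.

Lemma mateN_diagram D p : mate D p <> p.
Proof. by case: (diagramP D) => _ mN _ _ _ /(congr1 val); apply: mN. Qed.

Lemma dots_mate_diagram D p : dd D (mate D p) = dd D p.
Proof.
case: (diagramP D) => mK _ _ dm _; apply/idP/idP => [/dm|/dm//].
by rewrite mK.
Qed.

Variant stack_spec i D : k -> diagram n -> Prop :=
| StackLoop of mate D (l i) = r i :
    stack_spec i D (if dd D (l i) then 0 else delta) D
| StackJoin E of mate D (l i) <> r i & mate E =1 joinm (l i) (r i) (mate D)
    & (forall p, dd E p = joind (l i) (r i) (mate D) (dd D) p) :
    stack_spec i D 1 E.

Lemma stackP i D : (0 < i)%N -> stack_spec i D (stack delta i D).1 (stack delta i D).2.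
Proof.
move=> i0; have := @stack_cupcapE k delta n i D i0.
rewrite /stack gtn_eqF //; case: eqP => [e _|ne /(_ isT) E] /=.
  exact: StackLoop.
apply: StackJoin; first exact: ne.
  by move=> p; rewrite /mate E /= ffunE.
by move=> p; rewrite /dd /dots E /= inE.
Qed.

Lemma stack_dotP z D (z0 : z = 0%N :> nat) (E := (stack delta z D).2) :
  [/\ (stack delta z D).1 = 1, mate E =1 mate D &
      forall p, dd E p = toggled (r z) (mate D) (dd D) p].
Proof.
split; first by rewrite /stack z0 eqxx.
  by move=> p; rewrite /mate stack_dotE.
by move=> p; rewrite /dd /dots stack_dotE //= inE.
Qed.

Local Opaque stack_op basis_vector fun_of_lfun.

Lemma op_join i D E : (0 < i)%N -> mate D (l i) <> r i ->
    mate E =1 joinm (l i) (r i) (mate D) ->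
    (forall p, dd E p = joind (l i) (r i) (mate D) (dd D) p) -> op i (e D) = e E.
Proof.
move=> i0 ne mE dE; rewrite stack_op_basis.
case: (stackP D i0) => [|E' _ mE' dE']; first by move/ne.
rewrite scale1r; congr basis_vector.
by apply: diagram_eq => p; rewrite ?mE ?mE' ?dE ?dE'.
Qed.

Lemma op_loop i D : (0 < i)%N -> mate D (l i) = r i ->
  op i (e D) = (if dd D (l i) then 0 else delta) *: e D.
Proof.
move=> i0 le; rewrite stack_op_basis; case: (stackP D i0) => [_|E []]; first exact: erefl.
exact: le.
Qed.

Lemma op_dot z D E : z = 0%N :> nat -> mate E =1 mate D ->
  (forall p, dd E p = toggled (r z) (mate D) (dd D) p) -> op z (e D) = e E.
Proof.
move=> z0 mE dE; rewrite stack_op_basis; have [-> mE' dE'] := stack_dotP D z0.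
rewrite scale1r; congr basis_vector.
by apply: diagram_eq => p; rewrite ?mE ?mE' ?dE ?dE'.
Qed.

Lemma neq_lr i : (0 < i)%N -> l i <> r i.
Proof. by move=> i0 /(congr1 val) /=; lia. Qed.

(** Unless a dotted circle kills it, the result of stacking U_i has the undotted cup at i. This
    reduces U_i^2, U_i U_j U_i and U_1 s_0 U_1 to the action of the outer factors on such a
    diagram. *)
Lemma op_cup i D : (0 < i)%N -> op i (e D) = 0 \/ exists c E,
  [/\ op i (e D) = c *: e E, mate E (l i) = r i & dd E (l i) = false].
Proof.
move=> i0; rewrite stack_op_basis; case: (stackP D i0) => [le|E ne mE dE].
  case: ifP => [dl|dl]; first by left; rewrite scale0r.
  by right; exists delta, D.
by right; exists 1, E; rewrite mE dE /joinm /joind eqxx.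
Qed.

Lemma op_zigzag i j D : (0 < i)%N -> (0 < j)%N -> i.+1 = j :> nat \/ j.+1 = i :> nat ->
  mate D (l i) = r i -> dd D (l i) = false -> op i (op j (e D)) = e D.
Proof.
move=> i0 j0 ij mD dD.
have mK := @mateK_diagram D; have mN := @mateN_diagram D.
have dm := @dots_mate_diagram D.
have lri := neq_lr i0; have lrj := neq_lr j0; have vE := congr1 (@nat_of_ord n.*2).
case: ij => ij.
  have e1 : l j = r i by apply: val_inj; rewrite /= -ij.
  have rirj : r i <> r j by move/vE => /=; lia.
  have lirj : l i <> r j by move/vE => /=; lia.
  have mj : mate D (l j) = l i by rewrite e1 -mD mK.
  apply: etrans (congr1 (op i) (stack_op_basis j D)) _.
  case: (stackP D j0) => [e2|E _ mE dE].
    by case: lirj; rewrite -mj.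
  rewrite e1 in mE dE; rewrite scale1r; apply: op_join.
  - exact: i0.
  - rewrite mE /joinm; have := mK (l i); have := mK (r j); join_cases.
  - move=> p; rewrite /joinm !mE; have [ha hb] := joinm_zigzag mK mN p lri rirj lirj mD.
    exact/esym/ha.
  - move=> p; rewrite /joinm /joind !mE !dE.
    have [ha _] := joind_zigzag mK mN dm p lri rirj lirj mD dD; exact/esym/ha.
have e1 : r j = l i by apply: val_inj; rewrite /= -ij.
have rilj : r i <> l j by move/vE => /=; lia.
have lilj : l i <> l j by move/vE => /=; lia.
have rli : r i <> l i by move=> /esym.
have mr : mate D (r i) = l i by rewrite -mD mK.
have dr : dd D (r i) = false by rewrite -mD dm.
apply: etrans (congr1 (op i) (stack_op_basis j D)) _.
case: (stackP D j0) => [e2|E _ mE dE].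
  by case: rilj; rewrite -mD -e1 -e2 mK.
rewrite e1 in mE dE; rewrite scale1r; apply: op_join.
- exact: i0.
- rewrite mE /joinm; have := mK (l i); have := mK (l j); join_cases.
- move=> p; rewrite /joinm !mE; have [ha hb] := joinm_zigzag mK mN p rli lilj rilj mr.
    exact/esym/hb.
- move=> p; rewrite /joinm /joind !mE !dE.
  have [_ hb] := joind_zigzag mK mN dm p rli lilj rilj mr dr; exact/esym/hb.
Qed.

Lemma op_lin i c v : op i (c *: v) = c *: op i v.
Proof. exact: linearZ. Qed.

Lemma op0 i : op i 0 = 0.
Proof. exact: linear0. Qed.

Lemma op_UU i v : (0 < i)%N -> op i (op i v) = delta *: op i v.
Proof.
move=> i0; rewrite -comp_lfunE -scale_lfunE.
congr (fun_of_lfun _ v); apply: lfun_basis_ext => D; rewrite comp_lfunE scale_lfunE.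
have [->|[c [E [-> mE dE]]]] := op_cup D i0; first by rewrite !linear0 ?scaler0.
by rewrite op_lin op_loop // dE !scalerA mulrC.
Qed.

Lemma op_UUU i j v : (0 < i)%N -> (0 < j)%N -> i.+1 = j :> nat \/ j.+1 = i :> nat ->
  op i (op j (op i v)) = op i v.
Proof.
move=> i0 j0 ij; rewrite -[op i (op j _)]comp_lfunE -comp_lfunE.
congr (fun_of_lfun _ v); apply: lfun_basis_ext => D; rewrite !comp_lfunE.
have [h|[c [E [h mE dE]]]] := op_cup D i0.
all: apply: etrans (congr1 (fun w => op i (op j w)) h) (etrans _ (esym h)).
  exact: etrans (congr1 (op i) (op0 j)) (op0 i).
apply: etrans (congr1 (op i) (op_lin j c _)) (etrans (op_lin i c _) _).
by congr (_ *: _); apply: op_zigzag.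
Qed.

Lemma op_ss z v : z = 0%N :> nat -> op z (op z v) = v.
Proof.
move=> z0; rewrite -comp_lfunE -[RHS]id_lfunE.
congr (fun_of_lfun _ v); apply: lfun_basis_ext => D; rewrite comp_lfunE id_lfunE.
apply: etrans (congr1 (op z) (stack_op_basis z D)) _.
have [-> mE dE] := stack_dotP D z0; rewrite scale1r.
apply: op_dot; [exact: z0|by move=> p; rewrite mE|move=> p].
by rewrite /toggled !mE dE /toggled -addbA addbb addbF.
Qed.

Lemma op_UsU z i v : z = 0%N :> nat -> i = 1%N :> nat -> op i (op z (op i v)) = 0.
Proof.
move=> z0 i1; rewrite -[op i (op z _)]comp_lfunE -comp_lfunE -[RHS](zero_lfunE _ v).
have i0 : (0 < i)%N by rewrite i1.
congr (fun_of_lfun _ v); apply: lfun_basis_ext => D; rewrite !comp_lfunE zero_lfunE.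
have [h|[c [E [h mE dE]]]] := op_cup D i0.
all: apply: etrans (congr1 (fun w => op i (op z w)) h) _.
  exact: etrans (congr1 (op i) (op0 z)) (op0 i).
apply: etrans (congr1 (op i) (op_lin z c _)) (etrans (op_lin i c _) _).
apply: etrans (congr1 (fun w => _ *: op i w) (stack_op_basis z E)) _.
have [-> mE' dE'] := stack_dotP E z0.
rewrite scale1r op_loop ?mE' // dE'.
(* For i = 1 the left end of the cup is the first point, so s_0 puts its dot on the cup and the
   circle closed by U_1 is dotted. *)
have -> : l i = r z by apply: val_inj; rewrite /= z0 i1.
have -> : toggled (r z) (mate E) (dd E) (r z).
  rewrite /toggled eqxx /= addbT; have -> : r z = l i by apply: val_inj; rewrite /= z0 i1.
  by rewrite dE.
by rewrite scale0r scaler0.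
Qed.

Lemma op_comm_ext i j : (forall D, op i (op j (e D)) = op j (op i (e D))) ->
  forall v, op i (op j v) = op j (op i v).
Proof.
move=> comm v.
have H : (op i \o op j)%VF = (op j \o op i)%VF; last first.
  apply: etrans (esym (comp_lfunE (op i) (op j) v)) _.
  apply: etrans (congr1 (fun f : 'End(_) => f v) H) _; exact: comp_lfunE.
apply: lfun_basis_ext => D.
exact: etrans (comp_lfunE _ _ _) (etrans (comm D) (esym (comp_lfunE _ _ _))).
Qed.

Lemma op_sU z i v : z = 0%N :> nat -> (2 <= i)%N -> op z (op i v) = op i (op z v).
Proof.
move=> z0 i2; have i0 : (0 < i)%N by lia.
apply: op_comm_ext => D.
have vE := congr1 (@nat_of_ord n.*2).
have lz : l i <> r z by move/vE => /=; lia.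
have rz : r i <> r z by move/vE => /=; lia.
have sZ := stack_op_basis z D; have [cZ mZ dZ] := stack_dotP D z0.
move: sZ; rewrite cZ scale1r; set Z := (stack _ _ _).2 in mZ dZ * => sZ.
apply: etrans _ (esym (congr1 (op i) sZ)).
apply: etrans (congr1 (op z) (stack_op_basis i D)) _.
case: (stackP D i0) => [mD|E ne mE dE].
  apply: etrans (op_lin z _ _) (etrans (congr1 _ sZ) _).
  apply/esym; rewrite op_loop ?mZ // dZ /toggled.
  have /eqP/negPf -> := lz.
  suff /negPf -> : l i != mate D (r z) by rewrite addbF.
  by apply/eqP=> /(congr1 (mate D)); rewrite mateK_diagram mD.
rewrite scale1r; apply: etrans (stack_op_basis z E) _; have [-> mF dF] := stack_dotP E z0.
rewrite scale1r; apply/esym/op_join; first exact: i0.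
- by rewrite mZ.
- by move=> p; rewrite /joinm !mZ mF mE.
move=> p; have -> : joind (l i) (r i) (mate Z) (dd Z) p =
    joind (l i) (r i) (mate D) (toggled (r z) (mate D) (dd D)) p.
  by rewrite /joind !mZ !dZ.
rewrite (joind_toggle (dd D) (@mateK_diagram D) (@mateN_diagram D) p (neq_lr i0) lz rz ne).
by rewrite dF /toggled mE dE.
Qed.

Lemma op_stackP i D : (0 < i)%N ->
  (mate D (l i) = r i /\ op i (e D) = (if dd D (l i) then 0 else delta) *: e D) \/
  exists E, [/\ mate D (l i) <> r i, mate E =1 joinm (l i) (r i) (mate D),
    forall p, dd E p = joind (l i) (r i) (mate D) (dd D) p & op i (e D) = e E].
Proof.
move=> i0; have [mi|mi] := eqVneq (mate D (l i)) (r i).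
  by left; split; last exact: op_loop.
right; have {}mi : mate D (l i) <> r i by apply/eqP.
have : exists E, mate E =1 joinm (l i) (r i) (mate D) /\
    forall p, dd E p = joind (l i) (r i) (mate D) (dd D) p.
  by case: (stackP D i0) => [/mi//|E _ mE dE]; exists E.
by case=> E [mE dE]; exists E; split=> //; apply: op_join.
Qed.

Lemma op_UUC i j v : (0 < i)%N -> (i.+2 <= j)%N -> op i (op j v) = op j (op i v).
Proof.
move=> i0 ij; have j0 : (0 < j)%N by lia.
apply: op_comm_ext => D.
have vE := congr1 (@nat_of_ord n.*2).
have lri := neq_lr i0; have lrj := neq_lr j0.
have ll : l i <> l j by move/vE => /=; lia.
have lr : l i <> r j by move/vE => /=; lia.
have rl : r i <> l j by move/vE => /=; lia.
have rr : r i <> r j by move/vE => /=; lia.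
have mK := @mateK_diagram D; have mN := @mateN_diagram D.
have dm := @dots_mate_diagram D.
have [mmli mmri mmlj mmrj] : [/\ mate D (mate D (l i)) = l i, mate D (mate D (r i)) = r i,
    mate D (mate D (l j)) = l j & mate D (mate D (r j)) = r j] by split; exact: mK.
have [[mi si]|[E [mi mE dE si]]] := op_stackP D i0;
  have [[mj sj]|[E' [mj mE' dE' sj]]] := op_stackP D j0.
- apply: etrans (etrans (congr1 (op i) sj) (op_lin i _ _)) _.
  apply: etrans (congr1 ( *:%R _) si) _.
  apply/esym; apply: etrans (etrans (congr1 (op j) si) (op_lin j _ _)) _.
  apply: etrans (congr1 ( *:%R _) sj) _.
  apply: etrans (scalerA _ _ _) (etrans _ (esym (scalerA _ _ _))).
  exact: (congr1 (fun c => c *: e D) (mulrC _ _)).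
- have mE'i : mate E' (l i) = r i by rewrite mE' /joinm; join_cases.
  have dE'i : dd E' (l i) = dd D (l i).
    by rewrite dE' /joind; do 4!(case: eqP => [|_]; first by congruence).
  apply: etrans (etrans (congr1 (op i) sj) (op_loop i0 mE'i)) _; rewrite dE'i.
  apply/esym; apply: etrans (etrans (congr1 (op j) si) (op_lin j _ _)) _.
  exact: (congr1 ( *:%R _) sj).
- have mEj : mate E (l j) = r j by rewrite mE /joinm; join_cases.
  have dEj : dd E (l j) = dd D (l j).
    by rewrite dE /joind; do 4!(case: eqP => [|_]; first by congruence).
  apply: etrans (etrans (congr1 (op i) sj) (op_lin i _ _)) _.
  apply: etrans (congr1 ( *:%R _) si) _.
  apply/esym; apply: etrans (etrans (congr1 (op j) si) (op_loop j0 mEj)) _.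
  rewrite dEj; exact: erefl.
apply: etrans (congr1 (op i) sj) (etrans _ (esym (congr1 (op j) si))).
have rl' : r j <> l i by move/esym.
have ll' : l j <> l i by move/esym.
have lr' : l j <> r i by move/esym.
have rr' : r j <> r i by move/esym.
(* Two genuine joins interact only if they close a circle together. In that case either order
   creates a circle carrying the sum of the two dots: a dotted circle gives 0 on both sides, an
   undotted one gives delta times the same diagram. *)
have [lp|nlp] := pselect (mate D (l i) = l j /\ mate D (r i) = r j \/
                          mate D (l i) = r j /\ mate D (r i) = l j).
  have lp' : mate D (l j) = l i /\ mate D (r j) = r i \/
             mate D (l j) = r i /\ mate D (r j) = l i.
    by case: lp => -[<- <-]; rewrite !mK; [left|right].
  have [mEj dEj _] := joinm_loop (dd D) mK mN ll lr rl rr (l j) lp.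
  have [mEi dEi _] := joinm_loop (dd D) mK mN ll' lr' rl' rr' (l j) lp'.
  rewrite -mE in mEj; rewrite -dE in dEj; rewrite -mE' in mEi; rewrite -dE' in dEi.
  apply: etrans (op_loop i0 mEi) (etrans _ (esym (op_loop j0 mEj))); rewrite dEi dEj.
  have -> : dd D (l j) (+) dd D (r j) = dd D (l i) (+) dd D (r i).
    by case: lp => -[<- <-]; rewrite !dm // addbC.
  case: ifP => [_|dlr]; first exact: etrans (scale0r _) (esym (scale0r _)).
  congr (_ *: basis_vector _ _); apply: diagram_eq => p.
    have [_ _ h] := joinm_loop (dd D) mK mN ll lr rl rr p lp.
    by rewrite mE mE' h.
  by rewrite dE dE' (joind_loop mK dm p lp dlr).
have nlp1 : ~ (mate D (l i) = l j /\ mate D (r i) = r j) by move=> h; apply: nlp; left.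
have nlp2 : ~ (mate D (l i) = r j /\ mate D (r i) = l j) by move=> h; apply: nlp; right.
have lpC : ~ (mate D (l j) = l i /\ mate D (r j) = r i \/
              mate D (l j) = r i /\ mate D (r j) = l i).
  by move=> h; apply: nlp; case: h => -[<- <-]; rewrite !mK; [left|right].
have nE' : mate E' (l i) <> r i by rewrite mE' => /(joinm_hit mK ll lr mi)/nlp.
have nE : mate E (l j) <> r j by rewrite mE => /(joinm_hit mK ll' lr' mj)/lpC.
case: (op_stackP E' i0) => [[/nE' h _]|[G [_ mG dG sG]]]; first by case: h.
apply: etrans sG (esym (op_join j0 nE _ _)) => p.
  rewrite mG /joinm !mE' !mE; exact: (joinm_comm mK mN lri ll lr rl rr lrj p nlp1 nlp2).
rewrite dG /joind /joinm !mE' !dE' !mE !dE.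
exact: (joind_comm mK mN dm lri ll lr rl rr lrj p nlp1 nlp2).
Qed.

End StackRelations.

(** * Integrality of the coefficients *)

Section SubringCoefficients.

Variables (k : comNzRingType) (delta : k) (S : k -> Prop).
Hypotheses (S0 : S 0) (S1 : S 1) (SN : forall x, S x -> S (- x)).
Hypotheses (SD : forall x y, S x -> S y -> S (x + y)) (SM : forall x y, S x -> S y -> S (x * y)).
Hypothesis Sdelta : S delta.

Inductive TLB_form n : TLB delta n -> Prop :=
| form_gen i : (i < n)%N -> TLB_form (TLB_gen delta n i)
| form1 : TLB_form 1
| formZ c a : S c -> TLB_form a -> TLB_form (c *: a)
| formD a b : TLB_form a -> TLB_form b -> TLB_form (a + b)
| formM a b : TLB_form a -> TLB_form b -> TLB_form (a * b).

Lemma formB n (a b : TLB delta n) : TLB_form a -> TLB_form b -> TLB_form (a - b).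
Proof.
by move=> fa fb; apply: formD => //; rewrite -scaleN1r; apply: formZ => //; apply: SN.
Qed.

Lemma form_embed n (a : TLB delta n) : TLB_form a -> TLB_form (TLB_embed a).
Proof.
elim=> {a} [i ilt||c a Sc _ fa|a b _ fa _ fb|a b _ fa _ fb].
- by rewrite (TLB_embed_gen delta ilt); apply/form_gen/ltnW.
- by rewrite (TLB_embed1 delta n); exact: form1.
- by rewrite (TLB_embedZ c a); exact: (formZ Sc fa).
- by rewrite (TLB_embedD a b); exact: (formD fa fb).
- by rewrite (TLB_embedM a b); exact: (formM fa fb).
Qed.

Lemma subring_sum (I : Type) (s : seq I) (f : I -> k) :
  (forall i, S (f i)) -> S (\sum_(i <- s) f i).
Proof. by move=> Sf; elim/big_ind: _. Qed.

Lemma stack_op_subring n (i : 'I_n) (v : {ffun diagram n -> k^o}) :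
  (forall D, S (v D)) -> forall D, S (stack_op delta i v D).
Proof.
move=> Sv D; rewrite kernel_opE; apply: subring_sum => D'; apply: SM; last exact: Sv.
suff Sst : S (stack delta i D').1 by case: (_ == _); rewrite ?mulr1n ?mulr0n.
by rewrite /stack; do 3?case: ifP.
Qed.

(** Stacking a letter multiplies a diagram by 0, 1 or delta, so the letters preserve the vectors
    with all coordinates in [S], and the identity diagram is such a vector. The claim is made for
    all these vectors because in a product the left factor acts on the image of the right one. *)
Lemma diagram_coef_form n (a : TLB delta n) : TLB_form a ->
  forall D, S (diagram_coef a D).
Proof.
pose rep (b : TLB delta n) := TLB_rep (@stack_op k delta n) b.
have repM := TLB_repM (@op_UU k delta n) (@op_UUU k delta n) (@op_UUC k delta n)
  (@op_ss k delta n) (@op_UsU k delta n) (@op_sU k delta n).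
have repD := TLB_repD (@op_UU k delta n) (@op_UUU k delta n) (@op_UUC k delta n)
  (@op_ss k delta n) (@op_UsU k delta n) (@op_sU k delta n).
have repZ := TLB_repZ (@op_UU k delta n) (@op_UUU k delta n) (@op_UUC k delta n)
  (@op_ss k delta n) (@op_UsU k delta n) (@op_sU k delta n).
have rep1 := TLB_rep1 (@op_UU k delta n) (@op_UUU k delta n) (@op_UUC k delta n)
  (@op_ss k delta n) (@op_UsU k delta n) (@op_sU k delta n).
have repG := TLB_rep_gen (@op_UU k delta n) (@op_UUU k delta n) (@op_UUC k delta n)
  (@op_ss k delta n) (@op_UsU k delta n) (@op_sU k delta n).
move=> fa; suff : forall v : {ffun diagram n -> k^o}, (forall D, S (v D)) ->
    forall D, S (rep a v D).
  by apply=> D; rewrite ffunE; case: (_ == _).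
elim: fa => {a} [i ilt||c a Sc _ IHa|a b _ IHa _ IHb|a b _ IHa _ IHb] v Sv D.
- rewrite /rep (repG (Ordinal ilt)); exact: stack_op_subring.
- by rewrite /rep rep1.
- by rewrite /rep repZ ffunE; apply: SM => //; apply: IHa.
- by rewrite /rep repD ffunE; apply: SD; [apply: IHa|apply: IHb].
by rewrite /rep repM; apply: IHa => D'; apply: IHb.
Qed.

End SubringCoefficients.

Section JonesWenzlCoefficients.

Variables (F : fieldType) (q : F) (S : F -> Prop).
Hypotheses (q0 : q != 0) (q1 : forall m, q ^+ m + 1 != 0).
Hypotheses (S1 : S 1) (SN : forall x, S x -> S (- x)).
Hypotheses (SM : forall x y, S x -> S y -> S (x * y)).
Hypotheses (Sdelta : S (q + q^-1)^-1) (Sjw : forall n, (1 < n)%N -> S (jw_coef q n)).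

(** The induction runs on d_n and starts at n = 1 and n = 2, so the 1/2 of b_(1,+) and b_(1,-) never
    occurs. *)
Lemma TLB_jwD_form n : (0 < n)%N -> TLB_form S (TLB_jwD q n).
Proof.
case: n => // n _; elim: n => [|[|n] IH].
- by rewrite (TLB_jwD1 q1); exact: form1.
- rewrite (TLB_jwD2 q1); apply: formB => //; last first.
    apply: formZ => //; apply: formM; last exact: form_gen.
    by apply: formM; exact: form_gen.
  apply: formB => //; first exact: form1.
  by apply: formZ => //; exact: form_gen.
have fe := form_embed IH; rewrite (@TLB_jwDS F q q0 q1 n.+2 isT); apply: formB => //.
apply: formZ; first exact: Sjw.
apply: formM; [apply: formM; [exact: fe|]|exact: fe].
exact: form_gen.
Qed.

End JonesWenzlCoefficients.

(** The last computation of [int_laurent_jw_coef], with the powers of q replaced by variables. *)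
Lemma div_div_mul (F : fieldType) (q x a b : F) : q != 0 -> x != 0 -> a != 0 ->
  b / x / (a / (q * x)) * a = q * b.
Proof. by move=> q0 x0 a0; field; rewrite q0 x0 a0. Qed.

(** * Fractions with an integral Laurent expansion *)

Section LaurentIntegral.

(** Q is a unit of Z[[X]], and [a] lists the coefficients of the quotient P / Q. *)
Lemma int_series_div (P Q : {poly int}) : Q`_0 = 1 -> exists a : nat -> int,
  forall j, \sum_(i < j.+1) Q`_i * a (j - i)%N = P`_j.
Proof.
move=> Q0.
(* Long division: [s j] holds the first j coefficients, and the next one is determined by them
   without dividing, as Q has constant term 1. *)
pose s := fix s j : seq int := if j is j'.+1 then
  rcons (s j') (P`_j' - \sum_(i < j') Q`_i.+1 * (s j')`_(j' - i.+1)) else [::].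
have sz j : size (s j) = j by elim: j => //= j IH; rewrite size_rcons IH.
pose a j := (s j.+1)`_j; exists a => j.
have sE m i : (i < m)%N -> (s m)`_i = a i.
  elim: m => // m IH; rewrite ltnS leq_eqVlt => /predU1P[->//|im].
  by rewrite /= nth_rcons sz im IH.
rewrite big_ord_recl /= Q0 mul1r subn0 {1}/a /= nth_rcons sz ltnn eqxx.
rewrite -[RHS](subrK (\sum_(i < j) Q`_i.+1 * a (j - i.+1)%N)); congr (_ - _ + _).
by apply: eq_bigr => i _; rewrite sE //; have := ltn_ord i; lia.
Qed.

Variable K : fieldType.
Let Kq : fieldType := {fraction {poly K}}.

Local Notation intp P := (map_poly (intr : int -> K) P).

(* Q is invertible in Z[[X]], so these fractions form a ring of Laurent series
   with integer coefficients. *)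
Definition int_laurent (f : Kq) : Prop := exists (N : nat) (P Q : {poly int}),
  Q`_0 = 1 /\ f * tofrac (intp Q * 'X^N) = tofrac (intp P).

Lemma int_laurent_expansion (f : Kq) : int_laurent f ->
  exists (N : nat) (a : nat -> int) (P Q : {poly K}),
  [/\ Q != 0, f = tofrac P / tofrac Q &
    forall j, \sum_(i < j.+1) Q`_i * (a (j - i)%N)%:~R = (P * 'X^N)`_j].
Proof.
case=> N [P [Q [Q0 fE]]]; have [a aE] := int_series_div P Q0.
have QN : (Q * 'X^N)`_N = 1 by rewrite coefMXn ltnn subnn.
have Q'N : intp Q * 'X^N != 0 :> {poly K}.
  apply/eqP=> /(congr1 (fun p : {poly _} => p`_N)).
  rewrite -(map_polyXn (intr : int -> K)) -rmorphM coef_map QN coef0 => /eqP.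
  by rewrite /= mulr1z oner_eq0.
exists N, a, (intp P), (intp Q * 'X^N); split=> // [|j].
  by rewrite -fE mulfK // tofrac_eq0.
(* The coefficient of X^j in a product with the series only involves its terms up to X^j, so the
   series may be truncated to the polynomial [A]. *)
pose A := \poly_(i < j.+1) a i.
have AE i : (i <= j)%N -> A`_i = a i by rewrite coef_poly ltnS => ->.
have : (Q * 'X^N * A)`_j = (P * 'X^N)`_j.
  rewrite mulrAC !coefMXn; case: ltnP => // Nj.
  rewrite coefM -aE; apply: eq_bigr => i _; rewrite AE //.
  by have := ltn_ord i; lia.
rewrite coefM => /(congr1 (intr : int -> K)).
rewrite -!(map_polyXn (intr : int -> K)) -!rmorphM coef_map /= => <-.
rewrite rmorph_sum; apply: eq_bigr => i _; rewrite coef_map /= rmorphM AE //.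
by have := ltn_ord i; lia.
Qed.

Lemma int_laurent_int (P : {poly int}) : int_laurent (tofrac (intp P)).
Proof. by exists 0, P, 1; rewrite coefC; split=> //; rewrite rmorph1 mul1r expr0 mulr1. Qed.

Lemma int_laurentN f : int_laurent f -> int_laurent (- f).
Proof.
case=> N [P [Q [Q0 fE]]]; exists N, (- P), Q; split=> //.
by rewrite mulNr fE !rmorphN.
Qed.

Lemma int_laurentD f g : int_laurent f -> int_laurent g -> int_laurent (f + g).
Proof.
case=> N [P [Q [Q0 fE]]] [N' [P' [Q' [Q0' gE]]]].
exists (N + N')%N, (P * (Q' * 'X^N') + P' * (Q * 'X^N)), (Q * Q').
split; first by rewrite coef0M Q0 Q0'.
rewrite rmorphD /= !rmorphM /= !map_polyXn exprD.
rewrite !rmorphD /= !rmorphM /= -fE -gE !rmorphM /=; ring.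
Qed.

Lemma int_laurentM f g : int_laurent f -> int_laurent g -> int_laurent (f * g).
Proof.
case=> N [P [Q [Q0 fE]]] [N' [P' [Q' [Q0' gE]]]].
exists (N + N')%N, (P * P'), (Q * Q'); split; first by rewrite coef0M Q0 Q0'.
rewrite !rmorphM /= exprD !rmorphM /= -fE -gE !rmorphM /=; ring.
Qed.

Lemma int_laurent_frac (f : Kq) (P Q : {poly int}) : Q`_0 = 1 ->
  f * tofrac (intp Q) = tofrac (intp P) -> int_laurent f.
Proof. by move=> Q0 fE; exists 0, P, Q; rewrite expr0 mulr1. Qed.

Let q : Kq := tofrac 'X.

Lemma fracX_neq0 : q != 0.
Proof. by rewrite tofrac_eq0 polyX_eq0. Qed.

Hypothesis two0 : 2 != 0 :> K.

(** At X = 1 the polynomial takes the value 2. *)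
Lemma fracX_add1 m : q ^+ m + 1 != 0.
Proof.
rewrite -tofracXn -tofrac1 -tofracD tofrac_eq0.
apply/eqP=> /(congr1 (fun p : {poly _} => p.[1])); rewrite !hornerE expr1n => /eqP.
exact/negP.
Qed.

Lemma fracX_sub1 m : q ^+ m.+1 - 1 != 0.
Proof.
rewrite -tofracXn -tofrac1 -tofracB tofrac_eq0.
by rewrite -size_poly_eq0 size_XnsubC.
Qed.

Lemma int_laurent_delta : int_laurent (q + q^-1).
Proof.
exists 1%N, ('X^2 + 1), 1; rewrite coefC; split=> //.
rewrite rmorph1 mul1r rmorphD rmorph1 /= map_polyXn rmorphD rmorph1 expr1 rmorphXn.
by rewrite mulrDl mulVf ?fracX_neq0.
Qed.

Lemma int_laurent_deltaV : int_laurent (q + q^-1)^-1.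
Proof.
have E : q + q^-1 = (q ^+ 2 + 1) / q by rewrite mulrDl mul1r expr2 mulfK ?fracX_neq0.
apply: (@int_laurent_frac _ 'X ('X^2 + 1)); first by rewrite coefD coefXn coefC.
rewrite E invfM invrK rmorphD rmorph1 /= map_polyXn tofracD tofrac1 tofracXn map_polyX.
by rewrite mulrAC mulVf ?fracX_add1 // mul1r.
Qed.

(** c_n = q (q^(2(n-1)) + 1) / (q^(2n) + 1), whose denominator has constant term 1. *)
Lemma int_laurent_jw_coef n : (1 < n)%N -> int_laurent (jw_coef q n).
Proof.
case: n => // [[|n]] // _.
have qn m : q ^+ m != 0 by rewrite expf_neq0 ?fracX_neq0.
have E m : q ^+ m + q ^- m = (q ^+ (2 * m) + 1) / q ^+ m.
  by rewrite mulrDl mul1r mulnC exprM expr2 mulfK.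
apply: (@int_laurent_frac _ ('X * ('X^(2 * n.+1) + 1)) ('X^(2 * n.+2) + 1)).
  by rewrite coefD coefXn coefC.
rewrite /jw_coef [n.+2.-1]/= !E; move: (fracX_add1 (2 * n.+2)).
move: (2 * n.+2)%N (2 * n.+1)%N => a b h.
rewrite !(rmorphM, rmorphD, rmorph1) /= !map_polyXn map_polyX.
rewrite !(tofracM, tofracD, tofrac1, tofracXn) -/q [q ^+ n.+2]exprS.
apply: div_div_mul; [exact: fracX_neq0|exact: qn|exact: h].
Qed.

End LaurentIntegral.

(** * The tensor representation *)

Section WordUpdate.

Variable n : nat.
Implicit Types (a : word n) (x y z : 'I_n) (c d : 'I_2).

Definition upd a x c : word n := [ffun i => if i == x then c else a i].

Lemma upd_same a x c : upd a x c x = c. Proof. by rewrite ffunE eqxx. Qed.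

Lemma upd_other a x y c : y != x -> upd a x c y = a y.
Proof. by rewrite ffunE => /negPf->. Qed.

Lemma upd_id a x : upd a x (a x) = a.
Proof. by apply/ffunP=> i; rewrite ffunE; case: eqP => [->|]. Qed.

Lemma upd_upd a x c d : upd (upd a x c) x d = upd a x d.
Proof. by apply/ffunP=> i; rewrite !ffunE; case: eqP. Qed.

Lemma upd_comm a x y c d : x != y -> upd (upd a x c) y d = upd (upd a y d) x c.
Proof.
move=> xy; apply/ffunP=> i; rewrite !ffunE.
by have [->|//] := eqVneq i y; rewrite eq_sym (negPf xy).
Qed.

Lemma ord2P c : c = 0 \/ c = 1.
Proof. by case: c => -[|[|c]] // lt; [left|right]; apply: val_inj. Qed.

Definition flip c : 'I_2 := if c == 0 then 1 else 0.

Lemma flipK : involutive flip.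
Proof. by move=> c; have [->|->] := ord2P c. Qed.

Lemma neq_pred x : (0 < x)%N -> pred_ord x != x.
Proof. by move=> x0; rewrite -val_eqE /=; lia. Qed.

End WordUpdate.

(** * The relations of TL(B_n) on tensors *)

Section TensorRelations.

Variables (F : fieldType) (q : F) (n : nat).
Hypothesis q0 : q != 0.

Local Notation op := (@letter_op F q n).
Implicit Types (v w : tensorV F n) (a b : word n) (i j l r x y z : 'I_n).

Lemma tensor_op_swap z v a :
  tensor_op (fun j => if j == z then swap_mx F else 1%:M) v a = v (upd a z (flip (a z))).
Proof.
rewrite kernel_opE (bigD1 (upd a z (flip (a z)))) //= [X in _ + X]big1 ?addr0.
  rewrite big1 ?mul1r // => j _; rewrite ffunE; case: eqP => [->|_].
    rewrite !mxE /flip; have [->|->] := ord2P (a z); by rewrite /= ?addr0 ?add0r.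
  by rewrite mxE eqxx.
move=> b bN; suff [j jP] : exists j, (if j == z then swap_mx F else 1%:M) (a j) (b j) = 0.
  by rewrite (bigD1 j) //= jP !mul0r.
have [j jN] : exists j, b j != upd a z (flip (a z)) j.
  apply/existsP; apply: contraNT bN; rewrite negb_exists => /forallP h.
  by apply/eqP/ffunP=> j; apply/eqP; have := h j; rewrite negbK.
exists j; move: jN; rewrite ffunE; have [->|_] := eqVneq j z => bN'; last first.
  by rewrite mxE eq_sym (negPf bN').
move: bN'; rewrite !mxE /flip.
by have [->|->] := ord2P (a z); have [->|->] := ord2P (b z); rewrite //= addr0.
Qed.

Lemma op_dotE z v a : z = 0%N :> nat -> op z v a = v (upd a z (flip (a z))).
Proof. by move=> z0; rewrite /letter_op z0 eqxx tensor_op_swap. Qed.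

Lemma cupcap_opE l r v a : l != r -> cupcap_op q l r v a = cup q (a l) (a r) *
  (v (upd (upd a l 1) r 0) - q^-1 * v (upd (upd a l 0) r 1)).
Proof.
move=> lr; rewrite kernel_opE.
(* Only two words contribute: they agree with [a] outside [l], [r], and carry y x or x y there, the
   pairs on which the cap is not zero. *)
pose b1 := upd (upd a l 1) r 0; pose b0 := upd (upd a l 0) r 1.
have bl c d : upd (upd a l c) r d l = c by rewrite upd_other // upd_same.
have br c d : upd (upd a l c) r d r = d by rewrite upd_same.
have off c d : [forall j, (j != l) && (j != r) ==> (a j == upd (upd a l c) r d j)].
  by apply/forallP=> j; apply/implyP=> /andP[jl jr]; rewrite !upd_other.
have b10 : b0 != b1.
  by apply/eqP=> /(congr1 (fun b : word n => b r)); rewrite !br.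
rewrite (bigD1 b1) //= (bigD1 b0) //= [X in _ + (_ + X)]big1 ?addr0 => [|b /andP[bN1 bN0]].
  rewrite !off !bl !br /cap /= mulr1 mulrDr; congr (_ + _).
  by rewrite !mulrN mulNr mulrA.
case: ifP => [/forallP h|_]; last by rewrite mul0r.
suff -> : cap q (b l) (b r) = 0 by rewrite mulr0 mul0r.
have bE : b = upd (upd a l (b l)) r (b r).
  apply/ffunP=> j; rewrite !ffunE; case: eqP => [->//|/eqP jr]; case: eqP => [->//|/eqP jl].
  by have := h j; rewrite jl jr => /eqP.
move: bN1 bN0; rewrite bE /b1 /b0 bl br /cap.
by have [->|->] := ord2P (b l); have [->|->] := ord2P (b r); rewrite ?eqxx.
Qed.

(** The contraction of [v] by the cap at [l], [r]. As a function of words it ignores the letters of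
    [a] in these two places ([capval_updl], [capval_updr]). *)
Definition capval l r (v : word n -> F) a : F :=
  v (upd (upd a l 1) r 0) - q^-1 * v (upd (upd a l 0) r 1).

Lemma capval_updl l r (v : word n -> F) a c : l != r -> capval l r v (upd a l c) = capval l r v a.
Proof. by move=> lr; rewrite /capval !upd_upd. Qed.

Lemma capval_updr l r (v : word n -> F) a c : l != r -> capval l r v (upd a r c) = capval l r v a.
Proof.
move=> lr; rewrite /capval -![upd (upd a r c) l _]upd_comm //.
by rewrite !upd_upd.
Qed.

Lemma op_cupE i v a (l := pred_ord i) : (0 < i)%N ->
  op i v a = - cup q (a l) (a i) * capval l i v a.
Proof.
move=> i0; rewrite /letter_op gtn_eqF // opp_lfunE ffunE cupcap_opE ?neq_pred //.
by rewrite mulNr.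
Qed.

Lemma scaleFE (c : F) v a : (c *: v) a = c * v a.
Proof. by rewrite ffunE. Qed.

Lemma addFE v w a : (v + w) a = v a + w a.
Proof. by rewrite ffunE. Qed.

(** The scalar is minus the value q + q^-1, taken with opposite sign, of the cap on the cup; the
    sign in the action of U_i makes it positive. *)
Lemma capval_op i v a (l := pred_ord i) : (0 < i)%N ->
  capval l i (op i v) a = (q + q^-1) * capval l i v a.
Proof.
move=> i0; have lr : l != i := neq_pred i0.
rewrite {1}/capval !(op_cupE _ _ i0) -/l.
rewrite !upd_same !(upd_other _ _ lr) !upd_same !(capval_updr _ _ _ lr) !(capval_updl _ _ _ lr).
by rewrite /cup /=; field.
Qed.

Lemma tensor_UU i v : (0 < i)%N -> op i (op i v) = (q + q^-1) *: op i v.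
Proof.
move=> i0; apply/ffunP=> a; rewrite scaleFE !(op_cupE _ _ i0) capval_op //.
by rewrite mulrCA.
Qed.

Lemma tensor_ss z v : z = 0%N :> nat -> op z (op z v) = v.
Proof.
move=> z0; apply/ffunP=> a; rewrite !(op_dotE _ _ z0) upd_upd upd_same flipK.
by rewrite upd_id.
Qed.

(** s_0 turns the cup x y - q y x into y y - q x x, which the cap kills. *)
Lemma tensor_UsU z i v : z = 0%N :> nat -> i = 1%N :> nat -> op i (op z (op i v)) = 0.
Proof.
move=> z0 i1; have i0 : (0 < i)%N by rewrite i1.
have zl : pred_ord i = z by apply: val_inj; rewrite /= i1 z0.
have lr := neq_pred i0; rewrite zl in lr.
apply/ffunP=> a; rewrite [RHS]ffunE op_cupE // zl /capval !(op_dotE _ _ z0) !(op_cupE _ _ i0) zl.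
have rl : i != z by rewrite eq_sym.
rewrite !upd_same !(upd_other _ _ lr) !(upd_other _ _ rl) !upd_same.
by rewrite /cup /= oppr0 !mul0r mulr0 subrr mulr0.
Qed.

Lemma tensor_sU z i v : z = 0%N :> nat -> (2 <= i)%N -> op z (op i v) = op i (op z v).
Proof.
move=> z0 i2; have i0 : (0 < i)%N by lia.
have zi : i != z by rewrite -val_eqE /=; lia.
have zl : pred_ord i != z by rewrite -val_eqE /=; lia.
apply/ffunP=> a; rewrite (op_dotE _ _ z0) !(op_cupE _ _ i0) !upd_other // /capval !(op_dotE _ _ z0).
rewrite [upd _ i _ z]upd_other 1?eq_sym // [upd _ i _ z]upd_other 1?eq_sym //.
rewrite [upd _ (pred_ord i) _ z]upd_other 1?eq_sym // [upd _ (pred_ord i) _ z]upd_other 1?eq_sym //.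
rewrite ![upd (upd (upd _ _ _) i _) z _]upd_comm //.
by rewrite ![upd (upd _ (pred_ord i) _) z _]upd_comm.
Qed.

Lemma tensor_UUC i j v : (0 < i)%N -> (i.+2 <= j)%N -> op i (op j v) = op j (op i v).
Proof.
move=> i0 ij; have j0 : (0 < j)%N by lia.
have nli : pred_ord i != pred_ord j by rewrite -val_eqE /=; lia.
have nlj : pred_ord i != j by rewrite -val_eqE /=; lia.
have nil : i != pred_ord j by rewrite -val_eqE /=; lia.
have nij : i != j by rewrite -val_eqE /=; lia.
have [nli' nlj' nil' nij'] : [/\ pred_ord j != pred_ord i, j != pred_ord i,
  pred_ord j != i & j != i] by split; rewrite eq_sym.
apply/ffunP=> a; rewrite (op_cupE _ _ i0) (op_cupE _ _ j0) /capval.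
rewrite !(op_cupE _ _ i0) !(op_cupE _ _ j0) !upd_other // /capval.
set c := cup _ _ _; set d := cup _ _ _.
have E (s t s' t' : 'I_2) :
    upd (upd (upd (upd a (pred_ord i) s) i t) (pred_ord j) s') j t' =
    upd (upd (upd (upd a (pred_ord j) s') j t') (pred_ord i) s) i t.
  apply/ffunP=> x; rewrite !ffunE.
  have [->|_] := eqVneq x j; first by rewrite (negPf nlj') (negPf nij').
  by have [->|] := eqVneq x (pred_ord j); first by rewrite (negPf nli') (negPf nil').
by rewrite !E; ring.
Qed.

Lemma capval_updf x y z (v : word n -> F) a c : z != x -> z != y ->
  capval x y v (upd a z c) = capval x y (fun b => v (upd b z c)) a.
Proof.
move=> zx zy; rewrite /capval ![upd (upd a z c) x _]upd_comm //.
by rewrite ![upd (upd _ z c) y _]upd_comm.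
Qed.

Let opc x y (v : word n -> F) a := - cup q (a x) (a y) * capval x y v a.

(** The two zigzag identities between cup and cap. [opc] extends the formula of [op_cupE] to any
    pair of positions, so that both neighbours of U_i are covered. *)
Lemma capval_zigzag x y z (v : word n -> F) a : x != y -> y != z -> x != z ->
  capval x y (opc y z (opc x y v)) a = capval x y v a /\
  capval x y (opc z x (opc x y v)) a = capval x y v a.
Proof.
move=> xy yz xz; have yx : y != x by rewrite eq_sym.
have zy : z != y by rewrite eq_sym.
have zx : z != x by rewrite eq_sym.
have capvE b : capval x y v b = capval x y v (upd b z (b z)) by rewrite upd_id.
have off b s t : capval x y v (upd (upd b x s) y t) = capval x y v b.
  by rewrite (capval_updr _ _ _ xy) (capval_updl _ _ _ xy).
have off3 b s t c : capval x y v (upd (upd (upd b x s) y t) z c) = capval x y v (upd b z c).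
  by rewrite !(capval_updf _ _ _ zx zy) (capval_updr _ _ _ xy) (capval_updl _ _ _ xy).
have E1 b : opc y z (opc x y v) b = - cup q (b y) (b z) *
    (- cup q (b x) 1 * capval x y v (upd b z 0) + q^-1 * cup q (b x) 0 * capval x y v (upd b z 1)).
  rewrite /opc; congr (_ * _); rewrite {1}/capval /= !(upd_other _ _ yz) !(upd_other _ _ xz).
  rewrite !(upd_other _ _ xy) !upd_same !(capval_updf _ _ _ zx zy) !(capval_updr _ _ _ xy).
  by ring.
have E2 b : opc z x (opc x y v) b = - cup q (b z) (b x) *
    (- cup q 0 (b y) * capval x y v (upd b z 1) + q^-1 * cup q 1 (b y) * capval x y v (upd b z 0)).
  rewrite /opc; congr (_ * _); rewrite {1}/capval /= !(upd_other _ _ yx) !(upd_other _ _ yz).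
  by rewrite !upd_same !(capval_updl _ _ _ xy); ring.
have [az|az] := ord2P (a z); rewrite capvE az; split; rewrite [LHS]/capval.
all: rewrite ?E1 ?E2 !upd_same !(upd_other _ _ xy) !upd_same.
all: rewrite !(upd_other _ _ zy) !(upd_other _ _ zx) az !off3 /cup /=.
all: by field.
Qed.

Lemma tensor_UUU i j v : (0 < i)%N -> (0 < j)%N -> i.+1 = j :> nat \/ j.+1 = i :> nat ->
  op i (op j (op i v)) = op i v.
Proof.
move=> i0 j0 ij; apply/ffunP=> a; rewrite !(op_cupE _ _ i0); congr (_ * _).
have xy := neq_pred i0.
have opE (k : 'I_n) w : (0 < k)%N -> (op k w : word n -> F) = opc (pred_ord k) k w.
  by move=> k0; apply/funext => b; rewrite op_cupE.
rewrite !opE //; case: ij => ij.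
  have e : pred_ord j = i by apply: val_inj; rewrite /= -ij.
  rewrite e; apply: (proj1 (capval_zigzag v a xy _ _)); rewrite -val_eqE /=; lia.
have e : pred_ord i = j by apply: val_inj; rewrite /= -ij.
rewrite e in xy *.
have jl : pred_ord j != j := neq_pred j0.
by apply: (proj2 (capval_zigzag v a xy _ _)); rewrite -?val_eqE /=; lia.
Qed.

End TensorRelations.

(** * Pure tensors and the action of B and C *)

Section ProductVectors.

Variables (F : fieldType) (n : nat).
Implicit Types (f : 'I_n -> 'I_2 -> F) (g h : 'I_2 -> F) (x y : 'I_n).

Definition pvec f : tensorV F n := [ffun a : word n => \prod_i f i (a i)].

Definition slot x f g : 'I_n -> 'I_2 -> F := fun j => if j == x then g else f j.

Lemma eq_pvec f f' : (forall i c, f i c = f' i c) -> pvec f = pvec f'.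
Proof. by move=> ff; apply/ffunP=> a; rewrite !ffunE; apply: eq_bigr => i _; apply: ff. Qed.

Lemma pvec_slot x f g a : pvec (slot x f g) a = g (a x) * \prod_(j | j != x) f j (a j).
Proof.
rewrite ffunE (bigD1 x) //= /slot eqxx; congr (_ * _).
by apply: eq_bigr => j /negPf->.
Qed.

Lemma pvec_slotP (s t : F) x f g h : pvec (slot x f (fun c => s * g c + t * h c)) =
  s *: pvec (slot x f g) + t *: pvec (slot x f h).
Proof.
apply/ffunP=> a; rewrite addFE !scaleFE !pvec_slot.
by rewrite mulrDl !mulrA.
Qed.

Lemma basis_pvec (a : word n) : basis_vector F a = pvec (fun i c => (c == a i)%:R).
Proof.
apply/ffunP=> b; rewrite !ffunE; have [->|] := eqVneq b a.
  by rewrite big1 // => i _; rewrite eqxx.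
move=> bN; have [i /negPf iN] : exists i, b i != a i.
  apply/existsP; apply: contraNT bN; rewrite negb_exists => /forallP h.
  by apply/eqP/ffunP=> j; apply/eqP; have := h j; rewrite negbK.
by rewrite (bigD1 i) //= iN mul0r.
Qed.

Lemma lfun_pvec_ext (W : vectType F) (A B : 'Hom(tensorV F n, W)) :
  (forall f, A (pvec f) = B (pvec f)) -> A = B.
Proof. by move=> AB; apply: lfun_basis_ext => a; rewrite basis_pvec. Qed.

Definition mxapp (M : 'M[F]_2) g : 'I_2 -> F := fun c => \sum_d M c d * g d.

Lemma tensor_op_pvec (T : 'I_n -> 'M[F]_2) f :
  tensor_op T (pvec f) = pvec (fun i => mxapp (T i) (f i)).
Proof.
apply/ffunP=> a; rewrite kernel_opE ffunE bigA_distr_bigA /=.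
by apply: eq_bigr => b _; rewrite ffunE -big_split.
Qed.

Lemma mxapp_diag2 s t g c : mxapp (diag2 s t) g c = (if c == 0 then s else t) * g c.
Proof.
rewrite /mxapp big_ord_recl big_ord1 !mxE; have [->|->] := ord2P c.
  by rewrite /= mul0r addr0.
by rewrite /= mul0r add0r; congr (_ * g _); apply: val_inj.
Qed.

Lemma mxapp1 g c : mxapp 1%:M g c = g c.
Proof.
rewrite /mxapp (bigD1 c) //= mxE eqxx mul1r big1 ?addr0 // => d /negPf dc.
by rewrite mxE eq_sym dc mul0r.
Qed.

Lemma mxapp_E g c : mxapp (E_mx F) g c = if c == 0 then g 1 else 0.
Proof.
rewrite /mxapp big_ord_recl big_ord1 !mxE; have [->|->] := ord2P c.
  by rewrite /= mul0r add0r mul1r; congr (g _); apply: val_inj.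
by rewrite /= !mul0r addr0.
Qed.

Lemma mxapp_F g c : mxapp (F_mx F) g c = if c == 0 then 0 else g 0.
Proof.
rewrite /mxapp big_ord_recl big_ord1 !mxE; have [->|->] := ord2P c.
  by rewrite /= !mul0r addr0.
by rewrite /= mul0r mul1r addr0.
Qed.

Lemma invmx_diag2 (s t : F) : s != 0 -> t != 0 -> invmx (diag2 s t) = diag2 s^-1 t^-1.
Proof.
move=> s0 t0; have AB : diag2 s t *m diag2 s^-1 t^-1 = 1%:M.
  apply/matrixP=> i j; rewrite mxE.
  rewrite -[LHS]/(mxapp (diag2 s t) (fun d => diag2 s^-1 t^-1 d j) i).
  rewrite mxapp_diag2 !mxE; have [->|->] := ord2P i; have [->|->] := ord2P j.
  - by rewrite /= mulfV.
  - by rewrite /= mulr0.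
  - by rewrite /= mulr0.
  by rewrite /= mulfV.
by rewrite -[LHS]mulmx1 -AB mulKmx //; case: (mulmx1_unit AB).
Qed.

End ProductVectors.

Section BOperator.

Variables (F : fieldType) (q : F) (n : nat).
Hypothesis q0 : q != 0.
Implicit Types (f : 'I_n -> 'I_2 -> F).

Lemma K_mxE : K_mx q = diag2 q q^-1.
Proof.
rewrite /K_mx /D1_mx /D2_mx invmx_diag2 ?oner_neq0 //.
apply/matrixP=> i j; rewrite mxE.
rewrite -[LHS]/(mxapp (diag2 q 1) (fun d => diag2 1^-1 q^-1 d j) i) mxapp_diag2 !mxE invr1.
have [->|->] := ord2P i; have [->|->] := ord2P j.
- by rewrite /= mulr1.
- by rewrite /= mulr0.
- by rewrite /= mul1r.
by rewrite /= mul1r.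
Qed.

Lemma Kinv_mxE : invmx (K_mx q) = diag2 q^-1 q.
Proof. by rewrite K_mxE invmx_diag2 ?invr_eq0 // invrK. Qed.

Definition kinv (c : 'I_2) : F := if c == 0 then q^-1 else q.

(** In the i-th summands of q^-1 E K^-1 and of F, the factors before i are K K^-1 = 1 and 1, the
    factors after i are K^-1, and at i the operator q^-1 E K^-1 + F exchanges x and y. *)
Lemma B_op_pvec f : B_op q n (pvec f) = \sum_i pvec (slot i
  (fun j c => if (j < i)%N then f j c else kinv c * f j c) (fun c => f i (flip c))).
Proof.
rewrite /B_op add_lfunE scale_lfunE comp_lfunE /Kinv_op tensor_op_pvec /E_op /F_op.
rewrite !sum_lfunE scaler_sumr -big_split; apply: eq_bigr => i _ /=.
rewrite !tensor_op_pvec.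
pose b (j : 'I_n) c := if (j < i)%N then f j c else kinv c * f j c.
have -> : pvec (fun j => mxapp (if (j < i)%N then K_mx q else if j == i then E_mx F else 1%:M)
    (mxapp (invmx (K_mx q)) (f j))) =
    pvec (slot i b (fun c => if c == 0 then q * f i 1 else 0)).
  apply: eq_pvec => j c; rewrite /slot /b Kinv_mxE K_mxE.
  have [->|ji] := eqVneq j i; first by rewrite ltnn mxapp_E mxapp_diag2.
  case: ifP => _; rewrite ?mxapp1 !mxapp_diag2 // mulrA.
  by case: ifP => _; rewrite ?mulfV ?mulVf // mul1r.
have -> : pvec (fun j => mxapp (if (j < i)%N then 1%:M else if j == i then F_mx F
    else invmx (K_mx q)) (f j)) = pvec (slot i b (fun c => if c == 0 then 0 else f i 0)).
  apply: eq_pvec => j c; rewrite /slot /b Kinv_mxE.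
  have [->|ji] := eqVneq j i; first by rewrite ltnn mxapp_F.
  by case: ifP => _; rewrite ?mxapp1 ?mxapp_diag2.
rewrite -[X in _ + X]scale1r -pvec_slotP; apply: eq_pvec => j c; rewrite /slot.
case: eqP => // _; rewrite /flip; case: ifP => _; last by rewrite mulr0 add0r mul1r.
by rewrite mulr0 addr0 mulKf.
Qed.

Lemma C_op_scale v : C_op q n v = q ^+ n *: v.
Proof.
suff -> : C_op q n = q ^+ n *: \1%VF by rewrite scale_lfunE id_lfunE.
apply: lfun_pvec_ext => f; rewrite scale_lfunE id_lfunE comp_lfunE /D1_op /D2_op !tensor_op_pvec.
apply/ffunP=> a; rewrite scaleFE !ffunE -[n in q ^+ n]card_ord -prodr_const -big_split.
apply: eq_bigr => i _ /=; rewrite /D1_mx /D2_mx !mxapp_diag2.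
by case: ifP => _; rewrite !mul1r.
Qed.

End BOperator.

(** * Product eigenvectors of B *)

Section Eigenvectors.

Variables (F : fieldType) (q : F) (n : nat).
Hypotheses (q0 : q != 0) (q1 : forall m, q ^+ m + 1 != 0) (q2 : forall m, q ^+ m.+1 - 1 != 0).
Implicit Types (s : 'I_n -> bool).

Lemma qB_neq0 : q - q^-1 != 0.
Proof.
have := q2 1; apply: contraNneq => /eqP; rewrite subr_eq0 => /eqP qV.
by rewrite expr2 {2}qV mulfV // subrr.
Qed.

(** The x- and y-coordinates of [eigenfactorP] for the raising factor x + q^m y; [qint_down] does
    the same for x - q^-m y. *)
Lemma qint_up (m : int) : q ^ m + qint q m * q^-1 = qint q (m + 1) /\
  1 + qint q m * (q * q ^ m) = qint q (m + 1) * q ^ m.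
Proof.
have m0 : q ^ m != 0 by rewrite expfz_neq0.
have qB : q * q - 1 != 0 by have := q2 1; rewrite expr2.
rewrite /qint -!invr_expz !expfzDr // !expr1z.
by move: (q ^ m) m0 => x x0; split; field; rewrite q0 x0 qB.
Qed.

Lemma qint_down (m : int) : - q ^ (- m) + qint q m * q^-1 = qint q (m - 1) /\
  1 - qint q m * (q * q ^ (- m)) = - (qint q (m - 1) * q ^ (- m)).
Proof.
have m0 : q ^ m != 0 by rewrite expfz_neq0.
have qB : q * q - 1 != 0 by have := q2 1; rewrite expr2.
rewrite /qint -!invr_expz !expfzDr // -!invr_expz !expr1z.
by move: (q ^ m) m0 => x x0; split; field; rewrite q0 x0 qB.
Qed.

Lemma qpowzD_neq0 (m : int) : q ^ m + q ^ (- m) != 0.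
Proof.
have [[k ->]|[k ->]] : (exists k : nat, m = k) \/ (exists k : nat, m = - k%:Z).
- by case: m => k; [left; exists k|right; exists k.+1; rewrite NegzE].
- rewrite -invr_expz; exact: qpowDV_neq0.
by rewrite opprK addrC -invr_expz; exact: qpowDV_neq0.
Qed.

(* The exponent of the eigenvalue of B on the first t factors. *)
Definition weight s (t : nat) : int := \sum_(j < n | (j < t)%N) (-1) ^+ ~~ s j.

Lemma weightS s (i : 'I_n) : weight s i.+1 = weight s i + (-1) ^+ ~~ s i.
Proof.
rewrite /weight (bigD1 i) //= addrC; congr (_ + _); apply: eq_bigl => j.
by rewrite ltnS -val_eqE ltn_neqAle andbC.
Qed.

Lemma weight0 s : weight s 0 = 0. Proof. exact: big_pred0. Qed.

Lemma eq_weight s s' t : (forall j : 'I_n, (j < t)%N -> s j = s' j) ->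
  weight s t = weight s' t.
Proof. by move=> ss; apply: eq_bigr => j jt; rewrite ss. Qed.

Definition eigenfactor (b : bool) (m : int) (c : 'I_2) : F :=
  if c == 0 then 1 else if b then q ^ m else - q ^ (- m).

Definition eigenvec s : tensorV F n :=
  pvec (fun i : 'I_n => eigenfactor (s i) (weight s i)).

(** If B u = [m] u, then B sends u tensor w to u tensor ([m] K^-1 w + w'), where w' is w with x and
    y exchanged. The factors are the vectors w for which the bracket is [m + 1] w or [m - 1] w. *)
Lemma eigenfactorP b m c :
  eigenfactor b m (flip c) + qint q m * (kinv q c * eigenfactor b m c) =
  qint q (m + (-1) ^+ ~~ b) * eigenfactor b m c.
Proof.
have [u1 u2] := qint_up m; have [d1 d2] := qint_down m.
rewrite /eigenfactor /kinv /flip; have [->|->] := ord2P c; case: b => /=.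
- by rewrite !mulr1 expr0 u1.
- by rewrite !mulr1 expr1 d1.
- by rewrite expr0 u2.
by rewrite expr1 !mulrN d2.
Qed.

Lemma B_op_eigenvec s : B_op q n (eigenvec s) = qint q (weight s n) *: eigenvec s.
Proof.
rewrite /eigenvec B_op_pvec //.
pose f (i : 'I_n) := eigenfactor (s i) (weight s i).
pose b (i j : 'I_n) c := if (j < i)%N then f j c else kinv q c * f j c.
(* [G t] has K^-1 applied to the factors from t on. By [eigenfactorP] the i-th summand of B is H (i
   + 1) - H i, so the sum telescopes to [H n], starting from H 0 = 0 because [0] = 0. *)
pose G (t : nat) := pvec (fun (j : 'I_n) c => if (j < t)%N then f j c else kinv q c * f j c).
pose H t := qint q (weight s t) *: G t.
have Hn : H n = qint q (weight s n) *: pvec f.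
  by congr (_ *: _); apply: eq_pvec => j c; rewrite ltn_ord.
have H0 : H 0%N = 0.
  by rewrite /H weight0 /qint oppr0 subrr mul0r scale0r.
rewrite -Hn; have -> : H n = \sum_(i < n) (H i.+1 - H i).
  by rewrite -(big_mkord predT (fun i => H i.+1 - H i)) telescope_sumr // H0 subr0.
apply: eq_bigr => i _; apply: (canRL (addrK _)).
have G1 : G i.+1 = pvec (slot i (b i) (f i)).
  apply: eq_pvec => j c; rewrite /slot /b ltnS leq_eqVlt val_eqE.
  by case: eqP => [->|].
have G0 : G i = pvec (slot i (b i) (fun c => kinv q c * f i c)).
  by apply: eq_pvec => j c; rewrite /slot /b; case: eqP => [->|] //; rewrite ltnn.
rewrite /H G0 G1 -[X in X + _]scale1r -pvec_slotP.
rewrite -[RHS]addr0 -[in RHS](scale0r (pvec (slot i (b i) (f i)))) -pvec_slotP.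
apply: eq_pvec => j c; rewrite /slot; case: eqP => // _.
by rewrite mul1r mul0r addr0 weightS eigenfactorP.
Qed.

(* In position t the standard basis vectors are combinations of the two possible
   factors of eigenvectors. *)
Lemma eigenvec_span (V : {vspace tensorV F n}) :
  (forall s, eigenvec s \in V) -> V = fullv.
Proof.
move=> eV; pose W (t : nat) s := pvec (fun (i : 'I_n) c =>
  if (i < t)%N then eigenfactor (s i) (weight s i) c else (c == (~~ s i)%:R)%:R).
have WV t s : (t <= n)%N -> W t s \in V.
  move=> tn; rewrite -(subKn tn); move: (n - t)%N (leq_subr t n) => k.
  elim: k s => [|k IH] s kn.
    suff -> : W (n - 0)%N s = eigenvec s by apply: eV.
    by apply: eq_pvec => i c; rewrite subn0 ltn_ord.
  have lt : (n - k.+1 < n)%N by lia.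
  pose i := Ordinal lt.
  have nk : (n - k)%N = i.+1 by rewrite /=; lia.
  pose s' e j := if j == i then e else s j.
  have ws e t' : (t' <= i)%N -> weight (s' e) t' = weight s t'.
    move=> t'i; apply: eq_weight => j jt; rewrite /s'; case: eqP => // ji.
    by move: jt; rewrite ji; lia.
  pose m := weight s i; pose b (j : 'I_n) c : F :=
    if (j < i)%N then eigenfactor (s j) (weight s j) c else (c == (~~ s j)%:R)%:R.
  have WE e : W (n - k)%N (s' e) = pvec (slot i b (eigenfactor e m)).
    apply: eq_pvec => j c; rewrite /slot /b nk ltnS leq_eqVlt val_eqE /s'.
    case: eqP => [->|ji] /=; first by rewrite ws.
    by case: ifP => // jlt; rewrite ws // ltnW.
  have h := qpowzD_neq0 m.
  (* These coefficients come from solving the 2 x 2 system with columns x + q^m y and x - q^-m y,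
     whose determinant is - (q^m + q^-m). *)
  pose x := if s i then q ^ (- m) / (q ^ m + q ^ (- m)) else (q ^ m + q ^ (- m))^-1.
  pose y := if s i then q ^ m / (q ^ m + q ^ (- m)) else - (q ^ m + q ^ (- m))^-1.
  suff -> : W (n - k.+1)%N s = x *: W (n - k)%N (s' true) + y *: W (n - k)%N (s' false).
    by apply: memvD; apply: memvZ; apply: IH; lia.
  rewrite !WE -pvec_slotP; apply: eq_pvec => j c; rewrite /slot /b.
  have [->|//] := eqVneq j i; have -> : (i < n - k.+1)%N = false by rewrite /= ltnn.
  rewrite /x /y /eigenfactor; move: (q ^ m) (q ^ (- m)) h => A A' h.
  by case: (s i); have [->|->] := ord2P c; rewrite /= ?mulr1; field; rewrite h.
apply/eqP; rewrite eqEsubv subvf /=; apply/subvP=> v _.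
rewrite [v]ffun_basisE; apply: memv_suml => a _; apply: memvZ.
suff -> : basis_vector F a = W 0%N (fun i => a i == 0) by apply: WV.
rewrite basis_pvec; apply: eq_pvec => i c /=.
by have [->|->] := ord2P (a i).
Qed.

(** [m] - [m - 2k] = (q^(m-k) + q^-(m-k)) (q^k - q^-k) / (q - q^-1), and q is not a root of
    unity. *)
Lemma qint_neq (m : int) (k : nat) : (0 < k)%N -> qint q m != qint q (m - k%:Z - k%:Z).
Proof.
move=> k0; have m0 : q ^ (m - k%:Z) != 0 by rewrite expfz_neq0.
have k1 : q ^ k%:Z != 0 by rewrite expfz_neq0.
have h := qpowzD_neq0 (m - k%:Z).
have h' : q ^ k%:Z * q ^ k%:Z - 1 != 0.
  by have := q2 (k + k).-1; rewrite prednK ?addn_gt0 ?k0 // exprD.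
rewrite -subr_eq0 /qint -mulrBl mulf_neq0 ?invr_eq0 ?qB_neq0 //.
have -> : m = m - k%:Z + k%:Z by rewrite subrK.
move: h m0; rewrite addrK; move: (m - k%:Z) => t h t0.
move: h; rewrite -!invr_expz !expfzDr // -!invr_expz => h.
suff -> : q ^ t * q ^ k%:Z - (q ^ t * q ^ k%:Z)^-1 -
    (q ^ t * (q ^ k%:Z)^-1 - (q ^ t * (q ^ k%:Z)^-1)^-1) =
  (q ^ t + (q ^ t)^-1) * (q ^ k%:Z * q ^ k%:Z - 1) / q ^ k%:Z.
  by rewrite mulf_neq0 ?invr_eq0 // mulf_neq0.
by move: (q ^ t) (q ^ k%:Z) t0 k1 => x y x0 y0; field; rewrite x0 y0.
Qed.

(** C acts on the whole tensor power by q^n, so the eigenvalue of B alone decides. *)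
Lemma isotypicP (m : int) v : (v \in isotypic q n m) = (B_op q n v == qint q m *: v).
Proof.
have lE (A : 'End(tensorV F n)) c : (v \in passmx.leigenspace A c) = (A v == c *: v).
  rewrite /passmx.leigenspace memv_ker add_lfunE opp_lfunE scale_lfunE id_lfunE.
  by rewrite subr_eq0.
have Cv : C_op q n v == q ^+ n *: v by apply/eqP; exact: C_op_scale.
apply: etrans (memv_cap _ _ _) _.
apply: etrans (congr2 andb (lE (B_op q n) _) (lE (C_op q n) _)) _.
exact: etrans (congr1 (andb _) Cv) (andbT _).
Qed.

End Eigenvectors.

Section EigenIndependence.

Variables (F : fieldType) (W : vectType F) (B : 'End(W)) (I : finType).
Variables (P : pred I) (lam : I -> F).

(** The product of all B - lam_j kills the sum, while it multiplies [u] by the product of the mu -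
    lam_j, which is not zero. *)
Lemma eigen_sum_eq0 (us : I -> W) u mu :
  (forall j, P j -> B (us j) = lam j *: us j) -> B u = mu *: u ->
  (forall j, P j -> mu != lam j) -> u = \sum_(j | P j) us j -> u = 0.
Proof.
move=> Bus Bu muN uE.
pose T (s : seq I) : 'End(W) := foldr (fun j g => ((B - lam j *: \1) \o g)%VF) \1%VF s.
have TE s v nu : B v = nu *: v -> T s v = \prod_(j <- s) (nu - lam j) *: v.
  move=> Bv; elim: s => [|j s IH]; first by rewrite big_nil scale1r id_lfunE.
  rewrite /= comp_lfunE IH add_lfunE opp_lfunE scale_lfunE id_lfunE linearZ /= Bv big_cons.
  by rewrite !scalerA -scalerBl; congr (_ *: _); ring.
have /eqP := TE (enum P) u mu Bu.
rewrite {1}uE linear_sum /= big1 => [|j Pj]; last first.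
  rewrite (TE _ _ _ (Bus j Pj)) (bigD1_seq j) ?enum_uniq ?mem_enum //=.
  by rewrite subrr mul0r scale0r.
rewrite eq_sym scaler_eq0 => /orP[|/eqP//].
rewrite prodf_seq_eq0 => /hasP[j]; rewrite mem_enum => Pj.
by rewrite /= subr_eq0 (negPf (muN j Pj)).
Qed.

End EigenIndependence.

(** * Tensors killed by all U_i on which s_0 acts by a sign *)

Section SymmetricWords.

Variables (F : fieldType) (q : F) (n : nat) (sg : F).
Hypotheses (q0 : q != 0) (sg2 : sg * sg = 1).
Implicit Types (w : word n -> F) (a b : word n) (i j z : 'I_n).

(* The coordinate form of s_0 w = sg w and U_i w = 0. *)
Definition sgn_symmetric w :=
  (forall z a, z = 0%N :> nat -> w (upd a z (flip (a z))) = sg * w a) /\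
  (forall i a (l := pred_ord i), (0 < i)%N ->
     w (upd (upd a l 0) i 1) = q * w (upd (upd a l 1) i 0)).

(** The first y of a word can be moved one place to the left, at the cost of a factor q, or turned
    into x when it stands in position 0. Weighting a y in position i by i + 1 makes [mu] decrease in
    both moves, until only the word x ... x is left. *)
Lemma sgn_symmetric_eq0 w : sgn_symmetric w -> w [ffun=> 0] = 0 -> forall a, w a = 0.
Proof.
move=> [wz wi] w0; pose mu a : nat := (\sum_(i < n) a i * i.+1)%N.
have muE a x c : (mu (upd a x c) + a x * x.+1 = mu a + c * x.+1)%N.
  rewrite /mu (bigD1 x) //= [in RHS](bigD1 x) //= upd_same.
  have -> : (\sum_(i < n | i != x) upd a x c i * i.+1 = \sum_(i < n | i != x) a i * i.+1)%N.
    by apply: eq_bigr => i ix; rewrite upd_other.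
  by rewrite addnAC [RHS]addnAC; congr (_ + _)%N; apply: addnC.
move=> a; have [m] := ubnP (mu a); elim: m a => // m IH a am.
have [/existsP[i0 ai0]|] := boolP [exists i, a i != 0]; last first.
  rewrite negb_exists => /forallP h; rewrite -w0; congr w; apply/ffunP=> i.
  by rewrite ffunE; apply/eqP; have := h i; rewrite negbK.
case: (@arg_minnP _ i0 (fun i => a i != 0) (@nat_of_ord n) ai0) => i ai imin.
have ai1 : a i = 1 by case: (ord2P (a i)) ai => ->.
have [iz|i_gt0] := posnP i.
  have E : w (upd a i (flip (a i))) = 0.
    by apply: IH; have := muE a i (flip (a i)); rewrite ai1 /=; lia.
  by have := wz i a iz; rewrite E => /esym/eqP; rewrite mulf_eq0 => /orP[/eqP sg0|/eqP//];
    move: sg2 => /eqP; rewrite sg0 mul0r eq_sym oner_eq0.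
have al : a (pred_ord i) = 0.
  apply/eqP; apply: contraTT (i_gt0) => /imin /=; lia.
have aE : upd (upd a (pred_ord i) 0) i 1 = a by rewrite -al upd_id -ai1 upd_id.
rewrite -[a in LHS]aE wi // IH ?mulr0 //.
have := muE a (pred_ord i) 1; have := muE (upd a (pred_ord i) 1) i 0.
rewrite upd_other ?al ?ai1 /=; last by rewrite eq_sym neq_pred.
by lia.
Qed.

Lemma sgn_symmetricB w w' c : sgn_symmetric w -> sgn_symmetric w' ->
  sgn_symmetric (fun a => w a - c * w' a).
Proof.
move=> [wz wi] [wz' wi']; split=> [z a z0|i a l i0].
  by rewrite wz // wz' //; ring.
by rewrite wi // wi' //; ring.
Qed.

Lemma sgn_symmetric_uniq w w' : sgn_symmetric w -> sgn_symmetric w' -> w' [ffun=> 0] = 1 ->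
  forall a, w a = w [ffun=> 0] * w' a.
Proof.
move=> sw sw' w'0 a; apply/eqP; rewrite -subr_eq0; apply/eqP.
apply: (@sgn_symmetric_eq0 (fun a => w a - w [ffun=> 0] * w' a)).
  exact: sgn_symmetricB.
by rewrite w'0 mulr1 subrr.
Qed.

Local Notation op := (@letter_op F q n).

Lemma sgn_symmetricP (v : tensorV F n) :
  (forall z, z = 0%N :> nat -> op z v = sg *: v) ->
  (forall i, (0 < i)%N -> op i v = 0) -> sgn_symmetric v.
Proof.
move=> vz vi; split=> [z a z0|i a l i0].
  by rewrite -(op_dotE q v a z0) vz // scaleFE.
have lr := neq_pred i0; have /ffunP/(_ (upd (upd a l 0) i 1)) := vi i i0.
rewrite op_cupE // [RHS]ffunE upd_same (upd_other _ _ lr) upd_same /cup /=.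
move/eqP; rewrite mulf_eq0 oppr_eq0 oner_eq0 /= (capval_updr q _ _ _ lr) (capval_updl q _ _ _ lr).
rewrite /capval subr_eq0 => /eqP ->.
by rewrite mulrA mulfV // mul1r.
Qed.

End SymmetricWords.

(** * The projection onto an extreme isotypic component *)

Section Projection.

Variables (F : fieldType) (q : F) (n : nat) (e : bool).
Hypotheses (q0 : q != 0) (q1 : forall m, q ^+ m + 1 != 0) (q2 : forall m, q ^+ m.+1 - 1 != 0).
Local Notation op := (@letter_op F q n).
Local Notation sg := ((-1) ^+ (~~ e) : F).

Implicit Types (a b : word n) (i j z : 'I_n) (s : 'I_n -> bool).

Let ev : tensorV F n := eigenvec q (fun=> e).

Lemma sign2 : sg * sg = 1.
Proof. by rewrite -expr2 sqrr_sign. Qed.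

Lemma weight_const (s : 'I_n -> bool) t : (t <= n)%N ->
  (forall j : 'I_n, (j < t)%N -> s j = e) -> weight s t = if e then t%:Z else - t%:Z.
Proof.
elim: t => [|t IH] tn st; first by rewrite weight0; case: (e).
rewrite (weightS s (Ordinal tn)) /= IH ?(ltnW tn) // => [|j jt]; last by apply: st; rewrite ltnW.
rewrite st //; case: (e) => /=; first by rewrite expr0 intS addrC.
by rewrite expr1 intS opprD addrC.
Qed.

Let g (i : 'I_n) (c : 'I_2) : F := if c == 0 then 1 else sg * q ^+ i.

(** For the constant sign [e] the weight before position i is i or -i, and in the second case the
    factor is x - q^(-(-i)) y = x - q^i y. *)
Lemma eigenvec_const : ev = pvec g.
Proof.
apply: eq_pvec => i c; rewrite /eigenfactor /g weight_const ?(ltnW (ltn_ord i)) //.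
by case: (e); rewrite /= ?expr0 ?mul1r // opprK expr1 mulN1r.
Qed.

Lemma pvecD1 (f : 'I_n -> 'I_2 -> F) x a : pvec f a = f x (a x) * \prod_(j | j != x) f j (a j).
Proof. by rewrite ffunE (bigD1 x). Qed.

Lemma pvec_upd (f : 'I_n -> 'I_2 -> F) x c a :
  pvec f (upd a x c) = f x c * \prod_(j | j != x) f j (a j).
Proof.
rewrite (pvecD1 _ x) upd_same; congr (_ * _).
by apply: eq_bigr => j jx; rewrite upd_other.
Qed.

Lemma pvec_upd2 (f : 'I_n -> 'I_2 -> F) x y c d a : x != y ->
  pvec f (upd (upd a x c) y d) =
  f y d * (f x c * \prod_(j | (j != y) && (j != x)) f j (a j)).
Proof.
move=> xy; rewrite pvec_upd (bigD1 x) //= upd_same; congr (_ * (_ * _)).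
by apply: eq_bigr => j /andP[jy jx]; rewrite upd_other.
Qed.

Lemma op_dot_eigenvec z : z = 0%N :> nat -> op z ev = sg *: ev.
Proof.
move=> z0; apply/ffunP=> a; rewrite scaleFE op_dotE // eigenvec_const.
rewrite pvec_upd (pvecD1 _ z) mulrA; congr (_ * _).
by rewrite /g z0 expr0 mulr1; have [->|->] := ord2P (a z); rewrite /= ?mulr1 ?sign2.
Qed.

(** The cap contributes sg q^(i-1) from y x and - q^-1 sg q^i from x y. *)
Lemma op_cup_eigenvec i : (0 < i)%N -> op i ev = 0.
Proof.
move=> i0; have lr := neq_pred i0.
apply/ffunP=> a; rewrite [RHS]ffunE op_cupE // eigenvec_const /capval !pvec_upd2 //.
rewrite /g /= !mul1r; have -> : q ^+ i = q * q ^+ i.-1 by rewrite -exprS prednK.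
by rewrite [X in _ * (_ - X)]mulrA -[q^-1 * _]mulrCA mulKf // subrr mulr0.
Qed.

Section IsProjection.

Variable p : 'End(tensorV F n).
Hypothesis dot_p : forall z v, z = 0%N :> nat -> op z (p v) = sg *: p v.
Hypothesis p_dot : forall z v, z = 0%N :> nat -> p (op z v) = sg *: p v.
Hypothesis cup_p : forall i v, (0 < i)%N -> op i (p v) = 0.
Hypothesis p_cup : forall i v, (0 < i)%N -> p (op i v) = 0.
Hypothesis p_ev : p ev = ev.

Let w0 : word n := [ffun=> 0].

Lemma eigenvec_sgn_symmetric : sgn_symmetric q sg ev.
Proof.
apply: sgn_symmetricP => // [z z0|i i0]; [exact: op_dot_eigenvec|exact: op_cup_eigenvec].
Qed.

Lemma eigenvec_word0 : ev w0 = 1.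
Proof. by rewrite eigenvec_const ffunE big1 // => i _; rewrite /w0 ffunE. Qed.

Lemma proj_line v : p v = p v w0 *: ev.
Proof.
apply/ffunP=> a; rewrite scaleFE.
have sp : sgn_symmetric q sg (p v); last first.
  exact: (sgn_symmetric_uniq q0 sign2 sp eigenvec_sgn_symmetric eigenvec_word0).
by apply: sgn_symmetricP => // [z z0|i i0]; [exact: dot_p|exact: cup_p].
Qed.

(** The functional v |-> (p v)(w0) on the basis of words. By [proj_line] it determines [p], and the
    rules for products with [p] on the left show that it is itself a multiple of v_e. *)
Let psi a : F := p (basis_vector F a) w0.

Lemma op_dot_basis z a : z = 0%N :> nat ->
  op z (basis_vector F a) = basis_vector F (upd a z (flip (a z))).
Proof.
move=> z0; apply/ffunP=> b; rewrite op_dotE // !ffunE; congr (_%:R).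
suff -> : (upd b z (flip (b z)) == a) = (b == upd a z (flip (a z))) by [].
apply/eqP/eqP => [<-|->]; by rewrite upd_upd upd_same flipK upd_id.
Qed.

Lemma op_cup_basis i a (l := pred_ord i) : (0 < i)%N ->
  op i (basis_vector F (upd (upd a l 0) i 1)) =
  q^-1 *: basis_vector F (upd (upd a l 0) i 1) - basis_vector F (upd (upd a l 1) i 0).
Proof.
move=> i0; have lr : l != i := neq_pred i0.
have rl : i != l by rewrite eq_sym.
have bl (b : word n) c d : upd (upd b l c) i d l = c by rewrite upd_other // upd_same.
have br (b : word n) c d : upd (upd b l c) i d i = d by rewrite upd_same.
have uu (b : word n) c d c' d' : upd (upd (upd (upd b l c) i d) l c') i d' = upd (upd b l c') i d'.
  by rewrite -[upd (upd (upd b l c) i d) l c']upd_comm // !upd_upd.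
have ui (b : word n) : upd (upd b l (b l)) i (b i) = b by rewrite upd_id upd_id.
pose off (b : word n) := upd (upd b l 0) i 1 == upd (upd a l 0) i 1.
have offE (b : word n) c d : off (upd (upd b l c) i d) = off b by rewrite /off uu.
have bE (b : word n) c d : (b == upd (upd a l c) i d) = [&& b l == c, b i == d & off b].
  apply/eqP/and3P => [->|[/eqP bc /eqP bd /eqP h]].
    by rewrite bl br offE /off !eqxx.
  by rewrite -(ui b) bc bd -(uu b 0 1) h uu.
apply/ffunP=> b; rewrite op_cupE // /capval.
have bvE (c d : word n) : basis_vector F c d = (d == c)%:R by rewrite ffunE.
rewrite addFE scaleFE.
have -> : (- basis_vector F (upd (upd a l 1) i 0)) b = - basis_vector F (upd (upd a l 1) i 0) b.
  by rewrite ffunE.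
rewrite 4!bvE 4!bE -/l !bl !br !offE /cup.
by have [->|->] := ord2P (b l); have [->|->] := ord2P (b i); case: (off b); rewrite /=; field.
Qed.

(** The matrices of s_0 and U_i in the basis of words are symmetric, so this functional satisfies
    the same equations as the vectors in the image of [p]. *)
Lemma psi_sgn_symmetric : sgn_symmetric q sg psi.
Proof.
split=> [z a z0|i a l i0]; first by rewrite /psi -op_dot_basis // p_dot // scaleFE.
have := p_cup (basis_vector F (upd (upd a l 0) i 1)) i0.
rewrite op_cup_basis // linearB linearZ /= => /ffunP/(_ w0).
rewrite addFE scaleFE [RHS]ffunE => /eqP.
have -> : (- p (basis_vector F (upd (upd a l 1) i 0))) w0 = - psi (upd (upd a l 1) i 0).
  by rewrite ffunE.
by rewrite subr_eq0 => /eqP <-; rewrite mulVKf.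
Qed.

Lemma proj_pvec f : p (pvec f) w0 = psi w0 * \prod_i \sum_c f i c * g i c.
Proof.
rewrite [pvec f]ffun_basisE linear_sum sum_ffunE bigA_distr_bigA mulr_sumr /=.
apply: eq_bigr => a _; rewrite linearZ /= scaleFE -/(psi a).
rewrite (sgn_symmetric_uniq q0 sign2 psi_sgn_symmetric eigenvec_sgn_symmetric eigenvec_word0).
by rewrite eigenvec_const !ffunE mulrCA -big_split.
Qed.

Lemma proj_eigenvec s : (exists i, s i != e) -> p (eigenvec q s) = 0.
Proof.
case=> i0 si0; case: (@arg_minnP _ i0 (fun i => s i != e) (@nat_of_ord n) si0) => i si imin.
rewrite proj_line proj_pvec (bigD1 i) //=.
suff -> : \sum_c eigenfactor q (s i) (weight s i) c * g i c = 0 by rewrite mul0r mulr0 scale0r.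
have sj (j : 'I_n) : (j < i)%N -> s j = e.
  by move=> ji; apply/eqP; apply: contraTT ji => /imin; rewrite leqNgt.
rewrite weight_const ?(ltnW (ltn_ord i)) // big_ord_recl big_ord1 /g /eigenfactor /= mulr1.
have qi : q ^+ i != 0 by rewrite expf_neq0.
have -> : s i = ~~ e by case: (s i) si => //; case: (e).
have E : q ^ (- i%:Z) * q ^+ i = 1 by rewrite -invr_expz mulVf.
case: (e) => /=; first by rewrite expr0 mul1r mulNr E subrr.
by rewrite expr1 mulN1r mulrN E subrr.
Qed.

Let tgt : int := if e then n%:Z else - n%:Z.

Lemma weight_ends s : weight s n = n%:Z - (#|[pred i | ~~ s i]|).*2%:Z.
Proof.
have -> : weight s n = \sum_(i < n) (1 - (~~ s i).*2%:Z).
  by apply: eq_big => i; rewrite ?ltn_ord //; case: (s i).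
rewrite sumrB sumr_const card_ord; congr (_ - _); first by rewrite natz.
rewrite -sum1_card -muln2 big_distrl /= [in RHS]big_mkcond /=.
rewrite (big_morph Posz PoszD (erefl _)); apply: eq_bigr => i _.
by rewrite inE; case: (s i).
Qed.

Lemma is_isotypic_projectionP : is_isotypic_projection q tgt p.
Proof.
pose C : {vspace tensorV F n} :=
  (\sum_(j < n.+1 | n%:Z - j.*2%:Z != tgt) isotypic q n (n%:Z - j.*2%:Z))%VS.
(* [n] and [-n] are at the two ends of the list of the [n - 2j]. The gap in [qint_neq] is k = j for
   the first, and k = n - j for the second, since -n = (n - 2j) - 2(n - j). *)
have tgtE (j : 'I_n.+1) : n%:Z - j.*2%:Z != tgt -> qint q tgt != qint q (n%:Z - j.*2%:Z).
  rewrite /tgt; case: (e) => jn.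
    have j0 : (0 < j)%N by rewrite lt0n; apply: contraNneq jn => ->; rewrite subr0.
    have -> : n%:Z - j.*2%:Z = n%:Z - j%:Z - j%:Z by lia.
    exact: qint_neq.
  have jn' : (j < n)%N.
    by rewrite ltn_neqAle -ltnS ltn_ord andbT; apply: contraNneq jn => ->; apply/eqP; lia.
  rewrite eq_sym; have -> : - n%:Z = n%:Z - j.*2%:Z - (n - j)%N%:Z - (n - j)%N%:Z by lia.
  by apply: qint_neq; rewrite // subn_gt0.
have AC0 u : u \in isotypic q n tgt -> u \in C -> u = 0.
  rewrite isotypicP => /eqP Bu /memv_sumP[us usC uE].
  apply: (@eigen_sum_eq0 F _ (B_op q n) _ _
    (fun j : 'I_n.+1 => qint q (n%:Z - j.*2%:Z)) us u) Bu _ uE.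
    by move=> j /usC; rewrite isotypicP => /eqP.
  by move=> j /tgtE.
have evA : ev \in isotypic q n tgt.
  by rewrite isotypicP B_op_eigenvec // weight_const.
(* Taking the complement inside [C] and the kernel of [p] at once settles all claims: [ev] lies in
   the target eigenspace, which meets [C] only in 0, so a vector of [C] has no component along [ev],
   and a vector of the target has no other component. *)
have full : (<[ev]> + (C :&: lker p))%VS = fullv.
  apply: (eigenvec_span q0 q1) => s.
  have [/forallP se|] := boolP [forall i, s i == e].
    rewrite -[X in X \in _]addr0 memv_add ?mem0v //.
    suff -> : eigenvec q s = ev by exact: memv_line.
    by congr eigenvec; apply/funext => i; apply/eqP.
  rewrite negb_forall => /existsP se.
  rewrite -[X in X \in _]add0r memv_add ?mem0v // memv_cap memv_ker proj_eigenvec // eqxx andbT.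
  pose k := #|[pred i | ~~ s i]|.
  have kn : (k < n.+1)%N by rewrite ltnS -[n in (_ <= n)%N]card_ord max_card.
  have sk : eigenvec q s \in isotypic q n (n%:Z - (Ordinal kn).*2%:Z).
    by rewrite isotypicP B_op_eigenvec // weight_ends.
  apply: (subvP (sumv_sup (Ordinal kn) _ (subvv _))) sk; rewrite /= /tgt.
  case: se => i; case: (e) => si.
    suff : (0 < k)%N by move=> k0; apply/eqP; lia.
    by rewrite /k (cardD1 i) inE; move: si; case: (s i).
  suff : (k < n)%N by move=> k0; apply/eqP; lia.
  rewrite -[n in (_ < n)%N]card_ord; apply: proper_card; apply/properP; split.
    by apply/subsetP.
  by exists i => //; rewrite inE; move: si; case: (s i).
have dec v : exists c w, v = c *: ev + w /\ (w \in C /\ p w = 0).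
  have : v \in (<[ev]> + (C :&: lker p))%VS by rewrite full memvf.
  case/memv_addP=> u /vlineP[c ->] [w]; rewrite memv_cap memv_ker => /andP[wC /eqP pw] ->.
  by exists c, w.
split.
- apply/eqP; rewrite eqEsubv subvf -full; apply: addvS; last exact: capvSl.
  by rewrite -memvE.
- apply/eqP; rewrite -subv0; apply/subvP=> u /memv_capP[uA uC].
  by rewrite memv0 (AC0 _ uA uC).
- move=> v vA; have [c [w [vE [wC pw]]]] := dec v.
  have w0' : w = 0.
    apply: AC0 wC; have -> : w = v - c *: ev by rewrite vE addrC addKr.
    by rewrite memvB // memvZ.
  by rewrite vE w0' addr0 linearZ /= p_ev.
- move=> v vC; have [c [w [vE [wC pw]]]] := dec v.
  have c0 : c *: ev = 0.
    apply: AC0; first exact: memvZ.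
    have -> : c *: ev = v - w by rewrite vE addrK.
    exact: memvB.
  by rewrite vE c0 add0r.
Qed.

End IsProjection.

End Projection.

Section JonesWenzlProjection.

Variables (F : fieldType) (q : F) (n : nat).
Hypotheses (q0 : q != 0) (q1 : forall m, q ^+ m + 1 != 0) (q2 : forall m, q ^+ m.+1 - 1 != 0).
Hypothesis n0 : (0 < n)%N.

Let rep (a : TLB (q + q^-1) n) : 'End(tensorV F n) := TLB_on_tensorV a.

Let repM : forall (a b : TLB (q + q^-1) n) v, rep (a * b) v = rep a (rep b v) :=
  TLB_repM (@tensor_UU F q n q0) (@tensor_UUU F q n q0) (@tensor_UUC F q n q0)
    (@tensor_ss F q n) (@tensor_UsU F q n) (@tensor_sU F q n q0).
Let repD : forall (a b : TLB (q + q^-1) n) v, rep (a + b) v = rep a v + rep b v :=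
  TLB_repD (@tensor_UU F q n q0) (@tensor_UUU F q n q0) (@tensor_UUC F q n q0)
    (@tensor_ss F q n) (@tensor_UsU F q n) (@tensor_sU F q n q0).
Let repZ : forall c (a : TLB (q + q^-1) n) v, rep (c *: a) v = c *: rep a v :=
  TLB_repZ (@tensor_UU F q n q0) (@tensor_UUU F q n q0) (@tensor_UUC F q n q0)
    (@tensor_ss F q n) (@tensor_UsU F q n) (@tensor_sU F q n q0).
Let rep1 : forall v, rep 1 v = v :=
  TLB_rep1 (@tensor_UU F q n q0) (@tensor_UUU F q n q0) (@tensor_UUC F q n q0)
    (@tensor_ss F q n) (@tensor_UsU F q n) (@tensor_sU F q n q0).
Let repG : forall (i : 'I_n) v, rep (TLB_gen (q + q^-1) n i) v = letter_op q i v :=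
  TLB_rep_gen (@tensor_UU F q n q0) (@tensor_UUU F q n q0) (@tensor_UUC F q n q0)
    (@tensor_ss F q n) (@tensor_UsU F q n) (@tensor_sU F q n q0).

(** The line of v_e affords the character chi; as chi(b) = 1, the idempotent b fixes v_e. *)
Lemma rep_eigenvec (e : bool) (a : TLB (q + q^-1) n) :
  rep a (eigenvec q (fun=> e)) = TLB_chi ((-1) ^+ (~~ e)) a *: eigenvec q (fun=> e).
Proof.
have ee := sign2 F e; set sg : F := (-1) ^+ (~~ e) in ee *; set v := eigenvec q _.
elim/TLB_ind: a => [x y ex ey|c x ex||i x ex].
- rewrite repD ex ey (TLB_chiD ee) scalerDl; exact: erefl.
- rewrite repZ ex (TLB_chiZ ee) scalerA; exact: erefl.
- rewrite rep1 (TLB_chi1 _ _ ee) scale1r; exact: erefl.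
apply: etrans (repM _ _ _) _.
apply: etrans (congr1 _ ex) _; apply: etrans (repG _ _) _; rewrite linearZ /=.
rewrite (TLB_chiM ee) (TLB_chi_gen _ ee (ltn_ord i)).
case: eqP => [i0|/eqP]; last rewrite -lt0n => i0.
  by rewrite op_dot_eigenvec // scalerA mulrC.
by rewrite op_cup_eigenvec // scaler0 mul0r scale0r.
Qed.

Lemma TLB_jw_projection (e : bool) :
  is_isotypic_projection q (if e then n%:Z else - n%:Z)
    (TLB_on_tensorV (TLB_jw q ((-1) ^+ (~~ e)) n)).
Proof.
have ee := sign2 F e.
have [_ Ub bU sb bs] := TLB_jwP q0 q1 ee n0.
have chib := TLB_jw_chi q1 n ee.
set b := TLB_jw q _ n in Ub bU sb bs chib *.
have rep0 v : rep 0 v = 0 by have := repZ 0 0 v; rewrite !scale0r.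
apply: (is_isotypic_projectionP q0 q1 q2).
- move=> z v z0; rewrite -[LHS]repG -repM -repZ; congr (rep _ v).
  by rewrite z0; exact: sb.
- move=> z v z0; rewrite -[letter_op q z v]repG -repM -repZ; congr (rep _ v).
  by rewrite z0; exact: bs.
- move=> i v i0; rewrite -[LHS]repG -repM -[RHS](rep0 v); congr (rep _ v).
  by apply: Ub; rewrite i0 ltn_ord.
- move=> i v i0; rewrite -[letter_op q i v]repG -repM -[RHS](rep0 v); congr (rep _ v).
  by apply: bU; rewrite i0 ltn_ord.
by rewrite [LHS]rep_eigenvec chib scale1r.
Qed.

End JonesWenzlProjection.

Lemma eq_unique_nz_idempotent (A : nzRingType) (P Q : A -> Prop) (b : A) :
  (forall x, P x <-> Q x) -> is_unique_nz_idempotent P b -> is_unique_nz_idempotent Q b.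
Proof.
move=> PQ [b0 bb Pb bU]; split=> //; first exact/PQ.
by move=> x x0 xx /PQ; apply: bU.
Qed.

(** * Specialization to q = X over the complex numbers *)

Section Main.

Variable R : realType.

Let two0 : 2 != 0 :> R[i]. Proof. by rewrite pnatr_eq0. Qed.
Let q0 : qvar R != 0 := fracX_neq0 R[i].
Let q1 : forall m, qvar R ^+ m + 1 != 0 := @fracX_add1 R[i] two0.

Lemma int_laurent_in (f : Cq R) : @int_laurent R[i] f -> in_integral_laurent f.
Proof.
move=> fi; have [N [a [P [Q [Q0 fE aE]]]]] := int_laurent_expansion fi.
by exists N, a, P, Q; split.
Qed.

Lemma TLB_jwD_coef n (D : diagram n) : (0 < n)%N ->
  in_integral_laurent (diagram_coef (TLB_jwD (qvar R) n) D).
Proof.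
move=> n0; apply: int_laurent_in.
have S0 : @int_laurent R[i] 0 by have := int_laurent_int R[i] 0; rewrite rmorph0 tofrac0.
have S1 : @int_laurent R[i] 1 by have := int_laurent_int R[i] 1; rewrite rmorph1 tofrac1.
apply: (diagram_coef_form S0 S1 (@int_laurentD R[i]) (@int_laurentM R[i])).
  exact: int_laurent_delta.
apply: (TLB_jwD_form q0 q1 S1 (@int_laurentN R[i]) _ _ n0).
  exact: (int_laurent_deltaV two0).
exact: (int_laurent_jw_coef two0).
Qed.

End Main.

Theorem theoremB (R : realType) :
  let q : Cq R := qvar R in
  let TL (n : nat) := TLB (q + q^-1) n in
  let s0 (n : nat) : TL n := TLB_gen (q + q^-1) n 0 in
  let U (n i : nat) : TL n := TLB_gen (q + q^-1) n i in
  exists bp bm : forall n : nat, TL n,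
  let d (n : nat) : TL n := bp n + bm n in
  (forall n : nat, (1 <= n)%N ->
    [/\ is_isotypic_projection q n%:Z (TLB_on_tensorV (bp n)),
        is_isotypic_projection q (- n%:Z) (TLB_on_tensorV (bm n)),
        is_unique_nz_idempotent (fun b : TL n =>
          [/\ forall i : nat, (1 <= i < n)%N -> U n i * b = 0 /\ b * U n i = 0,
              b * s0 n = b & s0 n * b = b]) (bp n)
      & is_unique_nz_idempotent (fun b : TL n =>
          [/\ forall i : nat, (1 <= i < n)%N -> U n i * b = 0 /\ b * U n i = 0,
              b * s0 n = - b & s0 n * b = - b]) (bm n)]
    /\
    is_unique_nz_idempotent (fun b : TL n =>
      TLD b /\
      forall u : TL n, TLD_generator u -> u * b = 0 /\ b * u = 0) (d n)
    /\
    forall D : diagram n, in_integral_laurent (diagram_coef (d n) D))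
  /\ d 1%N = 1
  /\ d 2%N = 1 - (q + q^-1)^-1 *: U 2%N 1%N - (q + q^-1)^-1 *: U0 (q + q^-1) 2
  /\ (forall n : nat, (2 <= n)%N ->
        d n.+1 = TLB_embed (d n)
          - ((q ^+ n.-1 + q ^- n.-1) / (q ^+ n + q ^- n))
            *: (TLB_embed (d n) * U n.+1 n * TLB_embed (d n))).
Proof.
move=> q TL s0 U.
have q0 : q != 0 := fracX_neq0 R[i].
have two0 : 2 != 0 :> R[i] by rewrite pnatr_eq0.
have q1 m : q ^+ m + 1 != 0 := @fracX_add1 R[i] two0 m.
have q2 m : q ^+ m.+1 - 1 != 0 := @fracX_sub1 R[i] m.
have e1 : 1 * 1 = 1 :> Cq R := mulr1 1.
have eN1 : -1 * -1 = 1 :> Cq R by rewrite mulrNN mulr1.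
exists (fun n => TLB_jw q 1 n), (fun n => TLB_jw q (-1) n) => d.
split; last split; last split.
- move=> n n0; split; last split.
  + split.
    * exact: (TLB_jw_projection q0 q1 q2 n0 true).
    * exact: (TLB_jw_projection q0 q1 q2 n0 false).
    * apply: eq_unique_nz_idempotent (TLB_jw_unique q0 q1 e1 n0) => x.
      by split=> -[Ux xs sx]; (split; first exact: Ux);
        [apply: etrans xs _|apply: etrans sx _|apply: etrans xs _|apply: etrans sx _];
        rewrite scale1r.
    * apply: eq_unique_nz_idempotent (TLB_jw_unique q0 q1 eN1 n0) => x.
      by split=> -[Ux xs sx]; (split; first exact: Ux);
        [apply: etrans xs _|apply: etrans sx _|apply: etrans xs _|apply: etrans sx _];
        rewrite scaleN1r.
  + exact: TLB_jwD_unique.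
  + by move=> D; apply: TLB_jwD_coef.
- exact: TLB_jwD1.
- exact: TLB_jwD2.
- exact: TLB_jwDS.
Qed.
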